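(* Let $n\ge 2$ and let $\mathbf{p}=(\mathbf{p}_1,\dots,\mathbf{p}_N)$, $\mathbf{q}=(\mathbf{q}_1,\dots,\mathbf{q}_N)$ be configurations of points in $\mathbb{E}^n$ with $|\mathbf{p}_i-\mathbf{p}_j|\le|\mathbf{q}_i-\mathbf{q}_j|$ for all $1\le i<j\le N$. Then $$M_n[\mathrm{Conv}\{\mathbf{q}_1,\dots,\mathbf{q}_N\}]\ge M_n[\mathrm{Conv}\{\mathbf{p}_1,\dots,\mathbf{p}_N\}],$$ and if $\mathbf{p}$ and $\mathbf{q}$ are not congruent, the inequality is strict.
   Context: For a compact convex set $K\subset\mathbb{E}^n$, its (unnormalized) mean width is $M_n[K]=\int_{S^{n-1}}\max\{\langle x,u\rangle: x\in K\}\,d\sigma(u)$, where $\sigma$ is the Lebesgue (surface) measure on the unit sphere $S^{n-1}$ and $\langle\cdot,\cdot\rangle$ is the standard inner product. $\mathrm{Conv}$ denotes convex hull. Congruent means there is an isometry of $\mathbb{E}^n$ mapping $\mathbf{p}_i$ to $\mathbf{q}_i$ for every $i$. *)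

(* Defs.v *)
From HB Require Import structures.
From mathcomp Require Import all_boot all_order all_algebra.
From mathcomp Require Import all_classical all_reals all_analysis.
Set Implicit Arguments.
Unset Strict Implicit.
Unset Printing Implicit Defensive.
Import Order.TTheory GRing.Theory Num.Theory.
Local Open Scope classical_set_scope.
Local Open Scope ring_scope.

Section Defs.
Variable R : realType.

Definition dotp (n : nat) (x y : 'rV[R]_n) : R := \sum_(i < n) x 0 i * y 0 i.

(* Euclidean norm |x| (NB: the library norm `|x| on 'rV is the sup norm) *)
Definition enorm (n : nat) (x : 'rV[R]_n) : R := Num.sqrt (dotp x x).

Definition conv_hull (n N : nat) (p : 'I_N -> 'rV[R]_n) : set 'rV[R]_n :=
  [set x | exists l : 'I_N -> R,
      (forall i, 0 <= l i) /\ \sum_(i < N) l i = 1 /\ x = \sum_(i < N) l i *: p i].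

(* support function h_K(u) = max { <x,u> : x in K } (sup = max for compact K) *)
Definition support_fun (n : nat) (K : set 'rV[R]_n) (u : 'rV[R]_n) : R :=
  sup [set dotp x u | x in K].

(* Lebesgue integral over E^n, defined as the iterated one-dimensional
   Lebesgue integral (Fubini--Tonelli); 'rV_(n.+1) = 'rV_(1 + n) via row_mx. *)
Fixpoint leb_int (n : nat) : ('rV[R]_n -> \bar R) -> \bar R :=
  match n return ('rV[R]_n -> \bar R) -> \bar R with
  | 0%N => fun f => f 0
  | n'.+1 => fun f =>
      (\int[@lebesgue_measure R]_(t in [set: R])
          leb_int (fun v : 'rV[R]_n' => f (row_mx (\row_(j < 1) t) v)))%E
  end.

(* Integral over S^{n-1} w.r.t. the Lebesgue surface measure sigma, via the
   standard cone formula  sigma(A) = n * lambda_n { t a : a in A, 0 < t <= 1 },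
   i.e.  int_{S^{n-1}} g dsigma = n * int_{0 < |x| <= 1} g(x/|x|) dx. *)
Definition sphere_int (n : nat) (g : 'rV[R]_n -> R) : \bar R :=
  let G : 'rV[R]_n -> \bar R := fun x =>
    if (x != 0%R) && (enorm x <= 1)%R then (g ((enorm x)^-1 *: x))%:E else 0%E in
  ((n%:R)%:E * leb_int G)%E.

(* (unnormalized) mean width M_n[K] *)
Definition mean_width (n : nat) (K : set 'rV[R]_n) : \bar R :=
  sphere_int (support_fun K).

Definition isometry (n : nat) (f : 'rV[R]_n -> 'rV[R]_n) : Prop :=
  forall x y, enorm (f x - f y) = enorm (x - y).

Definition congruent (n N : nat) (p q : 'I_N -> 'rV[R]_n) : Prop :=
  exists f : 'rV[R]_n -> 'rV[R]_n, isometry f /\ forall i, f (p i) = q i.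

End Defs.

(* Main.v *)
Require Import Defs.
From HB Require Import structures.
From mathcomp Require Import all_boot all_order all_algebra.
From mathcomp Require Import all_classical all_reals all_analysis.
From mathcomp Require Import measurable_realfun ring lra.
Set Implicit Arguments.
Unset Strict Implicit.
Unset Printing Implicit Defensive.
Import Order.TTheory GRing.Theory Num.Theory.
Import numFieldNormedType.Exports.
Local Open Scope classical_set_scope.
Local Open Scope ring_scope.

(**
  The mean width of a convex hull is, up to a positive constant depending only on [n], the
  Gaussian expectation of [max_i <p_i, u>], so the inequality is an instance of the
  Sudakov-Fernique comparison.  The expectation of [log sum_i exp (c_i + e <p_i, u>)] depends,
  up to order [e ^ 3], only on the squared distances [|p_i - p_j|^2], and monotonically so;
  since a Gaussian vector is the sum of two independent copies of itself scaled by
  [1 / sqrt 2], halving the variance repeatedly turns this infinitesimal comparison into an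
  exact one, for every shift [c].

  In the case of equality the same semigroup property propagates equality to the shifts
  [c_i = <x, p_i> + <y, q_i>] for all [x] and [y].  If some distance is strictly
  increased, then Farkas' lemma provides an edge [k m] of the convex hull of the points
  [(p_i, q_i)] along which the distance strictly increases.  Letting [(x, y)] go to infinity
  along a functional exposing that edge leaves [E max (0, <q_m - q_k, u>) <=
  E max (0, <p_m - p_k, u>)], which is absurd.  Hence all distances agree, and the
  configurations are congruent by composing reflections.
*)

(** * Euclidean geometry of configurations *)

Section InnerProduct.
Variable R : realType.
Implicit Types n : nat.

(** The budget of the halving argument decides how far to expand. After [k] doublings the starting
    scale is [e = 2^(-k/2)] and the error has been multiplied by [2^k]; a remainder of order [e^3]
    leaves [2^k e^3 = 2^(-k/2)], while one of order [e^2] would not decay. Hence the third-order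
    remainders and the Gaussian third moments. The shift [c] is arbitrary throughout because one
    half of the Gaussian vector is absorbed into it while the other half is compared.

    [lse] serves for its expansion only; [max] is recovered from it by scaling up, since the two
    differ by at most [ln N] at every scale.

    One point of each configuration is moved to the origin. The functionals then dominate [c i0],
    every integrand is nonnegative, and the exchanges of integrals are instances of Tonelli's
    theorem.

    In the equality case the shifts along [p] and along [q] are both needed: an edge of the joint
    hull in dimension [2 n] is in general exposed only by a functional that mixes the two
    factors. *)

Lemma dotpC n (x y : 'rV[R]_n) : dotp x y = dotp y x.
Proof. by apply: eq_bigr => i _; rewrite mulrC. Qed.

Lemma dotpDl n (x y z : 'rV[R]_n) : dotp (x + y) z = dotp x z + dotp y z.
Proof. by rewrite -big_split; apply: eq_bigr => i _; rewrite mxE mulrDl. Qed.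

Lemma dotpZl n a (x y : 'rV[R]_n) : dotp (a *: x) y = a * dotp x y.
Proof. by rewrite mulr_sumr; apply: eq_bigr => i _; rewrite mxE mulrA. Qed.

Lemma dotpDr n (x y z : 'rV[R]_n) : dotp z (x + y) = dotp z x + dotp z y.
Proof. by rewrite dotpC dotpDl !(dotpC z). Qed.

Lemma dotpZr n a (x y : 'rV[R]_n) : dotp y (a *: x) = a * dotp y x.
Proof. by rewrite dotpC dotpZl (dotpC y). Qed.

Lemma dotpNl n (x y : 'rV[R]_n) : dotp (- x) y = - dotp x y.
Proof. by rewrite -scaleN1r dotpZl mulN1r. Qed.

Lemma dotpNr n (x y : 'rV[R]_n) : dotp y (- x) = - dotp y x.
Proof. by rewrite dotpC dotpNl dotpC. Qed.

Lemma dotpBl n (x y z : 'rV[R]_n) : dotp (x - y) z = dotp x z - dotp y z.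
Proof. by rewrite dotpDl dotpNl. Qed.

Lemma dotpBr n (x y z : 'rV[R]_n) : dotp z (x - y) = dotp z x - dotp z y.
Proof. by rewrite dotpDr dotpNr. Qed.

Lemma dotp0l n (x : 'rV[R]_n) : dotp 0 x = 0.
Proof. by rewrite -(scale0r x) dotpZl mul0r. Qed.

Lemma dotp0r n (x : 'rV[R]_n) : dotp x 0 = 0.
Proof. by rewrite dotpC dotp0l. Qed.

Lemma dotp_suml n (I : finType) (P : pred I) (F : I -> 'rV[R]_n) y :
  dotp (\sum_(i | P i) F i) y = \sum_(i | P i) dotp (F i) y.
Proof. by apply: (big_morph (fun x => dotp x y)) => [a b|]; rewrite (dotpDl, dotp0l). Qed.

Lemma dotp_ge0 n (x : 'rV[R]_n) : 0 <= dotp x x.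
Proof. by apply: sumr_ge0 => i _; rewrite -expr2 sqr_ge0. Qed.

Lemma dotp_eq0 n (x : 'rV[R]_n) : (dotp x x == 0) = (x == 0).
Proof.
apply/eqP/eqP => [/eqP|->]; last by rewrite dotp0l.
rewrite psumr_eq0 => [/allP xx|i _]; last by rewrite -expr2 sqr_ge0.
apply/rowP => i; rewrite mxE; apply/eqP.
by have := xx i (mem_index_enum i); rewrite /= -expr2 sqrf_eq0.
Qed.

Lemma dotp_gt0 n (x : 'rV[R]_n) : (0 < dotp x x) = (x != 0).
Proof. by rewrite lt0r dotp_eq0 dotp_ge0 andbT. Qed.

Lemma enorm_ge0 n (x : 'rV[R]_n) : 0 <= enorm x.
Proof. exact: sqrtr_ge0. Qed.

Lemma sqr_enorm n (x : 'rV[R]_n) : enorm x ^+ 2 = dotp x x.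
Proof. by rewrite sqr_sqrtr// dotp_ge0. Qed.

Lemma enorm_eq0 n (x : 'rV[R]_n) : (enorm x == 0) = (x == 0).
Proof. by rewrite -dotp_eq0 -sqr_enorm sqrf_eq0. Qed.

Lemma ler_enorm m n (x : 'rV[R]_m) (y : 'rV[R]_n) :
  (enorm x <= enorm y) = (dotp x x <= dotp y y).
Proof. by rewrite -!sqr_enorm ler_sqr// nnegrE enorm_ge0. Qed.

Lemma eq_enorm m n (x : 'rV[R]_m) (y : 'rV[R]_n) :
  dotp x x = dotp y y -> enorm x = enorm y.
Proof. by move=> e; rewrite /enorm e. Qed.

Lemma enormBC n (x y : 'rV[R]_n) : enorm (x - y) = enorm (y - x).
Proof. by apply: eq_enorm; rewrite -opprB dotpNl dotpNr opprK. Qed.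

Lemma dotp_row_mx m n (a c : 'rV[R]_m) (b d : 'rV[R]_n) :
  dotp (row_mx a b) (row_mx c d) = dotp a c + dotp b d.
Proof.
rewrite /dotp big_split_ord /=; congr (_ + _); apply: eq_bigr => i _.
  by rewrite !row_mxEl.
by rewrite !row_mxEr.
Qed.

End InnerProduct.

(** * Equal distances imply congruence *)

Section Congruence.
Variable R : realType.

Definition bisector_reflection n (a b x : 'rV[R]_n) :=
  x - (2 * dotp (x - 2^-1 *: (a + b)) (a - b) / dotp (a - b) (a - b)) *: (a - b).

Lemma bisector_reflection_isometry n (a b : 'rV[R]_n) :
  a != b -> Defs.isometry (bisector_reflection a b).
Proof.
rewrite -subr_eq0 -dotp_gt0 => ab x y; apply: eq_enorm.
rewrite /bisector_reflection; set d := a - b in ab *; set c := _ *: (a + b).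
set k := dotp d d in ab *.
have -> : x - (2 * dotp (x - c) d / k) *: d - (y - (2 * dotp (y - c) d / k) *: d)
    = (x - y) - (2 * dotp (x - y) d / k) *: d.
  rewrite !dotpBl; apply/rowP => i; rewrite !mxE; field; by rewrite gt_eqF.
clearbody d c; move: (x - y) => w; rewrite dotpBl !dotpBr !dotpZl !dotpZr (dotpC d w) -/k.
by field; rewrite gt_eqF.
Qed.

Lemma bisector_reflection_swap n (a b : 'rV[R]_n) :
  a != b -> bisector_reflection a b a = b.
Proof.
rewrite -subr_eq0 -dotp_gt0 => ab; rewrite /bisector_reflection.
have -> : 2 * dotp (a - 2^-1 *: (a + b)) (a - b) / dotp (a - b) (a - b) = 1.
  have -> : a - 2^-1 *: (a + b) = 2^-1 *: (a - b).
    by apply/rowP => i; rewrite !mxE; field.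
  by rewrite dotpZl; field; rewrite gt_eqF.
by rewrite scale1r opprB addrC subrK.
Qed.

Lemma bisector_reflection_fix n (a b x : 'rV[R]_n) :
  enorm (x - a) = enorm (x - b) -> bisector_reflection a b x = x.
Proof.
move=> e; have {e} : dotp (x - a) (x - a) = dotp (x - b) (x - b).
  by rewrite -!sqr_enorm e.
rewrite /bisector_reflection !(dotpBl, dotpBr, dotpDl, dotpDr, dotpNl, dotpNr, dotpZl).
rewrite (dotpC a x) (dotpC b x) (dotpC b a) => e.
set k := (X in _ - X *: _); suff -> : k = 0 by rewrite scale0r subr0.
by apply/eqP; rewrite /k !mulf_eq0; apply/orP; left; apply/orP; right; apply/eqP; lra.
Qed.

(** Induction on the number of points already matched. Those satisfy [f (p i) = q i], hence are
    equidistant from [f (p o)] and [q o], so the reflection exchanging these two leaves them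
    fixed. *)
Lemma congruent_of_equal_distances n N (p q : 'I_N -> 'rV[R]_n) :
  (forall i j, enorm (p i - p j) = enorm (q i - q j)) -> congruent p q.
Proof.
move=> pq.
suff H k : (k <= N)%N -> exists f : 'rV[R]_n -> 'rV[R]_n,
    Defs.isometry f /\ forall i : 'I_N, (i < k)%N -> f (p i) = q i.
  by have [f [fI fE]] := H N (leqnn N); exists f; split => // i; exact: fE.
elim: k => [_|k IHk kN]; first by exists id.
have [f [fI fE]] := IHk (ltnW kN); pose o := Ordinal kN.
have iE (i : 'I_N) : (i < k.+1)%N -> i = o \/ (i < k)%N.
  rewrite ltnS leq_eqVlt => /orP[/eqP ik|]; [left|by right].
  exact: val_inj.
have [e|ne] := eqVneq (f (p o)) (q o).
  by exists f; split=> // i /iE[->|/fE].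
exists (bisector_reflection (f (p o)) (q o) \o f); split=> [x y|i /iE[->|ik]] /=.
- by rewrite bisector_reflection_isometry.
- exact: bisector_reflection_swap.
- rewrite (fE i ik) bisector_reflection_fix//.
  by rewrite -{1}(fE i ik) fI pq.
Qed.

End Congruence.

(** * Finitely generated cones *)

Section Cones.
Variable R : realType.

Definition in_cone n N (g : 'I_N -> 'rV[R]_n) (I : {set 'I_N}) (b : 'rV[R]_n) :=
  exists c : 'I_N -> R, (forall i, 0 <= c i) /\ b = \sum_(i in I) c i *: g i.

Lemma in_cone_gen n N (g : 'I_N -> 'rV[R]_n) (I : {set 'I_N}) i : i \in I -> in_cone g I (g i).
Proof.
move=> iI; exists (fun j => (j == i)%:R); split=> [j|]; first exact: ler0n.
rewrite (bigD1 i)//= eqxx scale1r big1 ?addr0// => j /andP[_ /negbTE ->].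
by rewrite scale0r.
Qed.

Lemma in_cone_sum n N (g : 'I_N -> 'rV[R]_n) I (A : {set 'I_N}) (b : 'I_N -> 'rV[R]_n)
    (c : 'I_N -> R) : (forall j, 0 <= c j) -> (forall j, j \in A -> in_cone g I (b j)) ->
  in_cone g I (\sum_(j in A) c j *: b j).
Proof.
move=> c0 bI.
have /choice[d dE] : forall j, exists d : 'I_N -> R,
    (forall i, 0 <= d i) /\ (j \in A -> b j = \sum_(i in I) d i *: g i).
  move=> j; case: (boolP (j \in A)) => [/bI[d [d0 dE]]|_]; first by exists d.
  by exists (fun=> 0).
exists (fun i => \sum_(j in A) c j * d j i); split=> [i|].
  by apply: sumr_ge0 => j _; rewrite mulr_ge0// (dE j).1.
under [RHS]eq_bigr do rewrite scaler_suml.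
rewrite exchange_big /=; apply: eq_bigr => j jA.
by rewrite (dE j).2// scaler_sumr; apply: eq_bigr => i _; rewrite scalerA.
Qed.

(* Induction on the number of generators: if the functional found for the other
   generators is positive on the new generator [a], project along [a] and recurse. *)
Lemma farkas n N (g : 'I_N -> 'rV[R]_n) (I : {set 'I_N}) (b : 'rV[R]_n) :
  in_cone g I b \/
  exists l, 0 < dotp l b /\ forall i, i \in I -> dotp l (g i) <= 0.
Proof.
move: {2}#|I| (leqnn #|I|) => m; elim: m => [|m IHm] in g I b *.
  rewrite leqn0 cards_eq0 => /eqP ->.
  have [->|b0] := eqVneq b 0.
    by left; exists (fun=> 0); split=> //; rewrite big_set0.
  by right; exists b; split=> [|i]; rewrite ?dotp_gt0// inE.
move=> Im; have [I0|[a aI]] := set_0Vmem I.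
  by apply: IHm; rewrite I0 cards0.
have Iam : (#|I :\ a| <= m)%N by move: Im; rewrite (cardsD1 a I) aI.
case: (IHm g _ b Iam) => [[c [c0 bE]]|[l [lb lI]]].
  left; rewrite bE; apply: in_cone_sum => // j; rewrite !inE => /andP[_].
  exact: in_cone_gen.
have [la|la] := leP (dotp l (g a)) 0.
  right; exists l; split=> // i iI; have [->//|ia] := eqVneq i a.
  by apply: lI; rewrite !inE ia.
pose pr x := dotp l (g a) *: x - dotp l x *: g a.
case: (IHm (pr \o g) _ (pr b) Iam) => [[c [c0 bE]]|[l' [lb' lI']]].
  (* Undoing the projection leaves a multiple of [g a]. Its coefficient has the sign of [t], which
     is nonnegative because [l] is positive at [b] and nonpositive at the other generators. *)
  left; pose t := dotp l b - \sum_(i in I :\ a) c i * dotp l (g i).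
  have t0 : 0 <= t.
    rewrite subr_ge0 (le_trans _ (ltW lb))// sumr_le0// => i iI.
    by rewrite mulr_ge0_le0// lI.
  exists (fun i => if i == a then t / dotp l (g a) else c i); split.
    by move=> i; case: ifP => // _; rewrite divr_ge0// ltW.
  rewrite (big_setD1 a)//= eqxx; under eq_bigr => i.
    by rewrite !inE => /andP[/negbTE -> _]; over.
  apply: (@scalerI _ _ (dotp l (g a))); first by rewrite gt_eqF.
  rewrite scalerDr scalerA mulrCA divff ?gt_eqF// mulr1 scalerBl.
  move: bE; rewrite /pr => /(canRL (subrK _)) ->; rewrite addrC -addrA; congr (_ + _).
  rewrite scaler_suml scaler_sumr -sumrN -big_split /=.
  by apply: eq_bigr => i _; rewrite scalerBr !scalerA addrC (mulrC (dotp l (g a))).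
right; exists (dotp l (g a) *: l' - dotp l' (g a) *: l).
have E x : dotp (dotp l (g a) *: l' - dotp l' (g a) *: l) x = dotp l' (pr x).
  rewrite dotpBl !dotpZl dotpBr !dotpZr; ring.
split=> [|i iI]; rewrite E//; have [->|ia] := eqVneq i a.
  by rewrite /pr subrr dotp0r.
by apply: lI'; rewrite !inE ia.
Qed.

(** A generating subset of least cardinality works: a member lying in the cone of the others could
    be dropped, so Farkas' lemma separates each member from the rest. For homogenised points this
    yields the vertices of a convex hull, and for differences from a vertex the edges at that
    vertex. *)
Lemma irredundant_generators n N (g : 'I_N -> 'rV[R]_n) (A : {set 'I_N}) :
  exists I : {set 'I_N}, [/\ I \subset A, forall i, i \in A -> in_cone g I (g i) &
    forall k, k \in I -> exists l, 0 < dotp l (g k) /\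
      forall i, i \in I -> i != k -> dotp l (g i) <= 0].
Proof.
pose P (I : {set 'I_N}) := I \subset A /\ forall i, i \in A -> in_cone g I (g i).
pose Q m := [exists I : {set 'I_N}, (#|I| == m) && `[< P I >]].
have exQ : exists m, Q m.
  exists #|A|; apply/existsP; exists A; rewrite eqxx; apply/asboolP; split=> // i.
  exact: in_cone_gen.
case: (ex_minnP exQ) => m /existsP[I /andP[/eqP Im /asboolP[IA Igen]]] mmin.
exists I; split=> // k kI.
case: (farkas g (I :\ k) (g k)) => [gk|[l [lk lI]]]; last first.
  by exists l; split=> // i iI ik; apply: lI; rewrite !inE ik.
suff /mmin : Q #|I :\ k| by rewrite -Im (cardsD1 k I) kI ltnn.
apply/existsP; exists (I :\ k); rewrite eqxx; apply/asboolP; split.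
  by rewrite (fintype.subset_trans _ IA)// subsetDl.
move=> i /Igen[c [c0 ->]]; apply: in_cone_sum => // j jI.
by have [->//|jk] := eqVneq j k; apply: in_cone_gen; rewrite !inE jk.
Qed.

End Cones.

(** * A stretched edge of the joint configuration *)

Section Edges.
Variables (R : realType) (n N : nat) (p q : 'I_N -> 'rV[R]_n).

(** An indefinite form of signature [(n, n)]. Its bilinearity lets the growth of squared distances,
    which is its value at differences of the points [(p i, q i)], be propagated through convex
    combinations. *)
Definition excess (x y : 'rV[R]_(n + n)) : R :=
  dotp (rsubmx x) (rsubmx y) - dotp (lsubmx x) (lsubmx y).
Local Notation B := excess.
Local Notation z := (fun i => row_mx (p i) (q i)).

Lemma excessDl x y w : B (x + y) w = B x w + B y w.
Proof. by rewrite /B !linearD /= !dotpDl; ring. Qed.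
Lemma excessZl a x w : B (a *: x) w = a * B x w.
Proof. by rewrite /B !linearZ /= !dotpZl; ring. Qed.
Lemma excessC x w : B x w = B w x.
Proof. by rewrite /B dotpC (dotpC (lsubmx x)). Qed.
Lemma excessDr x y w : B w (x + y) = B w x + B w y.
Proof. by rewrite excessC excessDl !(excessC w). Qed.
Lemma excessZr a x w : B w (a *: x) = a * B w x.
Proof. by rewrite excessC excessZl (excessC w). Qed.
Lemma excess_suml (A : {set 'I_N}) (F : 'I_N -> 'rV[R]_(n + n)) w :
  B (\sum_(i in A) F i) w = \sum_(i in A) B (F i) w.
Proof.
apply: (big_morph (fun x => B x w)) => [a b|]; first exact: excessDl.
by rewrite -(scale0r w) excessZl mul0r.
Qed.
Lemma excess_sumr (A : {set 'I_N}) (F : 'I_N -> 'rV[R]_(n + n)) w :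
  B w (\sum_(i in A) F i) = \sum_(i in A) B w (F i).
Proof. by rewrite excessC excess_suml; apply: eq_bigr => i _; exact: excessC. Qed.
Lemma excessBB x y : B (x - y) (x - y) = B x x + B y y - 2 * B x y.
Proof.
by rewrite -scaleN1r excessDl !excessDr !excessZl !excessZr (excessC y x); ring.
Qed.

Lemma excess_config i j : B (z i - z j) (z i - z j) =
  dotp (q i - q j) (q i - q j) - dotp (p i - p j) (p i - p j).
Proof. by rewrite /B !linearB /= !row_mxKl !row_mxKr. Qed.

Hypothesis pq : forall i j, enorm (p i - p j) <= enorm (q i - q j).

Lemma excess_ge0 i j : 0 <= B (z i - z j) (z i - z j).
Proof. by rewrite excess_config subr_ge0 -ler_enorm. Qed.

(* If all edges at a vertex had zero excess, then all chords there would too: the edges span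
   the cone at that vertex, and [B] is nonpositive between two of them. *)
Lemma exists_stretched_edge : (exists i j, enorm (p i - p j) < enorm (q i - q j)) ->
  exists k m (x y : 'rV[R]_n),
    let h j := dotp x (p j) + dotp y (q j) in
    [/\ enorm (p m - p k) < enorm (q m - q k), h m = h k &
    forall i, h i < h k \/
      (h i = h k /\ exists s, [/\ 0 <= s, p i - p k = s *: (p m - p k) &
                                 q i - q k = s *: (q m - q k)])].
Proof.
have ltB i j : (enorm (p i - p j) < enorm (q i - q j)) = (0 < B (z i - z j) (z i - z j)).
  by rewrite excess_config subr_gt0 ltNge ler_enorm -ltNge.
move=> [i0 [j0]]; rewrite ltB => Bij.
(* The extra coordinate 1 turns conic combinations into convex ones, so [I] consists of the vertices
   of the convex hull of the [z i]. *)
pose g i : 'rV[R]_(n + n + 1) := row_mx (z i) (const_mx 1).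
have [I [_ Igen Imin]] := irredundant_generators g [set: 'I_N].
have comb i : exists c : 'I_N -> R, [/\ forall l, 0 <= c l, \sum_(l in I) c l = 1 &
    z i = \sum_(l in I) c l *: z l].
  have [c [c0 gE]] := Igen i (finset.in_setT i); exists c; split=> //.
  - have := congr1 (fun v => rsubmx v 0 0) gE; rewrite row_mxKr mxE linear_sum /= => ->.
    rewrite summxE; apply: eq_bigr => l _.
    by rewrite linearZ /= row_mxKr !mxE mulr1.
  - have := congr1 lsubmx gE; rewrite row_mxKl linear_sum /= => ->.
    by apply: eq_bigr => l _; rewrite linearZ /= row_mxKl.
(* Otherwise [B (z a) (z b)] is the mean of the two diagonal values for all vertices, and the
   quadratic form vanishes on every combination of vertices with coefficients of sum zero, in
   particular on [z i0 - z j0]. *)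
have [k [l0 [kI lI Bkl]]] : exists k l0, [/\ k \in I, l0 \in I &
    0 < B (z l0 - z k) (z l0 - z k)].
  apply: contrapT => /forallNP nB; move: Bij; rewrite ltNge => /negP; apply.
  have [c [c0 c1 zi]] := comb i0; have [d [d0 d1 zj]] := comb j0.
  have B0 a b : a \in I -> b \in I -> B (z a) (z b) = 2^-1 * (B (z a) (z a) + B (z b) (z b)).
    move=> aI bI; have /forallNP/(_ a) nBab := nB b.
    have : B (z a - z b) (z a - z b) = 0.
      apply/eqP; rewrite eq_le excess_ge0 andbT leNgt; apply/negP => ?.
      by apply: nBab.
    by rewrite excessBB => e; lra.
  have -> : z i0 - z j0 = \sum_(l in I) (c l - d l) *: z l.
    by rewrite zi zj -sumrB; apply: eq_bigr => l _; rewrite scalerBl.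
  pose e l := c l - d l.
  have e0 : \sum_(l in I) e l = 0 by rewrite sumrB c1 d1 subrr.
  rewrite excess_suml.
  suff -> : \sum_(l in I) B (e l *: z l) (\sum_(l in I) e l *: z l) =
     2^-1 * ((\sum_(l in I) e l * B (z l) (z l)) * (\sum_(l in I) e l) +
             (\sum_(l in I) e l) * (\sum_(l in I) e l * B (z l) (z l))).
    by rewrite e0 mulr0 mul0r addr0 mulr0.
  rewrite !mulr_suml -big_split /= mulr_sumr; apply: eq_bigr => a aI.
  rewrite excess_sumr !mulr_sumr -big_split mulr_sumr; apply: eq_bigr => b bI /=.
  by rewrite excessZl excessZr B0//; field.
(* The extra coordinate agrees at all points and cancels in differences: what remains is a
   functional whose maximum over the vertices is attained at [z k] alone. *)
have [lam lam0] : exists lam, forall l, l \in I -> l != k -> dotp lam (z l - z k) < 0.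
  have [l [lk lneg]] := Imin k kI.
  exists (lsubmx l) => j jI jk; have := lneg j jI jk; move: lk.
  by rewrite -[l]hsubmxK !dotp_row_mx dotpBr row_mxKl; lra.
(* The irredundant generators of the cone spanned by the differences from [z k] are the edges at
   this vertex. *)
pose g' i := z i - z k.
have [J [JI Jgen Jmin]] := irredundant_generators g' (I :\ k).
have Jk j : j \in J -> j \in I /\ j != k.
  by move=> /(fintype.subsetP JI); rewrite !inE => /andP[].
have Jall i : in_cone g' J (g' i).
  have [c [c0 c1 zi]] := comb i.
  have -> : g' i = \sum_(l in I) c l *: g' l.
    under eq_bigr do rewrite scalerBr.
    by rewrite sumrB -zi -scaler_suml c1 scale1r.
  apply: in_cone_sum => // l lI'; have [->|lk] := eqVneq l k.
    by exists (fun=> 0); split=> //; rewrite /g' subrr big1// => j _; rewrite scale0r.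
  by apply: Jgen; rewrite !inE lk.
have [m [mJ Bm]] : exists m, m \in J /\ 0 < B (g' m) (g' m).
  apply: contrapT => /forallNP nB; move: Bkl; rewrite ltNge => /negP; apply.
  have B0 j : j \in J -> B (g' j) (g' j) = 0.
    move=> jJ; apply/eqP; rewrite eq_le excess_ge0 andbT leNgt; apply/negP => ?.
    by apply: (nB j).
  have [c [c0]] := Jall l0; rewrite -/(g' l0) => ->.
  rewrite excess_suml; apply: sumr_le0 => a aJ; rewrite excess_sumr.
  apply: sumr_le0 => b bJ; rewrite excessZl excessZr mulrA mulr_ge0_le0 ?mulr_ge0//.
  have := excessBB (g' a) (g' b); rewrite !B0//.
  have -> : g' a - g' b = z a - z b by rewrite /g' opprB addrA subrK.
  by have := excess_ge0 a b; lra.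
have [l [lm lneg]] := Jmin m mJ; have [mI mk] := Jk m mJ.
have lamm := lam0 m mI mk; rewrite -/(g' m) in lamm.
(* [l] is positive on the edge [m] and nonpositive on the other edges, [lam] is negative on all of
   them. With this multiple of [lam] the sum vanishes on [m] and stays negative on the others, so it
   exposes the edge. *)
pose s := dotp l (g' m) / - dotp lam (g' m).
have s0 : 0 < s by rewrite divr_gt0// oppr_gt0.
pose mu := l + s *: lam.
have mum : dotp mu (g' m) = 0.
  by rewrite dotpDl dotpZl /s; field; rewrite lt_eqF.
have muJ j : j \in J -> j != m -> dotp mu (g' j) < 0.
  move=> jJ jm; have [jI jk] := Jk j jJ; rewrite dotpDl dotpZl.
  have := lneg j jJ jm; have : s * dotp lam (g' j) < 0 by rewrite pmulr_rlt0// lam0.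
  lra.
exists k, m, (lsubmx mu), (rsubmx mu) => h.
have hE j : h j = dotp mu (z j) by rewrite -[in RHS](hsubmxK mu) dotp_row_mx.
split; first by rewrite ltB.
  by apply/eqP; rewrite -subr_eq0 !hE -dotpBr -/(g' m) mum.
move=> i.
have [c [c0 cE]] := Jall i.
have hik : h i - h k = \sum_(j in J | j != m) c j * dotp mu (g' j).
  rewrite !hE -dotpBr -/(g' i) cE dotpC dotp_suml (bigD1 m)//=.
  rewrite dotpZl dotpC mum mulr0 add0r; apply: eq_bigr => j _.
  by rewrite dotpZl dotpC.
have neg j : (j \in J) && (j != m) -> c j * dotp mu (g' j) <= 0.
  by move=> /andP[jJ jm]; rewrite mulr_ge0_le0// ltW// muJ.
have : h i - h k <= 0 by rewrite hik; exact: sumr_le0.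
rewrite le_eqVlt => /predU1P[e|]; last by rewrite subr_lt0; left.
right; split; first by apply/eqP; rewrite -subr_eq0 e.
have cz j : j \in J -> j != m -> c j = 0.
  move=> jJ jm; move: e; rewrite hik => /eqP; rewrite -oppr_eq0 -sumrN psumr_eq0.
    move=> /allP/(_ j (mem_index_enum j)); rewrite jJ jm /= oppr_eq0 mulf_eq0.
    by rewrite (lt_eqF (muJ _ _ _))// orbF => /eqP.
  by move=> a /neg; rewrite oppr_ge0.
have zE : z i - z k = c m *: (z m - z k).
  rewrite -/(g' i) cE (bigD1 m)//= big1 ?addr0// => j /andP[jJ jm].
  by rewrite cz// scale0r.
exists (c m); split=> //.
  by have := congr1 lsubmx zE; rewrite linearZ /= !linearB /= !row_mxKl.
by have := congr1 rsubmx zE; rewrite linearZ /= !linearB /= !row_mxKr.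
Qed.

End Edges.

(** * Product Lebesgue and Gaussian measures *)

Section SigmaFiniteProduct.
Context d1 d2 (T1 : measurableType d1) (T2 : measurableType d2) (R : realType).
Variables (m1 : {sigma_finite_measure set T1 -> \bar R})
          (m2 : {sigma_finite_measure set T2 -> \bar R}).

(* The canonical structures of [m1 \x m2] assume finite factors; an alias carries
   the sigma-finite one. *)
Definition sfprod : set (T1 * T2) -> \bar R := (m1 \x m2)%E.

HB.instance Definition _ := Measure.on sfprod.

Lemma sfprod_sigma_finite : sigma_finite setT sfprod.
Proof.
have /sigma_finiteP[F [TF ndF Foo]] := sigma_finiteT m1.
have /sigma_finiteP[G [TG ndG Goo]] := sigma_finiteT m2.
exists (fun n => F n `*` G n).
  rewrite -setXTT TF TG; apply/seteqP; split=> [[x y] /= [[n _ Fx] [k _ Gy]]|].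
    exists (maxn n k) => //; split=> /=.
      by move: x Fx; exact/subsetPset/ndF/leq_maxl.
    by move: y Gy; exact/subsetPset/ndG/leq_maxr.
  by move=> [x y] [n _ [/= Fx Gy]]; split; exists n.
move=> k; have [mF Fk] := Foo k; have [mG Gk] := Goo k.
split; first exact: measurableX.
by rewrite [sfprod _]product_measure1E// lte_mul_pinfty// ge0_fin_numE.
Qed.

HB.instance Definition _ :=
  @Measure_isSigmaFinite.Build _ _ _ sfprod sfprod_sigma_finite.

End SigmaFiniteProduct.

(** * Iterated products of the line *)

Section ProductSpace.
Variable R : realType.
Local Notation mR := (measurableTypeR R).

Fixpoint pdisp (n : nat) : measure_display :=
  if n is n'.+1 then measure_prod_display ((R.-ocitv.-measurable).-sigma%mdisp, pdisp n')
  else default_measure_display.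

(** Product measures live on pairs, so space is built as an iterated product, with coordinates in
    the order in which [leb_int] integrates them. Facts in dimension [n] then follow by induction
    from the line, and [toV] carries them to row vectors. *)
Fixpoint pT (n : nat) : measurableType (pdisp n) :=
  match n return measurableType (pdisp n) with
  | 0%N => unit
  | n'.+1 => (mR * pT n')%type
  end.

Fixpoint lam (n : nat) : {sigma_finite_measure set (pT n) -> \bar R} :=
  match n return {sigma_finite_measure set (pT n) -> \bar R} with
  | 0%N => dirac tt
  | n'.+1 => sfprod (@lebesgue_measure R) (lam n')
  end.

Fixpoint pg (n : nat) : probability (pT n) R :=
  match n return probability (pT n) R with
  | 0%N => dirac tt
  | n'.+1 => (normal_prob 0 1 \x pg n')%E
  end.

Fixpoint toV (n : nat) : pT n -> 'rV[R]_n :=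
  match n return pT n -> 'rV[R]_n with
  | 0%N => fun=> 0
  | n'.+1 => fun v => row_mx (\row_(j < 1) v.1) (toV v.2)
  end.

Lemma toV0 n (v : pT n.+1) : toV v 0 ord0 = v.1.
Proof.
have -> : ord0 = lshift n (ord0 : 'I_1) by exact: val_inj.
by rewrite /= (@row_mxEl _ 1 1 n) mxE.
Qed.

Lemma toVS n (v : pT n.+1) i : toV v 0 (lift ord0 i) = toV v.2 0 i.
Proof.
have -> : lift ord0 i = rshift 1 i by exact: val_inj.
by rewrite /= (@row_mxEr _ 1 1 n).
Qed.

Lemma measurable_toV n (j : 'I_n) : measurable_fun setT (fun v : pT n => toV v 0 j).
Proof.
elim: n j => [[]//|n IHn j]; case: (unliftP ord0 j) => [i ->|->].
  under eq_fun do rewrite toVS.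
  exact: (measurableT_comp (IHn i) measurable_snd).
under eq_fun do rewrite toV0.
exact: measurable_fst.
Qed.

Lemma measurable_partial_integral d1 d2 (T1 : measurableType d1) (T2 : measurableType d2)
    (m2 : {sigma_finite_measure set T2 -> \bar R}) (f : T1 * T2 -> \bar R) :
  measurable_fun setT f -> (forall x, 0 <= f x)%E ->
  measurable_fun setT (fun x => \int[m2]_y f (x, y))%E.
Proof. exact: measurable_fun_fubini_tonelli_F. Qed.

Lemma lam_integralS n (f : pT n.+1 -> \bar R) :
  measurable_fun setT f -> (forall v, 0 <= f v)%E ->
  (\int[lam n.+1]_v f v = \int[lebesgue_measure]_t \int[lam n]_v f (t, v))%E.
Proof. by move=> mf f0; rewrite [LHS]fubini_tonelli1. Qed.

Lemma lamX n (A : set mR) (B : set (pT n)) : measurable A -> measurable B ->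
  (lam n.+1 (A `*` B) = lebesgue_measure A * lam n B)%E.
Proof. exact: product_measure1E. Qed.

Lemma pgX n (A : set mR) (B : set (pT n)) : measurable A -> measurable B ->
  (pg n.+1 (A `*` B) = normal_prob 0 1 A * pg n B)%E.
Proof. exact: product_measure1E. Qed.

Lemma pg_integralS n (f : pT n.+1 -> \bar R) :
  measurable_fun setT f -> (forall v, 0 <= f v)%E ->
  (\int[pg n.+1]_v f v = \int[normal_prob 0 1]_t \int[pg n]_v f (t, v))%E.
Proof. by move=> mf f0; rewrite [LHS]fubini_tonelli1. Qed.

Import HBNNSimple.

(** The density formula for sets extends to simple functions by linearity and to [f] by monotone
    convergence along [nnsfun_approx]. *)
Lemma ge0_integral_density d (T : measurableType d) (mu nu : {measure set T -> \bar R})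
    (g : T -> R) (f : T -> \bar R) : measurable_fun setT g -> (forall x, 0 <= g x) ->
  (forall A, measurable A -> nu A = \int[mu]_(x in A) (g x)%:E)%E ->
  measurable_fun setT f -> (forall x, 0 <= f x)%E ->
  (\int[nu]_x f x = \int[mu]_x (f x * (g x)%:E))%E.
Proof.
move=> mg g0 nuE mf f0.
have {}mg : measurable_fun setT (EFin \o g) by exact/measurable_EFinP.
pose f_ := nnsfun_approx measurableT mf.
have fE x : (f x = limn (EFin \o f_ ^~ x))%E.
  by apply/esym/cvg_lim => //; apply: cvg_nnsfun_approx.
have cvgf x : cvgn (EFin \o f_ ^~ x).
  by apply/cvg_ex; exists (f x); apply: cvg_nnsfun_approx.
under eq_integral do rewrite fE.
rewrite monotone_convergence//; last 3 first.
- by move=> n; apply/measurable_EFinP.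
- by move=> n x _; rewrite lee_fin.
- by move=> x _ m n mn; rewrite lee_fin; exact/lefP/nd_nnsfun_approx.
transitivity (\int[mu]_x limn (fun n => (f_ n x)%:E * (g x)%:E))%E; last first.
  apply: eq_integral => x _; rewrite fE.
  by apply/cvg_lim => //; apply: cvgeZr => //; exact: cvgf.
rewrite monotone_convergence//; last 3 first.
- by move=> n; apply: emeasurable_funM => //; apply/measurable_EFinP.
- by move=> n x _; rewrite mule_ge0// lee_fin.
- move=> x _ m n mn; rewrite lee_wpmul2r ?lee_fin//.
  exact/lefP/nd_nnsfun_approx.
congr (limn _); apply/funext => n.
under eq_integral do rewrite fimfunE -fsumEFin//.
rewrite ge0_integral_fsum//; last 2 first.
- by move=> r; apply/measurable_EFinP/measurableT_comp.
- by move=> r x _; rewrite EFinM nnfun_muleindic_ge0.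
under [RHS]eq_integral.
  move=> x _; rewrite fimfunE -fsumEFin// ge0_mule_fsuml; last first.
    by move=> r; rewrite EFinM nnfun_muleindic_ge0.
  over.
rewrite ge0_integral_fsum//; last 2 first.
- move=> r; apply: emeasurable_funM => //.
  by apply/measurable_EFinP/measurableT_comp.
- move=> r x _; apply: mule_ge0; last by rewrite lee_fin.
  by rewrite EFinM nnfun_muleindic_ge0.
apply: eq_fsbigr => r _.
rewrite integralZl_indic_nnsfun//= integral_indic// setIT nuE//.
have [r0|r0] := ltP r 0%R.
  rewrite preimage_nnfun0// integral_set0 mule0 integral0_eq// => x _.
  by rewrite indic0 mulr0 mul0e.
under [RHS]eq_integral do rewrite EFinM -muleA.
rewrite ge0_integralZl//; last 2 first.
- by apply: emeasurable_funM => //; apply/measurable_EFinP.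
- by move=> x _; rewrite mule_ge0// lee_fin.
congr (_ * _)%E; rewrite integral_mkcond; apply: eq_integral => x _.
by rewrite patchE indicE; case: ifP => _; rewrite (mul1e, mul0e).
Qed.

Lemma ge0_integral_normal (f : mR -> \bar R) :
  measurable_fun setT f -> (forall t, 0 <= f t)%E ->
  (\int[normal_prob 0 1]_t f t =
   \int[lebesgue_measure]_t (f t * (normal_pdf 0 1 t)%:E))%E.
Proof.
move=> mf f0; apply: ge0_integral_density => //.
- exact: measurable_normal_pdf.
- by move=> x; rewrite normal_pdf_ge0.
Qed.

(** The pushforward of Lebesgue measure under the affine map, multiplied by [a], agrees with
    Lebesgue measure on the intervals []c, d]]; uniqueness identifies the two. *)
Lemma ge0_integral_affine (a b : R) (f : mR -> \bar R) : 0 < a ->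
  measurable_fun setT f -> (forall t, 0 <= f t)%E ->
  (\int[lebesgue_measure]_t f (a * t + b)%R = (a^-1)%:E * \int[lebesgue_measure]_t f t)%E.
Proof.
move=> a0 mf f0.
pose phi : mR -> mR := fun t => a * t + b.
have mphi : measurable_fun setT phi.
  by apply: measurable_funD => //; apply: measurable_funM.
have a0' : 0 <= a by exact: ltW.
pose nu0 : _ -> {measure set mR -> \bar R} := fun m : measurable_fun setT phi =>
  mscale (NngNum a0') (measure_function_pushforward__canonical__measure_function_Measure lebesgue_measure m).
pose nu := nu0 mphi.
have nuE (A : set mR) : measurable A -> lebesgue_measure A = nu A.
  apply: lebesgue_measure_unique => _ [[c d]] _ <- /=.
  rewrite /nu /mscale /= /pushforward.
  have -> : phi @^-1` `]c, d]%classic = `](c - b) / a, (d - b) / a]%classic.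
    apply/seteqP; split => t /=; rewrite !in_itv /= /phi => /andP[t1 t2];
      apply/andP; split.
    - by rewrite ltr_pdivrMr// ltrBlDr mulrC.
    - by rewrite ler_pdivlMr// lerBrDr mulrC.
    - by move: t1; rewrite ltr_pdivrMr// ltrBlDr mulrC.
    - by move: t2; rewrite ler_pdivlMr// lerBrDr mulrC.
  rewrite !lebesgue_measure_itv /= !lte_fin ltr_pM2r ?invr_gt0// ltrD2r.
  case: ifP => _; last by rewrite mule0.
  by rewrite -!EFinB -EFinM; congr (_%:E); field; rewrite gt_eqF.
transitivity (\int[pushforward lebesgue_measure phi]_t f t)%E.
  by rewrite ge0_integral_pushforward.
rewrite [in RHS](eq_measure_integral nu) => [|A mA _]; last exact: nuE.
rewrite ge0_integral_mscale//= muleA -EFinM mulVf ?gt_eqF// mul1e//.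
Qed.

Definition cube n : set (pT n) := [set v | forall i, `|toV v 0 i| <= 1].

Lemma cubeS n : @cube n.+1 = [set t : mR | `|t| <= 1] `*` @cube n.
Proof.
apply/seteqP; split=> [v /= H|v /= [H1 H2] i].
  by split=> /= [|i]; [have := H ord0; rewrite toV0|have := H (lift ord0 i); rewrite toVS].
by case: (unliftP ord0 i) => [k ->|->]; rewrite (toVS, toV0)//; exact: H2.
Qed.

Lemma lam_cube n : measurable (@cube n) /\ (lam n (@cube n) < +oo)%E.
Proof.
elim: n => [|n [mB IHn]].
  have -> : @cube 0 = setT by apply/seteqP; split=> // v _ [].
  by split=> //; rewrite /= diracT ltry.
have E : [set t : mR | `|t| <= 1] = `[-1, 1]%classic.
  by apply/seteqP; split=> t /=; rewrite in_itv /= ler_norml.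
rewrite cubeS E; split; first exact: measurableX.
rewrite lamX// lebesgue_measure_itv /=.
case: ifP => _; rewrite ?mul0e// lte_mul_pinfty// -?EFinB ?lee_fin//; lra.
Qed.

Lemma lam_integrable_box n (f : pT n -> R) (C : R) : measurable_fun setT f ->
  (forall v, `|f v| <= C) -> (forall v i, 1 < `|toV v 0 i| -> f v = 0) ->
  (lam n).-integrable setT (EFin \o f).
Proof.
move=> mf fC f0; have [mB Boo] := lam_cube n; set B := @cube n in mB Boo.
have C0 : 0 <= C by apply: le_trans (normr_ge0 _) (fC point).
apply/integrableP; split; first exact/measurable_EFinP.
apply: (@le_lt_trans _ _ (\int[lam n]_v (C%:E * (\1_B v)%:E))%E); last first.
  rewrite ge0_integralZl//; last by apply/measurable_EFinP; exact: measurable_indic.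
  by rewrite integral_indic// setIT lte_mul_pinfty.
apply: ge0_le_integral => //.
- by apply: measurableT_comp => //; exact/measurable_EFinP.
- apply: emeasurable_funM => //; apply/measurable_EFinP; exact: measurable_indic.
- move=> v _ /=; rewrite -EFinM lee_fin indicE.
  have [vB|/negP vB] := boolP (v \in B); first by rewrite mulr1.
  have [i vi] : exists i, ~ `|toV v 0 i| <= 1.
    by apply/existsNP => H; apply: vB; rewrite inE.
  by rewrite (f0 v i) ?normr0 ?mulr0// ltNge; apply/negP.
Qed.

(** The bridge from the iterated integral behind [sphere_int] to a product measure. As [f] has no
    sign, Fubini's theorem needs integrability; boundedness and support in the unit cube supply
    it. *)
Lemma leb_intE n (f : 'rV[R]_n -> R) (C : R) :
  measurable_fun setT (fun v : pT n => f (toV v)) ->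
  (forall x, `|f x| <= C) -> (forall (x : 'rV[R]_n) i, 1 < `|x 0 i| -> f x = 0) ->
  leb_int (fun x => (f x)%:E) = (\int[lam n]_v (f (toV v))%:E)%E.
Proof.
elim: n f => [|n IHn] f mf fC f0; first by rewrite /= integral_dirac// diracT mul1e.
rewrite /= (eq_integral (fun t : mR => \int[lam n]_v (f (toV ((t, v) : pT n.+1)))%:E)%E).
  rewrite [LHS](@integral12_prod_meas1 _ _ _ _ _ lebesgue_measure (lam n)
    (fun v : mR * pT n => (f (toV (v : pT n.+1)))%:E))//.
  exact: (@lam_integrable_box n.+1 _ C mf (fun v => fC _) (fun v i => f0 _ i)).
move=> t _; apply: IHn => //.
- exact: (measurableT_comp mf (pair1_measurable t)).
- by move=> x i xi; apply: (f0 _ (rshift 1 i)); rewrite (@row_mxEr _ 1 1 n).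
Qed.

Fixpoint gwt (n : nat) : pT n -> R :=
  match n return pT n -> R with
  | 0%N => fun=> 1
  | n'.+1 => fun v => normal_pdf 0 1 v.1 * gwt v.2
  end.

Lemma measurable_gwt n : measurable_fun setT (@gwt n).
Proof.
elim: n => [|n IHn]; first exact: measurable_cst.
apply: measurable_funM.
  exact: (measurableT_comp (measurable_normal_pdf 0 1) measurable_fst).
exact: (measurableT_comp IHn measurable_snd).
Qed.

Lemma gwt_ge0 n (v : pT n) : 0 <= gwt v.
Proof. by elim: n v => // n IHn [t v] /=; rewrite mulr_ge0// normal_pdf_ge0. Qed.

Lemma gwtE n (v : pT n) :
  gwt v = normal_peak 1 ^+ n * expR (- (dotp (toV v) (toV v) / 2)).
Proof.
elim: n v => [v|n IHn [t v]] /=.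
  by rewrite /dotp big_ord0 mul0r oppr0 expR0 mulr1.
rewrite (@dotp_row_mx R 1 n) IHn normal_pdfE ?oner_eq0// /normal_fun.
have -> : dotp (\row_(_ < 1) t) (\row_(_ < 1) t) = t ^+ 2.
  by rewrite /dotp big_ord1 !mxE expr2.
rewrite mulrACA -expRD -exprS; congr (_ * expR _).
by rewrite subr0 expr1n; field.
Qed.

Lemma pg_density n (F : pT n -> \bar R) : measurable_fun setT F ->
  (forall v, 0 <= F v)%E ->
  (\int[pg n]_v F v = \int[lam n]_v (F v * (gwt v)%:E))%E.
Proof.
elim: n F => [|n IHn] F mF F0.
  by rewrite /= !integral_dirac// ?mule1// diracT mul1e.
have mFt t : measurable_fun setT (fun v : pT n => F (t, v)).
  exact: (measurableT_comp mF (pair1_measurable t)).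
have mG : measurable_fun setT (fun v : pT n.+1 => (F v * (gwt v)%:E)%E).
  by apply: emeasurable_funM => //; apply/measurable_EFinP; exact: measurable_gwt.
rewrite pg_integralS// lam_integralS//; last first.
  by move=> v; rewrite mule_ge0// lee_fin gwt_ge0.
under eq_integral => t _.
  rewrite IHn//; over.
have mH : measurable_fun setT (fun v : mR * pT n => (F v * (gwt v.2)%:E)%E).
  apply: emeasurable_funM => //; apply/measurable_EFinP.
  exact: (measurableT_comp (@measurable_gwt n) measurable_snd).
rewrite ge0_integral_normal; last 2 first.
- apply: (measurable_partial_integral (lam n) mH).
  by move=> v; rewrite mule_ge0// lee_fin gwt_ge0.
- by move=> t; apply: integral_ge0 => v _; rewrite mule_ge0// lee_fin gwt_ge0.
apply: eq_integral => t _.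
rewrite muleC -ge0_integralZl//; last 3 first.
- by apply: emeasurable_funM => //; apply/measurable_EFinP; exact: measurable_gwt.
- by move=> v _; rewrite mule_ge0// lee_fin gwt_ge0.
- by rewrite lee_fin normal_pdf_ge0.
by apply: eq_integral => v _; rewrite muleCA EFinM.
Qed.

Fixpoint psc (s : R) (n : nat) : pT n -> pT n :=
  match n return pT n -> pT n with
  | 0%N => id
  | n'.+1 => fun v => (s * v.1, psc s v.2)
  end.

Lemma toV_psc s n (v : pT n) : toV (psc s v) = s *: toV v.
Proof.
elim: n v => [v|n IHn [t v]]; first by rewrite scaler0.
apply/rowP => i; rewrite [RHS]mxE.
case: (unliftP ord0 i) => [j ->|->].
  by rewrite !toVS IHn mxE.
by rewrite !toV0.
Qed.

Lemma measurable_psc s n : measurable_fun setT (@psc s n).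
Proof.
elim: n => [|n IHn]; first exact: measurable_id.
apply: measurable_fun_pair.
  by apply: measurable_funM => //; exact: measurable_fst.
exact: (measurableT_comp IHn measurable_snd).
Qed.

Lemma lam_scale s n (F : pT n -> \bar R) : 0 < s -> measurable_fun setT F ->
  (forall v, 0 <= F v)%E ->
  (\int[lam n]_v F (psc s v) = (s ^- n)%:E * \int[lam n]_v F v)%E.
Proof.
move=> s0; elim: n F => [|n IHn] F mF F0; first by rewrite expr0 invr1 mul1e.
have mFt t : measurable_fun setT (fun v : pT n => F (t, v)).
  exact: (measurableT_comp mF (pair1_measurable t)).
have s0' k : (0 <= (s ^- k)%:E)%E by rewrite lee_fin invr_ge0 exprn_ge0// ltW.
have mI : measurable_fun setT (fun t : mR => \int[lam n]_v F (t, v))%E.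
  exact: (measurable_partial_integral (lam n) mF).
have I0 t : (0 <= \int[lam n]_v F (t, v))%E by apply: integral_ge0.
rewrite lam_integralS//; last exact: (measurableT_comp mF (@measurable_psc s n.+1)).
rewrite lam_integralS//=.
under eq_integral => t _ do rewrite (IHn (fun v => F (s * t, v)))//.
have mst : measurable_fun setT (fun t : mR => (s * t : mR)) by apply: measurable_funM.
rewrite ge0_integralZl//; last exact: (measurableT_comp mI mst).
have -> : (\int[lebesgue_measure]_t \int[lam n]_v F ((s * t)%R, v) =
    (s^-1)%:E * \int[lebesgue_measure]_t \int[lam n]_v F (t, v))%E.
  rewrite -(@ge0_integral_affine s 0 _ s0 mI I0).
  by apply: eq_integral => t _; rewrite addr0.
rewrite muleA -EFinM; congr (_%:E * _)%E.
by rewrite exprSr invfM.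
Qed.

End ProductSpace.

Lemma integral_cst_probability d (T : measurableType d) (R : realType) (P : probability T R)
  (r : R) : (\int[P]_x r%:E = r%:E)%E.
Proof. by rewrite integral_cst// [X in (_ * X)%E]probability_setT mule1. Qed.

(** * The Gaussian semigroup and third moments *)

Section GaussianSpace.
Variable R : realType.
Local Notation mR := (measurableTypeR R).
Local Notation gam := (@normal_prob R 0 1).
Local Notation phi := (@normal_pdf R 0 1).
Local Notation r2 := (Num.sqrt (2 : R)).

Lemma sqrt2_gt0 : 0 < r2. Proof. by rewrite sqrtr_gt0. Qed.

Lemma sqrt2_sqr : r2 ^+ 2 = 2. Proof. by rewrite sqr_sqrtr. Qed.

Lemma gauss_pdfE t : phi t = normal_peak 1 * expR (- (t ^+ 2 / 2)).
Proof.
by rewrite normal_pdfE ?oner_eq0// /normal_fun subr0 expr1n; congr (_ * expR _); field.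
Qed.

(** Invariance of the planar Gaussian density under the orthogonal map [(x, y) -> ((x + y) / sqrt 2,
    (x - y) / sqrt 2)], taken at [x = s] and [y = sqrt 2 r - s]. *)
Lemma gauss_pdf_rotation s r : phi (r2 * r - s) * phi s = phi r * phi (r2 * s - r).
Proof.
rewrite !gauss_pdfE [LHS]mulrACA [RHS]mulrACA -!expRD; congr (_ * expR _).
have -> : (r2 * r - s) ^+ 2 = r2 ^+ 2 * r ^+ 2 - 2 * r2 * r * s + s ^+ 2 by ring.
have -> : (r2 * s - r) ^+ 2 = r2 ^+ 2 * s ^+ 2 - 2 * r2 * r * s + r ^+ 2 by ring.
by rewrite sqrt2_sqr; field.
Qed.

Lemma measurable_gauss_pdf : measurable_fun setT (phi : mR -> R).
Proof. exact: measurable_normal_pdf. Qed.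

Lemma measurable_gauss_pdfE : measurable_fun setT (fun t : mR => (phi t)%:E).
Proof. by apply/measurable_EFinP; exact: measurable_gauss_pdf. Qed.

Lemma measurable_norm3 : measurable_fun setT (fun t : mR => (`|t| ^+ 3)%:E).
Proof. by apply/measurable_EFinP; apply: measurable_funX; exact: normr_measurable. Qed.

(** Substituting [t = sqrt 2 r - s] and exchanging the integrals puts [g r] outside. By the rotation
    identity the remaining integral over [s] is [phi r] times the total mass of a Gaussian
    density. *)
Lemma gauss_semigroup1 (g : mR -> \bar R) : measurable_fun setT g ->
  (forall t, 0 <= g t)%E ->
  (\int[gam]_s \int[gam]_t g ((s + t) / r2)%R = \int[gam]_t g t)%E.
Proof.
move=> mg g0; have r0 := sqrt2_gt0.
have mst : measurable_fun setT (fun w : mR * mR => (w.1 + w.2) / r2 : mR).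
  by apply: measurable_funM => //; apply: measurable_funD.
have inner (s : mR) : (\int[gam]_t g ((s + t) / r2)%R =
    \int[lebesgue_measure]_r (g r * (r2 * phi (r2 * r - s))%:E))%E.
  have m1 : measurable_fun setT (fun t : mR => g ((s + t) / r2)).
    exact: (measurableT_comp mg (measurableT_comp mst (pair1_measurable s))).
  have m2 : measurable_fun setT (fun t : mR => g ((s + t) / r2)%R * (phi t)%:E)%E.
    exact: emeasurable_funM measurable_gauss_pdfE.
  rewrite ge0_integral_normal//.
  have := @ge0_integral_affine R r2 (- s) _ r0 m2.
  have gp0 t : (0 <= g ((s + t) / r2)%R * (phi t)%:E)%E.
    by rewrite mule_ge0// lee_fin normal_pdf_ge0.
  move=> /(_ gp0).
  move=> /(congr1 (fun x => r2%:E * x)%E); rewrite muleA -EFinM divff ?gt_eqF// mul1e => <-.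
  have maff : measurable_fun setT (fun r : mR => r2 * r - s : mR).
    by apply: measurable_funD => //; exact: measurable_funM.
  rewrite -ge0_integralZl; [|by []|exact: (measurableT_comp m2 maff)|by move=> r _; exact: gp0|by rewrite lee_fin ltW].
  apply: eq_integral => r _; rewrite muleCA EFinM; congr (g _ * _)%E.
  by field; rewrite gt_eqF.
under eq_integral do rewrite inner.
have mr : measurable_fun setT (fun w : mR * mR => r2 * phi (r2 * w.2 - w.1)).
  apply: measurable_funM => //; apply: (measurableT_comp measurable_gauss_pdf).
  by apply: measurable_funB => //; apply: measurable_funM.
have m3 : measurable_fun setT (fun w : mR * mR => (g w.2 * (r2 * phi (r2 * w.2 - w.1))%:E)%E).
  apply: emeasurable_funM; first exact: (measurableT_comp mg measurable_snd).
  exact/measurable_EFinP.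
have p0 (a b : mR) : 0 <= r2 * phi (r2 * a - b) by rewrite mulr_ge0 ?normal_pdf_ge0// ltW.
have m30 (w : mR * mR) : (0 <= g w.2 * (r2 * phi (r2 * w.2 - w.1))%:E)%E by rewrite mule_ge0// lee_fin.
have m4 : measurable_fun setT (fun s : mR =>
    \int[lebesgue_measure]_r (g r * (r2 * phi (r2 * r - s))%:E))%E.
  exact: (measurable_partial_integral (@lebesgue_measure R) m3 m30).
have m40 (s : mR) : (0 <= \int[lebesgue_measure]_r (g r * (r2 * phi (r2 * r - s))%:E))%E.
  by apply: integral_ge0 => r _; rewrite mule_ge0// lee_fin.
rewrite (ge0_integral_normal m4 m40).
pose H (w : mR * mR) := (g w.2 * (r2 * phi (r2 * w.2 - w.1) * phi w.1)%:E)%E.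
have mH : measurable_fun setT H.
  apply: emeasurable_funM; first exact: (measurableT_comp mg measurable_snd).
  apply/measurable_EFinP; apply: measurable_funM => //.
  exact: (measurableT_comp measurable_gauss_pdf measurable_fst).
have H0 w : (0 <= H w)%E by rewrite mule_ge0// lee_fin mulr_ge0// normal_pdf_ge0.
transitivity (\int[lebesgue_measure]_s \int[lebesgue_measure]_r H (s, r))%E.
  apply: eq_integral => s _; rewrite muleC -ge0_integralZl; [|by []
    |exact: (measurableT_comp m3 (pair1_measurable s))|by move=> r _; rewrite mule_ge0// lee_fin
    |by rewrite lee_fin normal_pdf_ge0].
  by apply: eq_integral => r _; rewrite /H muleCA -EFinM mulrC.
rewrite fubini_tonelli// [RHS]ge0_integral_normal//; apply: eq_integral => r _.
rewrite /H /=.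
transitivity (\int[lebesgue_measure]_s ((g r * (phi r)%:E) * (r2 * phi (r2 * s + - r))%:E))%E.
  apply: eq_integral => s _; rewrite -muleA -EFinM; congr (_ * _%:E)%E.
  by rewrite -mulrA gauss_pdf_rotation mulrCA.
have mp : measurable_fun setT (fun s : mR => (phi (r2 * s + - r))%:E).
  apply/measurable_EFinP; apply: (measurableT_comp measurable_gauss_pdf).
  by apply: measurable_funD => //; apply: measurable_funM.
under eq_integral do rewrite EFinM.
rewrite ge0_integralZl; [|by []|exact: emeasurable_funM|by move=> s _; rewrite -EFinM lee_fin
  |by rewrite mule_ge0// lee_fin normal_pdf_ge0].
rewrite ge0_integralZl; [|by []|by []|by move=> s _; rewrite lee_fin normal_pdf_ge0
  |by rewrite lee_fin ltW].
have mphi : measurable_fun setT (fun t : mR => (phi t)%:E).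
  exact: measurable_gauss_pdfE.
rewrite (@ge0_integral_affine R r2 (- r) (fun t => (phi t)%:E))//; last first.
  by move=> t; rewrite lee_fin normal_pdf_ge0.
by rewrite integral_normal_pdf mule1 -EFinM divff ?gt_eqF// mule1.
Qed.

Fixpoint phs (n : nat) : pT R n -> pT R n -> pT R n :=
  match n return pT R n -> pT R n -> pT R n with
  | 0%N => fun u _ => u
  | n'.+1 => fun u v => ((u.1 + v.1) / r2, phs u.2 v.2)
  end.

Lemma toV_phs n (u v : pT R n) : toV (phs u v) = r2^-1 *: (toV u + toV v).
Proof.
elim: n u v => [u v|n IHn [s u] [t v]]; first by rewrite /= addr0 scaler0.
apply/rowP => i; rewrite [RHS]mxE [X in _ * X]mxE.
case: (unliftP ord0 i) => [j ->|->]; first by rewrite !toVS IHn !mxE.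
by rewrite !toV0 /= mulrC.
Qed.

Lemma measurable_phs n : measurable_fun setT (fun w : pT R n * pT R n => phs w.1 w.2).
Proof.
elim: n => [|n IHn]; first exact: measurable_fst.
apply: measurable_fun_pair.
  apply: measurable_funM => //; apply: measurable_funD.
    exact: (measurableT_comp measurable_fst measurable_fst).
  exact: (measurableT_comp measurable_fst measurable_snd).
have h : measurable_fun setT (fun w : pT R n.+1 * pT R n.+1 => (w.1.2, w.2.2)).
  apply: measurable_fun_pair; first exact: (measurableT_comp measurable_snd measurable_fst).
  exact: (measurableT_comp measurable_snd measurable_snd).
exact: (measurableT_comp IHn h).
Qed.

(** Exchanging the integral over the tail [u] with the one over the head [t] brings the two tails
    together, where the induction hypothesis applies; the two heads are then handled by the
    one-dimensional case. *)
Lemma gauss_semigroup n (F : pT R n -> \bar R) : measurable_fun setT F ->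
  (forall v, 0 <= F v)%E ->
  (\int[pg R n]_u \int[pg R n]_v F (phs u v) = \int[pg R n]_v F v)%E.
Proof.
elim: n F => [|n IHn] F mF F0.
  by rewrite /= !integral_dirac// !diracT !mul1e.
have mFh : measurable_fun setT (fun w : pT R n.+1 * pT R n.+1 => F (phs w.1 w.2)).
  exact: (measurableT_comp mF (@measurable_phs n.+1)).
rewrite pg_integralS//; last 2 first.
- exact: (measurable_partial_integral (pg R n.+1) mFh).
- by move=> v; apply: integral_ge0.
have mG (s : mR) : measurable_fun setT
    (fun w : (pT R n * mR) * pT R n => F ((s + w.1.2) / r2, phs w.1.1 w.2)).
  have h1 : measurable_fun setT (fun w : (pT R n * mR) * pT R n => (w.1.1, w.2)).
    apply: measurable_fun_pair => //.
    exact: (measurableT_comp measurable_fst measurable_fst).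
  have h2 : measurable_fun setT (fun w : (pT R n * mR) * pT R n => (s + w.1.2) / r2 : mR).
    apply: measurable_funM => //; apply: measurable_funD => //.
    exact: (measurableT_comp measurable_snd measurable_fst).
  have h3 := measurable_fun_pair h2 (measurableT_comp (@measurable_phs n) h1).
  exact: (measurableT_comp mF h3).
transitivity (\int[gam]_s \int[gam]_t \int[pg R n]_w F (((s + t) / r2)%R, w))%E.
  apply: eq_integral => s _.
  transitivity (\int[pg R n]_u \int[gam]_t \int[pg R n]_v F (((s + t) / r2)%R, phs u v))%E.
    apply: eq_integral => u _; rewrite pg_integralS//.
    exact: (measurableT_comp mFh (pair1_measurable _)).
  rewrite (@fubini_tonelli _ _ _ _ _ (pg R n) gam
    (fun w : pT R n * mR => \int[pg R n]_v F (((s + w.2) / r2)%R, phs w.1 v))%E); last 2 first.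
  - exact: (measurable_partial_integral (pg R n) (mG s)).
  - by move=> w; apply: integral_ge0.
  apply: eq_integral => t _; apply: (IHn (fun w => F ((s + t) / r2, w))) => //.
  exact: (measurableT_comp mF (pair1_measurable _)).
rewrite (@gauss_semigroup1 (fun r => \int[pg R n]_w F (r, w))%E); last 2 first.
- exact: (measurable_partial_integral (pg R n) mF).
- by move=> t; apply: integral_ge0.
by rewrite pg_integralS.
Qed.


Lemma gauss_symmetric (f : mR -> \bar R) : measurable_fun setT f ->
  (forall t, 0 <= f t)%E -> (\int[gam]_t f (- t)%R = \int[gam]_t f t)%E.
Proof.
move=> mf f0.
have mN : measurable_fun setT (-%R : mR -> mR) by exact: measurable_funN.
have mfp : measurable_fun setT (fun t : mR => f t * (phi t)%:E)%E.
  exact: emeasurable_funM measurable_gauss_pdfE.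
have fp0 (t : mR) : (0 <= f t * (phi t)%:E)%E by rewrite mule_ge0// lee_fin normal_pdf_ge0.
rewrite !ge0_integral_normal//; last exact: (measurableT_comp mf mN).
transitivity (\int[pushforward lebesgue_measure (-%R : mR -> mR)]_t (f t * (phi t)%:E))%E.
  rewrite (ge0_integral_pushforward mN _ measurableT mfp (fun t _ => fp0 t)).
  rewrite preimage_setT; apply: eq_integral => t _; rewrite /comp.
  by rewrite !gauss_pdfE sqrrN.
by apply: eq_measure_integral => A mA _; exact: lebesgue_measureN.
Qed.

(** The integrand is dominated by a multiple of the Gaussian density of standard deviation 2: up to
    normalisation the ratio of the two densities is [exp x] with [x = 3 t^2 / 8], which outgrows
    [1 + t^4]. *)
Lemma gauss_moment3 : (\int[gam]_t (`|t| ^+ 3)%:E < +oo)%E.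
Proof.
have m3 := measurable_norm3.
rewrite ge0_integral_normal//.
(* The quotient of the peaks exchanges the normalisations. Since [t^4 = 64 x^2 / 9], the factor 32
   gives [1 + t^4 <= 32 (1 + x / 2)^2 <= 32 exp x]. *)
pose C : R := 32 * (normal_peak 1 / normal_peak 2).
have p1 : 0 < normal_peak (1 : R) by rewrite normal_peak_gt0// oner_eq0.
have p2 : 0 < normal_peak (2 : R) by rewrite normal_peak_gt0// pnatr_eq0.
have C0 : 0 <= C by rewrite mulr_ge0// divr_ge0// ltW.
apply: (@le_lt_trans _ _ (\int[lebesgue_measure]_t (C%:E * (normal_pdf 0 2 t)%:E))%E).
  apply: ge0_le_integral => //.
  - by move=> t _; rewrite mule_ge0 ?lee_fin ?normal_pdf_ge0// exprn_ge0.
  - exact: emeasurable_funM measurable_norm3 measurable_gauss_pdfE.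
  - by apply: emeasurable_funM => //; apply/measurable_EFinP; exact: measurable_normal_pdf.
  move=> t _; rewrite -!EFinM lee_fin gauss_pdfE normal_pdfE ?pnatr_eq0// /normal_fun subr0.
  have -> : C * (normal_peak 2 * expR (- t ^+ 2 / (2 ^+ 2 *+ 2))) =
      normal_peak 1 * (32 * expR (- t ^+ 2 / (2 ^+ 2 *+ 2))).
    by rewrite /C; field; rewrite gt_eqF.
  rewrite mulrCA ler_wpM2l ?(ltW p1)//.
  pose x := 3 * t ^+ 2 / 8.
  have x0 : 0 <= x by rewrite /x divr_ge0// mulr_ge0// sqr_ge0.
  have -> : - t ^+ 2 / (2 ^+ 2 *+ 2) = x + - (t ^+ 2 / 2) by rewrite /x; field.
  rewrite expRD mulrA ler_wpM2r ?expR_ge0//.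
  have e1 : (1 + x / 2) ^+ 2 <= expR x.
    have -> : expR x = expR (x / 2) ^+ 2 by rewrite -expRM_natl; congr expR; field.
    by rewrite lerXn2r ?nnegrE ?expR_ge0 ?expR_ge1Dx//; lra.
  have e2 : t ^+ 2 = 8 / 3 * x by rewrite /x; field.
  have e3 : `|t| ^+ 3 <= 1 + (`|t| ^+ 2) ^+ 2.
    have a0 : 0 <= `|t| by [].
    move: (`|t|) a0 => a a0; rewrite -exprM.
    have [a1|a1] := leP a 1.
      have : a ^+ 3 <= 1 by rewrite exprn_ile1.
      have : 0 <= a ^+ (2 * 2) by rewrite exprn_ge0.
      lra.
    have : a ^+ 3 <= a ^+ (2 * 2) by rewrite ler_weXn2l// ltW.
    lra.
  apply: le_trans e3 _; rewrite -normrX (ger0_norm (sqr_ge0 _)) e2 exprMn.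
  move: e1; rewrite sqrrD expr1n mul1r exprMn; nra.
rewrite ge0_integralZl//; last 2 first.
- by apply/measurable_EFinP; exact: measurable_normal_pdf.
- by move=> t _; rewrite lee_fin normal_pdf_ge0.
by rewrite integral_normal_pdf mule1 ltry.
Qed.

Lemma measurable_dotp n (w : 'rV[R]_n) :
  measurable_fun setT (fun v : pT R n => dotp w (toV v)).
Proof.
by apply: measurable_sum => i; apply: measurable_funM => //; exact: measurable_toV.
Qed.

Lemma dotp_cons n (w : 'rV[R]_n.+1) (v : pT R n.+1) :
  dotp w (toV v) = w 0 ord0 * v.1 + dotp (\row_i w 0 (lift ord0 i)) (toV v.2).
Proof.
rewrite /dotp big_ord_recl toV0; congr (_ + _); apply: eq_bigr => i _.
by rewrite toVS mxE.
Qed.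

Lemma norm3_add (a b : R) : `|a + b| ^+ 3 <= 4 * (`|a| ^+ 3 + `|b| ^+ 3).
Proof.
have h : `|a + b| ^+ 3 <= (`|a| + `|b|) ^+ 3 by rewrite lerXn2r// ?nnegrE ?addr_ge0// ler_normD.
apply: le_trans h _; have := normr_ge0 a; have := normr_ge0 b.
move: `|a| `|b| => x y y0 x0.
have -> : 4 * (x ^+ 3 + y ^+ 3) = (x + y) ^+ 3 + 3 * ((x + y) * (x - y) ^+ 2) by ring.
by rewrite lerDl mulr_ge0// mulr_ge0 ?addr_ge0// sqr_ge0.
Qed.

Lemma pg_moment3 n (w : 'rV[R]_n) :
  (\int[pg R n]_v (`|dotp w (toV v)| ^+ 3)%:E < +oo)%E.
Proof.
have mw k (u : 'rV[R]_k) : measurable_fun setT (fun v : pT R k => (`|dotp u (toV v)| ^+ 3)%:E).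
  apply/measurable_EFinP; apply: measurable_funX; apply: measurableT_comp => //.
  exact: measurable_dotp.
elim: n w => [|n IHn] w.
  rewrite (eq_integral (cst 0%E)) ?integral0// => v _.
  by rewrite /dotp big_ord0 normr0 expr0n.
rewrite pg_integralS//.
set w' : 'rV[R]_n := \row_i w 0 (lift ord0 i).
pose K := fine (\int[pg R n]_v (`|dotp w' (toV v)| ^+ 3)%:E)%E.
have KE : (\int[pg R n]_v (`|dotp w' (toV v)| ^+ 3)%:E = K%:E)%E.
  by rewrite fineK// ge0_fin_numE ?IHn// integral_ge0// => v _; rewrite lee_fin exprn_ge0.
pose J := fine (\int[gam]_t (`|t| ^+ 3)%:E)%E.
have JE : (\int[gam]_t (`|t| ^+ 3)%:E = J%:E)%E.
  by rewrite fineK// ge0_fin_numE ?gauss_moment3// integral_ge0// => v _; rewrite lee_fin exprn_ge0.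
have m3 := measurable_norm3.
have K0 : 0 <= K by rewrite -lee_fin -KE integral_ge0// => v _; rewrite lee_fin exprn_ge0.
pose a := 4 * `|w 0 ord0| ^+ 3.
have a0 : 0 <= a by rewrite mulr_ge0// exprn_ge0.
apply: (@le_lt_trans _ _ (\int[gam]_t ((4 * K)%:E + a%:E * (`|t| ^+ 3)%:E))%E).
  apply: ge0_le_integral => //.
  - by move=> t _; apply: integral_ge0 => v _; rewrite lee_fin exprn_ge0.
  - apply: (measurable_partial_integral (pg R n) (mw _ w)) => v.
    by rewrite lee_fin exprn_ge0.
  - by apply: emeasurable_funD => //; apply: emeasurable_funM.
  move=> t _.
  apply: (@le_trans _ _ (\int[pg R n]_v ((a * `|t| ^+ 3)%:E + 4%:E * (`|dotp w' (toV v)| ^+ 3)%:E))%E).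
    apply: ge0_le_integral => //.
    - exact: (measurableT_comp (mw _ w) (pair1_measurable t)).
    - by apply: emeasurable_funD => //; apply: emeasurable_funM.
    move=> v _; rewrite -EFinM -EFinD lee_fin dotp_cons /=.
    by apply: le_trans (norm3_add _ _) _; rewrite normrM exprMn mulrDr mulrA.
  rewrite ge0_integralD; [|by []|by move=> v _; rewrite lee_fin mulr_ge0// exprn_ge0|by []
    |by move=> v _; rewrite mule_ge0// lee_fin exprn_ge0|exact: emeasurable_funM].
  rewrite ge0_integralZl; [|by []|exact: mw|by move=> v _; rewrite lee_fin exprn_ge0|by []].
  by rewrite integral_cst_probability KE -!EFinM addeC.
rewrite ge0_integralD; [|by []|by move=> v _; rewrite lee_fin mulr_ge0|by []
  |by move=> t _; rewrite mule_ge0// lee_fin exprn_ge0|exact: emeasurable_funM].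
rewrite ge0_integralZl; [|by []|by []|by move=> v _; rewrite lee_fin exprn_ge0|by []].
by rewrite integral_cst_probability JE -EFinM -EFinD ltry.
Qed.

End GaussianSpace.

(** * Gaussian moments and full support *)

Section GaussianMoments.
Variable R : realType.
Local Notation mR := (measurableTypeR R).
Local Notation gam := (@normal_prob R 0 1).
Local Notation phi := (@normal_pdf R 0 1).

Lemma pg_integrable_norm3 n (w : 'rV[R]_n) :
  (pg R n).-integrable setT (fun v => (`|dotp w (toV v)| ^+ 3)%:E).
Proof.
apply/integrableP; split.
  apply/measurable_EFinP; apply: measurable_funX; apply: measurableT_comp => //.
  exact: measurable_dotp.
under eq_integral do rewrite gee0_abs ?lee_fin ?exprn_ge0//.
exact: pg_moment3.
Qed.

(** A common dominating function: third powers of linear forms are the highest that occur, and lower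
    powers reduce to them by [norm_le_1norm3] and [sqr_le_1norm3]. *)
Lemma pg_integrable_bound n N (w : 'I_N -> 'rV[R]_n) (f : pT R n -> R) (K : R) :
  measurable_fun setT f ->
  (forall v, `|f v| <= K * (1 + \sum_i `|dotp (w i) (toV v)| ^+ 3)) ->
  (pg R n).-integrable setT (fun v => (f v)%:E).
Proof.
move=> mf fK.
have iS : (pg R n).-integrable setT
    (fun v => K%:E * (1%:E + \sum_(i < N) (`|dotp (w i) (toV v)| ^+ 3)%:E))%E.
  apply: integrableZl => //; apply: integrableD => //.
    exact: finite_measure_integrable_cst.
  by apply: integrable_sum => // i _; exact: pg_integrable_norm3.
apply: le_integrable iS => //; first exact/measurable_EFinP.
move=> v _; rewrite sumEFin -EFinD -EFinM /= lee_fin.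
by apply: le_trans (fK v) (ler_norm _).
Qed.

Lemma norm_le_1norm3 (a : R) : `|a| <= 1 + `|a| ^+ 3.
Proof.
have a0 := normr_ge0 a; move: `|a| a0 => x x0.
have [x1|x1] := leP x 1; first by have : 0 <= x ^+ 3 by [rewrite exprn_ge0]; lra.
have : x <= x ^+ 3 by rewrite -[leLHS]expr1 ler_weXn2l// ltW.
lra.
Qed.

Lemma sqr_le_1norm3 (a : R) : a ^+ 2 <= 1 + `|a| ^+ 3.
Proof.
rewrite -[a ^+ 2]ger0_norm ?sqr_ge0// normrX.
have a0 := normr_ge0 a; move: `|a| a0 => x x0.
have [x1|x1] := leP x 1.
  have : x ^+ 2 <= 1 by rewrite exprn_ile1.
  have : 0 <= x ^+ 3 by rewrite exprn_ge0.
  lra.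
have : x ^+ 2 <= x ^+ 3 by rewrite ler_weXn2l// ltW.
lra.
Qed.

Lemma pg_integrable_dotp n (w : 'rV[R]_n) :
  (pg R n).-integrable setT (fun v => (dotp w (toV v))%:E).
Proof.
apply: (@pg_integrable_bound n 1 (fun=> w) _ 1); first exact: measurable_dotp.
by move=> v; rewrite big_ord1 mul1r norm_le_1norm3.
Qed.

Lemma pg_integrable_dotp2 n (w : 'rV[R]_n) :
  (pg R n).-integrable setT (fun v => (dotp w (toV v) ^+ 2)%:E).
Proof.
apply: (@pg_integrable_bound n 1 (fun=> w) _ 1).
  by apply: measurable_funX; exact: measurable_dotp.
by move=> v; rewrite big_ord1 mul1r ger0_norm ?sqr_ge0// sqr_le_1norm3.
Qed.

Lemma pg_integralS_integrable n (f : pT R n.+1 -> \bar R) :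
  (pg R n.+1).-integrable setT f ->
  (\int[pg R n.+1]_v f v = \int[gam]_t \int[pg R n]_v f (t, v))%E.
Proof. by move=> fi; rewrite -[LHS]integral12_prod_meas1. Qed.

Lemma gauss_integrable_id : gam.-integrable setT (fun t : mR => (t : R)%:E).
Proof.
apply/integrableP; split; first exact/measurable_EFinP.
apply: (@le_lt_trans _ _ (\int[gam]_t (1%:E + (`|t| ^+ 3)%:E))%E).
  apply: ge0_le_integral; [by []|by []| | |].
  - by apply: measurableT_comp => //; exact/measurable_EFinP.
  - apply: emeasurable_funD => //; exact: measurable_norm3.
  - by move=> t _; rewrite -EFinD lee_fin norm_le_1norm3.
rewrite ge0_integralD; [|by []|by []|by []|by move=> t _; rewrite lee_fin exprn_ge0
  |exact: measurable_norm3].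
by rewrite integral_cst_probability lte_add_pinfty ?ltry// gauss_moment3.
Qed.

Lemma gauss_mean : (\int[gam]_t (t : R)%:E = 0)%E.
Proof.
have mE : measurable_fun setT (fun t : mR => (t : R)%:E) by exact/measurable_EFinP.
rewrite integralE.
have <- : (\int[gam]_t (fun t : mR => (t : R)%:E)^\+%E t =
           \int[gam]_t (fun t : mR => (t : R)%:E)^\-%E t)%E.
  rewrite -[LHS]gauss_symmetric//; last exact: measurable_funepos.
  by apply: eq_integral => t _; rewrite funeposE funenegE EFinN.
rewrite subee//; apply: integrable_pos_fin_num => //.
exact: gauss_integrable_id.
Qed.

(** Kept as a symbol: it multiplies the quadratic terms of both configurations by the same
    nonnegative factor. *)
Definition gauss_var : R := fine (\int[gam]_t ((t : R) ^+ 2)%:E)%E.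

Lemma gauss_varE : (\int[gam]_t ((t : R) ^+ 2)%:E = gauss_var%:E)%E.
Proof.
have m2 : measurable_fun setT (fun t : mR => ((t : R) ^+ 2)%:E).
  by apply/measurable_EFinP; exact: measurable_funX.
rewrite /gauss_var fineK// ge0_fin_numE; last first.
  by apply: integral_ge0 => t _; rewrite lee_fin sqr_ge0.
apply: (@le_lt_trans _ _ (\int[gam]_t (1%:E + (`|t| ^+ 3)%:E))%E).
  apply: ge0_le_integral; [by []|by move=> t _; rewrite lee_fin sqr_ge0|by []| |].
  - apply: emeasurable_funD => //; exact: measurable_norm3.
  - by move=> t _; rewrite -EFinD lee_fin sqr_le_1norm3.
rewrite ge0_integralD; [|by []|by []|by []|by move=> t _; rewrite lee_fin exprn_ge0
  |exact: measurable_norm3].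
by rewrite integral_cst_probability lte_add_pinfty ?ltry// gauss_moment3.
Qed.

Lemma gauss_var_ge0 : 0 <= gauss_var.
Proof. by rewrite fine_ge0// integral_ge0// => t _; rewrite lee_fin sqr_ge0. Qed.

Lemma pg_mean n (w : 'rV[R]_n) : (\int[pg R n]_v (dotp w (toV v))%:E = 0)%E.
Proof.
elim: n w => [|n IHn] w.
  by rewrite integral0_eq// => v _; rewrite /dotp big_ord0.
rewrite pg_integralS_integrable; last exact: pg_integrable_dotp.
set w' : 'rV[R]_n := \row_i w 0 (lift ord0 i).
transitivity (\int[gam]_t ((w 0 ord0)%:E * (t : R)%:E))%E.
  apply: eq_integral => t _.
  rewrite (eq_integral (fun v => ((w 0 ord0 * t)%:E + (dotp w' (toV v))%:E)%E)).
    rewrite integralD//; [|exact: finite_measure_integrable_cst|exact: pg_integrable_dotp].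
    by rewrite integral_cst_probability IHn adde0 EFinM.
  by move=> v _; rewrite dotp_cons EFinD.
by rewrite integralZl// ?gauss_mean ?mule0//; exact: gauss_integrable_id.
Qed.

Lemma pg_second n (w : 'rV[R]_n) :
  (\int[pg R n]_v (dotp w (toV v) ^+ 2)%:E = (gauss_var * dotp w w)%:E)%E.
Proof.
elim: n w => [|n IHn] w.
  rewrite integral0_eq; first by rewrite /dotp big_ord0 mulr0.
  by move=> v _; rewrite /dotp big_ord0 expr0n.
rewrite pg_integralS_integrable; last exact: pg_integrable_dotp2.
set w' : 'rV[R]_n := \row_i w 0 (lift ord0 i).
have m2 : measurable_fun setT (fun t : mR => ((t : R) ^+ 2)%:E).
  by apply/measurable_EFinP; exact: measurable_funX.
transitivity (\int[gam]_t ((w 0 ord0 ^+ 2)%:E * ((t : R) ^+ 2)%:E +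
    (gauss_var * dotp w' w')%:E))%E.
  apply: eq_integral => t _; set a := w 0 ord0 * t.
  rewrite (eq_integral (fun v => (((a ^+ 2)%:E + (2 * a)%:E * (dotp w' (toV v))%:E) +
      (dotp w' (toV v) ^+ 2)%:E)%E)); last first.
    move=> v _; rewrite dotp_cons -/w' -EFinM -!EFinD; congr (_%:E).
    by rewrite /= /a; ring.
  rewrite integralD//; last 2 first.
  - apply: integrableD => //; first exact: finite_measure_integrable_cst.
    by apply: integrableZl => //; exact: pg_integrable_dotp.
  - exact: pg_integrable_dotp2.
  rewrite integralD//; last 2 first.
  - exact: finite_measure_integrable_cst.
  - by apply: integrableZl => //; exact: pg_integrable_dotp.
  rewrite integralZl//; last exact: pg_integrable_dotp.
  by rewrite pg_mean mule0 adde0 integral_cst_probability IHn /a exprMn EFinM.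
rewrite ge0_integralD; [|by []|by move=> t _; rewrite -EFinM lee_fin mulr_ge0 ?sqr_ge0
  |exact: emeasurable_funM|by move=> t _; rewrite lee_fin mulr_ge0 ?dotp_ge0 ?gauss_var_ge0|by []].
rewrite ge0_integralZl; [|by []|by []|by move=> t _; rewrite lee_fin sqr_ge0
  |by rewrite lee_fin sqr_ge0].
rewrite gauss_varE integral_cst_probability -EFinM -EFinD; congr (_%:E).
rewrite /dotp big_ord_recl mulrDr mulrC; congr (_ * _ + _ * _).
by apply: eq_bigr => i _; rewrite !mxE.
Qed.

Lemma gauss_ball_gt0 (a e : R) : 0 < e -> (0 < gam `](a - e)%R, (a + e)%R[%classic)%E.
Proof.
move=> e0; pose M := `|a| + e.
have M0 : 0 < phi M by rewrite gauss_pdfE mulr_gt0 ?expR_gt0// normal_peak_gt0// oner_eq0.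
apply: (@lt_le_trans _ _ (\int[lebesgue_measure]_(t in `](a - e)%R, (a + e)%R[) (phi M)%:E)%E).
  have -> : (\int[lebesgue_measure]_(t in `](a - e)%R, (a + e)%R[) (phi M)%:E =
      (phi M)%:E * lebesgue_measure `](a - e)%R, (a + e)%R[%classic)%E.
    by rewrite integral_cst.
  rewrite lebesgue_measure_itv /= lte_fin.
  have -> : a - e < a + e by lra.
  by rewrite -EFinB -EFinM lte_fin mulr_gt0//; lra.
apply: ge0_le_integral => //.
- by move=> t _; rewrite lee_fin ltW.
- by apply: measurable_funTS; exact: measurable_gauss_pdfE.
- move=> t /=; rewrite in_itv /= => /andP[t1 t2].
  rewrite lee_fin !gauss_pdfE ler_wpM2l ?normal_peak_ge0// ler_expR lerN2 ler_pM2r ?invr_gt0//.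
  rewrite -[t ^+ 2]ger0_norm ?sqr_ge0// normrX lerXn2r ?nnegrE ?addr_ge0 ?(ltW e0)//.
  rewrite ler_norml /M; have := ler_norm a; have := ler_norm (- a); rewrite normrN => h1 h2.
  by apply/andP; split; lra.
Qed.

Lemma pg_ball_gt0 n (x : 'rV[R]_n) (e : R) : 0 < e ->
  measurable [set v : pT R n | forall i, `|toV v 0 i - x 0 i| < e] /\
  (0 < pg R n [set v : pT R n | forall i, (`|toV v ord0 i - x ord0 i| < e)%R])%E.
Proof.
move=> e0; elim: n x => [|n IHn] x.
  have E : [set v : pT R 0 | forall i, `|toV v 0 i - x 0 i| < e] = setT.
    by apply/seteqP; split=> // v _ [].
  by rewrite E; split=> //; rewrite [X in (_ < X)%E]probability_setT.
have [mB B0] := IHn (\row_i x 0 (lift ord0 i)).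
set B := (X in measurable X) in mB; rewrite -/B in B0.
have E : [set v : pT R n.+1 | forall i, `|toV v 0 i - x 0 i| < e] =
    `]x 0 ord0 - e, x 0 ord0 + e[%classic `*` B.
  apply/seteqP; split=> [v /= H|v /= [H1 H2] i].
    split=> [|i] /=.
      by have := H ord0; rewrite toV0 in_itv /= ltr_distl.
    by have := H (lift ord0 i); rewrite toVS mxE.
  case: (unliftP ord0 i) => [k ->|->].
    by have := H2 k; rewrite toVS mxE.
  by move: H1; rewrite toV0 /= in_itv /= ltr_distl.
rewrite E; split; first exact: measurableX.
by rewrite pgX// mule_gt0// gauss_ball_gt0.
Qed.

(** The Gaussian measure charges every box, and near a point where it is positive a Lipschitz
    function stays bounded below. This turns equality of integrals into equality at every point, so
    that shifts can be prescribed exactly. *)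
Lemma pg_integral_eq0 n (D : 'rV[R]_n -> R) (K : R) :
  measurable_fun setT (fun v : pT R n => D (toV v)) ->
  (forall x, 0 <= D x) ->
  (forall x y : 'rV[R]_n, `|D x - D y| <= K * \sum_i `|x 0 i - y 0 i|) ->
  (\int[pg R n]_v (D (toV v))%:E = 0)%E -> forall x, D x = 0.
Proof.
move=> mD D0 DK I0 x; apply/eqP; rewrite eq_le D0 andbT leNgt; apply/negP => Dx.
have K0 : 0 <= `|K| * n%:R by rewrite mulr_ge0// ler0n.
(* On a box of this half-width the Lipschitz bound [|K| n e] is at most [D x / 2]; the added 1 keeps
   the denominator positive when [K] or [n] is zero. *)
pose e := D x / (2 * (`|K| * n%:R + 1)).
have e0 : 0 < e by rewrite divr_gt0// mulr_gt0//; lra.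
have [mB B0] := pg_ball_gt0 x e0; set B := (X in measurable X) in mB.
rewrite -/B in B0.
have : (0 < \int[pg R n]_v (D (toV v))%:E)%E.
  apply: (@lt_le_trans _ _ (\int[pg R n]_v ((D x / 2)%:E * (\1_B v)%:E))%E).
    rewrite ge0_integralZl; [|by []|by apply/measurable_EFinP; exact: measurable_indic|by []
      |by rewrite lee_fin divr_ge0// ltW].
    by rewrite integral_indic// setIT mule_gt0// lte_fin divr_gt0.
  apply: ge0_le_integral; [by []| | |exact/measurable_EFinP|].
  - by move=> v _; rewrite -EFinM lee_fin mulr_ge0// divr_ge0// ltW.
  - by apply: emeasurable_funM => //; apply/measurable_EFinP; exact: measurable_indic.
  move=> v _; rewrite -EFinM lee_fin indicE.
  have [|_] := boolP (v \in B); last by rewrite mulr0.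
  rewrite inE /B /= mulr1 => vB.
  have : `|D x - D (toV v)| <= D x / 2.
    apply: le_trans (DK _ _) _.
    apply: (@le_trans _ _ (`|K| * \sum_i `|x 0 i - toV v 0 i|)).
      by rewrite ler_wpM2r ?ler_norm// sumr_ge0.
    apply: (@le_trans _ _ (`|K| * (n%:R * e))).
      rewrite ler_wpM2l//; apply: (@le_trans _ _ (\sum_(i < n) e)).
        by apply: ler_sum => i _; rewrite distrC ltW.
      by rewrite sumr_const card_ord mulr_natl.
    rewrite mulrA /e mulrA ler_pdivrMr; last by rewrite mulr_gt0//; lra.
    have -> : D x / 2 * (2 * (`|K| * n%:R + 1)) = (`|K| * n%:R + 1) * D x by field.
    by rewrite ler_wpM2r//; lra.
  by rewrite ler_norml => /andP[]; lra.
by rewrite I0 ltxx.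
Qed.

End GaussianMoments.

(** * Log-sum-exp *)

Section LogSumExp.
Variable R : realType.
Implicit Types (N k : nat).

(** One step of Taylor's theorem, gaining one power. The radius 2 suits [cumulant_taylor], where
    deviations from the mean are at most [2 Y] with [Y <= 1]. *)
Lemma mvt_power_bound (f df : R -> R) (K : R) k : f 0 = 0 ->
  (forall x : R, is_derive x 1 f (df x)) ->
  (forall x, `|x| <= 2 -> `|df x| <= K * `|x| ^+ k) ->
  forall x, `|x| <= 2 -> `|f x| <= K * `|x| ^+ k.+1.
Proof.
move=> f0 fd dfK x x2.
have K0 : 0 <= K.
  have h2 : `|2 : R| <= 2 by rewrite ger0_norm.
  have := le_trans (normr_ge0 _) (dfK 2 h2).
  by rewrite pmulr_lge0// exprn_gt0// normr_gt0.
have cf a b : {within `[a, b], continuous f}.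
  by apply: derivable_within_continuous => y _; exact: ex_derive.
have key c : `|c| <= `|x| -> f x = df c * x -> `|f x| <= K * `|x| ^+ k.+1.
  move=> cx ->; rewrite normrM exprSr mulrA ler_wpM2r//.
  by rewrite (le_trans (dfK c (le_trans cx x2)))// ler_wpM2l// lerXn2r// nnegrE.
have [x0|x0|x0] := ltgtP x 0.
- have [c] := MVT x0 (fun y _ => fd y) (cf x 0).
  rewrite in_itv /= f0 sub0r sub0r mulrN => /andP[cx c0] /oppr_inj e.
  by apply: key e; rewrite !ltr0_norm// lerN2 ltW.
- have [c] := MVT x0 (fun y _ => fd y) (cf 0 x).
  rewrite in_itv /= f0 !subr0 => /andP[c0 cx] e.
  by apply: key e; rewrite !gtr0_norm// ltW.
- by rewrite x0 f0 normr0 expr0n mulr0.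
Qed.

Lemma expR_taylor3 : exists K : R, 0 <= K /\
  forall z, `|z| <= 2 -> `|expR z - 1 - z - z ^+ 2 / 2| <= K * `|z| ^+ 3.
Proof.
exists (expR 2); split; first exact: expR_ge0.
pose f1 (z : R) := expR z - 1.
pose f2 (z : R) := expR z - 1 - z.
pose f3 (z : R) := expR z - 1 - z - z ^+ 2 / 2.
apply: (@mvt_power_bound f3 f2 _ 2).
- by rewrite /f3 expR0; ring.
- move=> x; rewrite /f3 /f2; apply: is_derive_eq.
  by rewrite !scaler1 /GRing.scale /=; field.
apply: (@mvt_power_bound f2 f1 _ 1).
- by rewrite /f2 expR0; ring.
- move=> x; rewrite /f2 /f1; apply: is_derive_eq.
  by rewrite /GRing.scale /=; ring.
apply: (@mvt_power_bound f1 expR _ 0).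
- by rewrite /f1 expR0; ring.
- move=> x; rewrite /f1; apply: is_derive_eq.
  by rewrite /GRing.scale /=; ring.
move=> x x2; rewrite expr0 mulr1 ger0_norm ?expR_ge0// ler_expR.
by rewrite (le_trans (ler_norm _)).
Qed.

(** Written over pairs, the variance involves the differences [y i - y j] alone; after Gaussian
    averaging these become squared distances. *)
Lemma variance_pairs N (s y : 'I_N -> R) : \sum_i s i = 1 ->
  let m := \sum_i s i * y i in
  \sum_i s i * (y i - m) ^+ 2 =
  2^-1 * \sum_i \sum_j s i * s j * (y i - y j) ^+ 2.
Proof.
move=> s1 m.
have -> : \sum_i \sum_j s i * s j * (y i - y j) ^+ 2 =
    \sum_i \sum_j s i * s j * (y i ^+ 2) - 2 * (\sum_i \sum_j s i * s j * (y i * y j)) +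
    \sum_i \sum_j s i * s j * (y j ^+ 2).
  rewrite mulr_sumr -sumrB -big_split; apply: eq_bigr => i _ /=.
  rewrite mulr_sumr -sumrB -big_split; apply: eq_bigr => j _ /=; ring.
have e1 : \sum_i \sum_j s i * s j * (y i ^+ 2) = \sum_i s i * y i ^+ 2.
  apply: eq_bigr => i _; under eq_bigr do rewrite mulrAC.
  by rewrite -mulr_sumr s1 mulr1.
have e2 : \sum_i \sum_j s i * s j * (y j ^+ 2) = \sum_i s i * y i ^+ 2.
  rewrite exchange_big -e1; apply: eq_bigr => i _; apply: eq_bigr => j _.
  by rewrite (mulrC (s i)).
have e3 : \sum_i \sum_j s i * s j * (y i * y j) = m ^+ 2.
  rewrite expr2 /m mulr_suml; apply: eq_bigr => i _.
  by rewrite mulr_sumr; apply: eq_bigr => j _; rewrite mulrACA.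
rewrite e1 e2 e3.
under eq_bigr => i _.
  have -> : s i * (y i - m) ^+ 2 = s i * y i ^+ 2 - (2 * m) * (s i * y i) + m ^+ 2 * s i by ring.
  over.
by rewrite big_split sumrB /= -!mulr_sumr s1 -/m; field.
Qed.

Lemma weighted_mean_le N (s a : 'I_N -> R) b : (forall i, 0 <= s i) ->
  \sum_i s i = 1 -> (forall i, a i <= b) -> \sum_i s i * a i <= b.
Proof.
move=> s0 s1 ab; rewrite -[leRHS]mul1r -s1 mulr_suml; apply: ler_sum => i _.
by rewrite ler_wpM2l.
Qed.

Lemma weighted_mean_ge N (s a : 'I_N -> R) b : (forall i, 0 <= s i) ->
  \sum_i s i = 1 -> (forall i, b <= a i) -> b <= \sum_i s i * a i.
Proof.
move=> s0 s1 ab; rewrite -[leLHS]mul1r -s1 mulr_suml; apply: ler_sum => i _.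
by rewrite ler_wpM2l.
Qed.

(** The upper bound [ln x <= x - 1] at [x = 1 / (1 + w)] gives [ln (1 + w) >= w / (1 + w)]. *)
Lemma ln_ge_sub_sqr (w : R) : 0 <= w -> w - w ^+ 2 <= ln (1 + w).
Proof.
move=> w0; have w1 : 0 < 1 + w by lra.
have : ln (1 + w)^-1 <= (1 + w)^-1 - 1.
  have := @le_ln1Dx R ((1 + w)^-1 - 1); rewrite [1 + (_ - 1)]addrC subrK; apply.
  by rewrite ltrBrDr addrC subrr invr_gt0.
rewrite lnV ?posrE// => h.
have e : 1 - (1 + w)^-1 = w / (1 + w) by field; rewrite gt_eqF.
have : w - w ^+ 2 <= w / (1 + w).
  rewrite ler_pdivlMr//; have : 0 <= w ^+ 3 by rewrite exprn_ge0.
  rewrite !exprS expr0; nra.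
by rewrite -e; lra.
Qed.

(** The second-order expansion of a cumulant generating function. The constant is uniform in the
    weights, which will be softmax weights depending on the shift. *)
Lemma cumulant_taylor : exists C : R, 0 <= C /\
  forall N (s y : 'I_N -> R) Y, (forall i, 0 <= s i) -> \sum_i s i = 1 ->
    (forall i, `|y i| <= Y) ->
    `|ln (\sum_i s i * expR (y i)) - \sum_i s i * y i
       - 4^-1 * \sum_i \sum_j s i * s j * (y i - y j) ^+ 2| <= C * Y ^+ 3.
Proof.
have [K [K0 HK]] := expR_taylor3.
(* For [Y > 1] the crude bound [Y + Y + 2 Y^2 <= 4 Y^3] accounts for the 4. For [Y <= 1], [8 K] is
   the Taylor remainder at deviations [2 Y], and the square comes from [w - w^2 <= ln (1 + w)] with
   [w <= (2 + 8 K) Y^2]. *)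
exists (8 * K + (2 + 8 * K) ^+ 2 + 4); split.
  by have := sqr_ge0 (2 + 8 * K); lra.
move=> N s y Y s0 s1 yY.
pose m := \sum_i s i * y i.
have Y0 : 0 <= Y.
  case: N s y s0 s1 yY @m => [s y _ |N s y _ _ yY _].
    by rewrite big_ord0 => /eqP; rewrite eq_sym oner_eq0.
  exact: le_trans (normr_ge0 _) (yY ord0).
have yle i : - Y <= y i <= Y by rewrite -ler_norml.
have mY : - Y <= m <= Y.
  by apply/andP; split; [apply: weighted_mean_ge|apply: weighted_mean_le] => // i;
    have /andP[] := yle i.
set D := \sum_i \sum_j _.
have vE : D = 2 * \sum_i s i * (y i - m) ^+ 2.
  by have := variance_pairs y s1; rewrite /= -/m -/D => ->; field.
set v := \sum_i s i * (y i - m) ^+ 2 in vE.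
have v0 : 0 <= v by apply: sumr_ge0 => i _; rewrite mulr_ge0// sqr_ge0.
have v4 : v <= 4 * Y ^+ 2.
  apply: weighted_mean_le => // i; have /andP[h1 h2] := yle i; have /andP[h3 h4] := mY.
  rewrite !expr2; nra.
have -> : 4^-1 * D = v / 2 by rewrite vE; field.
have [Y1|Y1] := leP Y 1; last first.
  have eY i : expR (- Y) <= expR (y i) <= expR Y by rewrite !ler_expR.
  have h1 : ln (\sum_i s i * expR (y i)) <= Y.
    rewrite -[leRHS]expRK ler_ln ?posrE ?expR_gt0//.
      by apply: weighted_mean_le => // i; have /andP[] := eY i.
    apply: lt_le_trans (expR_gt0 (- Y)) _.
    by apply: weighted_mean_ge => // i; have /andP[] := eY i.
  have h2 : - Y <= ln (\sum_i s i * expR (y i)).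
    rewrite -[leLHS]expRK ler_ln ?posrE ?expR_gt0//.
      by apply: weighted_mean_ge => // i; have /andP[] := eY i.
    apply: lt_le_trans (expR_gt0 (- Y)) _.
    by apply: weighted_mean_ge => // i; have /andP[] := eY i.
  have b0 : 0 <= 8 * K + (2 + 8 * K) ^+ 2 by have := sqr_ge0 (2 + 8 * K); lra.
  have : 4 * Y ^+ 3 <= (8 * K + (2 + 8 * K) ^+ 2 + 4) * Y ^+ 3.
    by rewrite ler_wpM2r ?exprn_ge0//; lra.
  have Y2 : Y <= Y ^+ 2 by rewrite expr2; nra.
  have Y3 : Y ^+ 2 <= Y ^+ 3 by rewrite [in leRHS]exprS expr2; nra.
  move=> h3; rewrite ler_norml; have /andP[m1 m2] := mY; rewrite -/m.
  by apply/andP; split; lra.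
(* Centring at the mean removes the linear term, so [A - 1] is of order [Y^2] and its square is
   harmless. *)
pose A := \sum_i s i * expR (y i - m).
have AE : \sum_i s i * expR (y i) = expR m * A.
  rewrite /A mulr_sumr; apply: eq_bigr => i _.
  by rewrite mulrCA -expRD addrC subrK.
have zsum : \sum_i s i * (y i - m) = 0.
  by under eq_bigr do rewrite mulrBr; rewrite sumrB -mulr_suml s1 mul1r subrr.
have A1 : 1 <= A.
  have : \sum_i s i * (1 + (y i - m)) <= A.
    by apply: ler_sum => i _; rewrite ler_wpM2l// expR_ge1Dx.
  by under eq_bigr do rewrite mulrDr mulr1; rewrite big_split /= s1 zsum addr0.
have errA : `|A - 1 - v / 2| <= 8 * K * Y ^+ 3.
  have -> : A - 1 - v / 2 = \sum_i s i * (expR (y i - m) - 1 - (y i - m) - (y i - m) ^+ 2 / 2).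
    transitivity (\sum_i (s i * expR (y i - m) - s i - s i * (y i - m) -
        s i * (y i - m) ^+ 2 / 2)).
      by rewrite !sumrB s1 zsum subr0 -mulr_suml.
    by apply: eq_bigr => i _; field.
  apply: le_trans (ler_norm_sum _ _ _) _.
  under eq_bigr do rewrite normrM (ger0_norm (s0 _)).
  apply: weighted_mean_le => // i.
  have zY : `|y i - m| <= 2 * Y.
    rewrite ler_norml; have /andP[h1 h2] := yle i; have /andP[h3 h4] := mY.
    by apply/andP; split; lra.
  have z2 : `|y i - m| <= 2 by lra.
  apply: le_trans (HK _ z2) _.
  have -> : 8 * K * Y ^+ 3 = K * (2 * Y) ^+ 3 by rewrite exprMn; ring.
  by rewrite ler_wpM2l// lerXn2r// nnegrE mulr_ge0.
have -> : ln (\sum_i s i * expR (y i)) = m + ln A.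
  by rewrite AE lnM ?posrE ?expR_gt0 ?expRK//; lra.
pose w := A - 1; have w0 : 0 <= w by rewrite /w; lra.
have AwE : A = 1 + w by rewrite /w; ring.
have lnA1 : ln A <= w.
  by rewrite AwE; apply: le_ln1Dx; lra.
have lnA2 : w - w ^+ 2 <= ln A by rewrite AwE; exact: ln_ge_sub_sqr.
have Y32 : Y ^+ 3 <= Y ^+ 2 by rewrite exprS expr2; nra.
have Y3 : 0 <= Y ^+ 3 by rewrite exprn_ge0.
move: errA; rewrite ler_norml -/w => /andP[e1 e2].
have wY : w <= (2 + 8 * K) * Y ^+ 2.
  have : 8 * K * Y ^+ 3 <= 8 * K * Y ^+ 2 by rewrite ler_wpM2l//; lra.
  rewrite mulrDl; lra.
have w2 : w ^+ 2 <= (2 + 8 * K) ^+ 2 * Y ^+ 3.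
  have : w ^+ 2 <= ((2 + 8 * K) * Y ^+ 2) ^+ 2.
    by rewrite lerXn2r// nnegrE (le_trans w0).
  move=> /le_trans; apply; rewrite exprMn ler_wpM2l ?sqr_ge0//.
  by rewrite -exprM [leLHS]exprS ler_piMl.
rewrite -/m ler_norml; apply/andP; split; rewrite !mulrDl; lra.
Qed.

Definition lse N (c : 'I_N -> R) : R := ln (\sum_i expR (c i)).

Definition softmax N (c : 'I_N -> R) (i : 'I_N) : R := expR (c i) / \sum_j expR (c j).

Lemma sum_expR_gt0 N (i0 : 'I_N) (c : 'I_N -> R) : 0 < \sum_i expR (c i).
Proof.
rewrite (bigD1 i0)//= ltr_pwDl ?expR_gt0// sumr_ge0// => i _; exact: expR_ge0.
Qed.

Lemma softmax_ge0 N (c : 'I_N -> R) i : 0 <= softmax c i.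
Proof. by rewrite divr_ge0 ?expR_ge0// sumr_ge0// => j _; exact: expR_ge0. Qed.

Lemma sum_softmax N (i0 : 'I_N) (c : 'I_N -> R) : \sum_i softmax c i = 1.
Proof. by rewrite -mulr_suml divff// gt_eqF// (sum_expR_gt0 i0). Qed.

(** The increment [lse (c + y) - lse c] is the cumulant generating function of [y] under the softmax
    weights of [c], which is why [C] can be chosen before [c]. *)
Lemma lse_taylor : exists C : R, 0 <= C /\
  forall N (i0 : 'I_N) (c y : 'I_N -> R),
    `|lse (fun i => c i + y i) - lse c - \sum_i softmax c i * y i
       - 4^-1 * \sum_i \sum_j softmax c i * softmax c j * (y i - y j) ^+ 2|
    <= C * \sum_i `|y i| ^+ 3.
Proof.
have [C [C0 HC]] := cumulant_taylor; exists C; split=> // N i0 c y.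
have [k _ kmax] := @arg_maxP _ _ _ i0 xpredT (fun i => `|y i|) isT.
have S0 := sum_expR_gt0 i0 c.
have -> : lse (fun i => c i + y i) - lse c = ln (\sum_i softmax c i * expR (y i)).
  rewrite /lse; have -> : \sum_i expR (c i + y i) =
      (\sum_j expR (c j)) * \sum_i softmax c i * expR (y i).
    rewrite mulr_sumr; apply: eq_bigr => i _; rewrite expRD /softmax; field.
    by rewrite gt_eqF.
  have S1 : 0 < \sum_i softmax c i * expR (y i).
    rewrite (bigD1 i0)//= ltr_pwDl//.
      by rewrite mulr_gt0 ?expR_gt0// divr_gt0// expR_gt0.
    by rewrite sumr_ge0// => i _; rewrite mulr_ge0 ?softmax_ge0 ?expR_ge0.
  by rewrite lnM ?posrE//; ring.
apply: le_trans (HC _ _ _ `|y k| (softmax_ge0 c) (sum_softmax i0 c) _) _.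
  by move=> i; exact: kmax.
by rewrite ler_wpM2l// (bigD1 k)//= lerDl sumr_ge0.
Qed.

Definition maxc N (i0 : 'I_N) (c : 'I_N -> R) : R := \big[Num.max/c i0]_i c i.

Lemma maxc_ge N (i0 : 'I_N) c i : c i <= maxc i0 c.
Proof. exact: le_bigmax. Qed.

Lemma maxc_le N (i0 : 'I_N) c b : (forall i, c i <= b) -> maxc i0 c <= b.
Proof. by move=> cb; apply: bigmax_le. Qed.

Lemma maxc_attained N (i0 : 'I_N) (c : 'I_N -> R) : exists i, maxc i0 c = c i.
Proof.
have [k _ kmax] := @arg_maxP _ _ _ i0 xpredT c isT; exists k; apply/eqP.
by rewrite eq_le maxc_ge andbT maxc_le// => i; exact: kmax.
Qed.

Lemma maxc_le_lse N (i0 : 'I_N) c : maxc i0 c <= lse c.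
Proof.
have [k ->] := maxc_attained i0 c; rewrite -[leLHS]expRK ler_ln ?posrE ?expR_gt0//.
  by rewrite (bigD1 k)//= lerDl sumr_ge0// => i _; exact: expR_ge0.
exact: sum_expR_gt0.
Qed.

Lemma lse_le_maxc N (i0 : 'I_N) c : lse c <= maxc i0 c + ln N%:R.
Proof.
have N0 : 0 < (N%:R : R) by rewrite ltr0n; case: N i0 c => [[]|].
rewrite -[X in X + _]expRK -lnM ?posrE ?expR_gt0// ler_ln ?posrE ?mulr_gt0 ?expR_gt0//; last first.
  exact: sum_expR_gt0.
have -> : expR (maxc i0 c) * N%:R = \sum_(i < N) expR (maxc i0 c).
  by rewrite sumr_const card_ord mulr_natr.
apply: ler_sum => i _.
by rewrite ler_expR maxc_ge.
Qed.

Lemma maxc_lipschitz N (i0 : 'I_N) c d : `|maxc i0 c - maxc i0 d| <= \sum_i `|c i - d i|.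
Proof.
have H (a b : 'I_N -> R) : maxc i0 a <= maxc i0 b + \sum_i `|a i - b i|.
  apply: maxc_le => i; rewrite (bigD1 i)//=.
  have := maxc_ge i0 b i; have := ler_norm (a i - b i).
  have : 0 <= \sum_(j < N | j != i) `|a j - b j| by apply: sumr_ge0.
  lra.
have H1 := H c d; have := H d c.
rewrite (eq_bigr (fun i => `|c i - d i|)) => [|i _]; last exact: distrC.
by move=> H2; rewrite ler_norml; apply/andP; split; lra.
Qed.

End LogSumExp.

(** * The Sudakov-Fernique comparison *)

Lemma lee_double (R : realType) (x y y' z : \bar R) (K : R) :
  (x <= y + K%:E -> y = y' -> y' <= z + K%:E -> x <= z + (2 * K)%:E)%E.
Proof.
move=> xy yy yz; rewrite -{}yy in yz; apply: le_trans xy _.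
have -> : (2 * K)%:E = (K%:E + K%:E)%E by rewrite -EFinD; congr (_%:E); ring.
by rewrite addeA leeD2r.
Qed.

Section Expectation.
Variables (R : realType) (n : nat).

(** Integrability travels with the value, so that expectations of linear combinations can be
    assembled and compared without separate side conditions. *)
Definition has_mean (f : 'rV[R]_n -> R) (r : R) : Prop :=
  (pg R n).-integrable setT (fun v => (f (toV v))%:E) /\
  (\int[pg R n]_v (f (toV v))%:E = r%:E)%E.

Lemma has_mean_integrable f : (pg R n).-integrable setT (fun v => (f (toV v))%:E) ->
  has_mean f (fine (\int[pg R n]_v (f (toV v))%:E)%E).
Proof. by move=> fi; split=> //; rewrite fineK//; exact: integrable_fin_num. Qed.

Lemma has_mean_cst r : has_mean (fun=> r) r.
Proof.
split; first exact: finite_measure_integrable_cst.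
exact: integral_cst_probability.
Qed.

Lemma has_meanD f g r s : has_mean f r -> has_mean g s ->
  has_mean (fun x => f x + g x) (r + s).
Proof.
move=> [fi fr] [gi gs]; split; first exact: (integrableD measurableT fi gi).
by rewrite (integralD measurableT fi gi) fr gs.
Qed.

Lemma has_meanZ a f r : has_mean f r -> has_mean (fun x => a * f x) (a * r).
Proof.
move=> [fi fr]; split; first exact: (integrableZl measurableT a fi).
by rewrite (integralZl measurableT fi) fr.
Qed.

Lemma has_meanB f g r s : has_mean f r -> has_mean g s ->
  has_mean (fun x => f x - g x) (r - s).
Proof.
move=> fr gs; have := has_meanD fr (has_meanZ (-1) gs); rewrite mulN1r.
by under eq_fun do rewrite mulN1r.
Qed.

Lemma has_mean_sum (I : finType) (f : I -> 'rV[R]_n -> R) (r : I -> R) :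
  (forall i, has_mean (f i) (r i)) -> has_mean (fun x => \sum_i f i x) (\sum_i r i).
Proof.
move=> fr.
suff H (s : seq I) : has_mean (fun x => \sum_(i <- s) f i x) (\sum_(i <- s) r i) by exact: H.
elim: s => [|i s IHs].
  by under eq_fun do rewrite big_nil; rewrite big_nil; exact: has_mean_cst.
by under eq_fun do rewrite big_cons; rewrite big_cons; exact: has_meanD.
Qed.

Lemma has_mean_le f g r s : has_mean f r -> has_mean g s ->
  (forall x, f x <= g x) -> r <= s.
Proof.
move=> [fi fr] [gi gs] fg; rewrite -lee_fin -fr -gs.
by apply: le_integral => // v _; rewrite lee_fin.
Qed.

Lemma has_mean_uniq f r s : has_mean f r -> has_mean f s -> r = s.
Proof. by move=> [_ fr] [_]; rewrite fr => -[]. Qed.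

Lemma has_mean_dotp w : has_mean (fun x => dotp w x) 0.
Proof. by split; [exact: pg_integrable_dotp|exact: pg_mean]. Qed.

Lemma has_mean_dotp2 w : has_mean (fun x => dotp w x ^+ 2) (gauss_var R * dotp w w).
Proof. by split; [exact: pg_integrable_dotp2|exact: pg_second]. Qed.

End Expectation.

Section Comparison.
Variables (R : realType) (n N : nat) (i0 : 'I_N).
Implicit Types (p q : 'I_N -> 'rV[R]_n) (c : 'I_N -> R).
Local Notation r2 := (Num.sqrt (2 : R)).

Definition shiftc c p (x : 'rV[R]_n) : 'I_N -> R := fun i => c i + dotp (p i) x.
Definition scalec (a : R) p : 'I_N -> 'rV[R]_n := fun i => a *: p i.

Lemma shiftc_i0 c p x : p i0 = 0 -> shiftc c p x i0 = c i0.
Proof. by move=> p0; rewrite /shiftc p0 dotp0l addr0. Qed.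

Lemma scalec_i0 a p : p i0 = 0 -> scalec a p i0 = 0.
Proof. by move=> p0; rewrite /scalec p0 scaler0. Qed.

Lemma scalec1 p : scalec 1 p = p.
Proof. by apply/funext => i; rewrite /scalec scale1r. Qed.

Lemma scalecA a b p : scalec a (scalec b p) = scalec (a * b) p.
Proof. by apply/funext => i; rewrite /scalec scalerA. Qed.

Section Functional.
Variable Phi : ('I_N -> R) -> R.
Hypothesis Phi_measurable : forall d (T : measurableType d) (g : 'I_N -> T -> R),
  (forall i, measurable_fun setT (g i)) -> measurable_fun setT (fun t => Phi (fun i => g i t)).
Hypothesis Phi_ge : forall c i, c i <= Phi c.
Variable A : R.
Hypothesis Phi_le : forall c, Phi c <= A + \sum_i `|c i|.

(** When [p i0 = 0], subtracting [c i0] makes the integrand nonnegative. Moreover a shift along such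
    a configuration leaves the coordinate [i0] alone, so the same constant is subtracted at every
    stage of the semigroup argument. *)
Definition meanPhi p c : \bar R := (\int[pg R n]_v (Phi (shiftc c p (toV v)) - c i0)%:E)%E.

Lemma shiftc_measurable c p i : measurable_fun setT (fun v : pT R n => shiftc c p (toV v) i).
Proof. by apply: measurable_funD => //; exact: measurable_dotp. Qed.

Lemma measurable_Phi_shift c p :
  measurable_fun setT (fun v : pT R n => Phi (shiftc c p (toV v)) - c i0).
Proof.
apply: measurable_funB => //; apply: Phi_measurable => i; exact: shiftc_measurable.
Qed.

Lemma Phi_shift_ge0 c p x : p i0 = 0 -> 0 <= Phi (shiftc c p x) - c i0.
Proof. by move=> p0; rewrite subr_ge0 -[leLHS](shiftc_i0 c x p0) Phi_ge. Qed.

Lemma Phi_integrable c p :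
  (pg R n).-integrable setT (fun v => (Phi (shiftc c p (toV v)) - c i0)%:E).
Proof.
pose K := `|A| + \sum_i `|c i| + `|c i0| + `|c i0| + N%:R + 1.
have S0 : 0 <= \sum_i `|c i| by apply: sumr_ge0.
have K1 : 1 <= K.
  by rewrite /K; have := normr_ge0 A; have := normr_ge0 (c i0);
     have := ler0n R N; lra.
apply: (@pg_integrable_bound _ _ _ p _ K); first exact: measurable_Phi_shift.
move=> v; set T := \sum_i `|dotp (p i) (toV v)| ^+ 3.
have T0 : 0 <= T by apply: sumr_ge0 => i _; rewrite exprn_ge0.
have h1 : Phi (shiftc c p (toV v)) <= A + \sum_i `|c i| + (N%:R + T).
  apply: le_trans (Phi_le _) _; rewrite -addrA lerD2l -[N%:R]/(1 *+ N).
  have -> : 1 *+ N = \sum_(i < N) (1 : R) by rewrite sumr_const card_ord.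
  rewrite /T -big_split -big_split; apply: ler_sum => i _ /=.
  by apply: le_trans (ler_normD _ _) _; rewrite lerD2l norm_le_1norm3.
have h2 : c i0 - (1 + T) <= Phi (shiftc c p (toV v)).
  apply: le_trans (Phi_ge _ i0); rewrite /shiftc lerD2l lerNl.
  apply: le_trans (ler_norm _) _; rewrite normrN; apply: le_trans (norm_le_1norm3 _) _.
  by rewrite lerD2l /T (bigD1 i0)//= lerDl sumr_ge0.
have h3 : K + T <= K * (1 + T) by rewrite mulrDr mulr1 lerD2l ler_peMl.
have := ler_norm A; have := ler_norm (c i0); have := ler_norm (- c i0).
rewrite normrN => k1 k2 k3.
rewrite ler_norml; apply/andP; split; rewrite /K in h3 *;
  have := normr_ge0 A; have := normr_ge0 (c i0); have := ler0n R N; lra.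
Qed.

Lemma meanPhiE p c : meanPhi p c = (fine (meanPhi p c))%:E.
Proof. by rewrite fineK//; apply: integrable_fin_num => //; exact: Phi_integrable. Qed.

Lemma meanPhi_ge0 p c : p i0 = 0 -> (0 <= meanPhi p c)%E.
Proof. by move=> p0; apply: integral_ge0 => v _; rewrite lee_fin Phi_shift_ge0. Qed.

Lemma has_mean_Phi p c :
  has_mean (fun x => Phi (shiftc c p x) - c i0) (fine (meanPhi p c)).
Proof. by apply: has_mean_integrable; exact: Phi_integrable. Qed.

Lemma measurable_Phi_shift2 c p q : measurable_fun setT
  (fun w : pT R n * pT R n => (Phi (shiftc (shiftc c p (toV w.1)) q (toV w.2)) - c i0)%:E).
Proof.
apply/measurable_EFinP; apply: measurable_funB => //; apply: Phi_measurable => i.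
apply: measurable_funD.
  exact: (measurableT_comp (shiftc_measurable c p i) measurable_fst).
exact: (measurableT_comp (measurable_dotp (q i)) measurable_snd).
Qed.

Lemma shiftcAC c p q x y : shiftc (shiftc c p x) q y = shiftc (shiftc c q y) p x.
Proof. by apply/funext => i; rewrite /shiftc addrAC. Qed.

Lemma meanPhi_shift p q c (u : pT R n) : p i0 = 0 ->
  meanPhi q (shiftc c p (toV u)) =
  (\int[pg R n]_v (Phi (shiftc (shiftc c p (toV u)) q (toV v)) - c i0)%:E)%E.
Proof. by move=> p0; rewrite /meanPhi shiftc_i0. Qed.

Lemma measurable_meanPhi p q c : p i0 = 0 -> q i0 = 0 ->
  measurable_fun setT (fun u : pT R n => meanPhi q (shiftc c p (toV u))).
Proof.
move=> p0 q0; under eq_fun do rewrite meanPhi_shift//.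
apply: (measurable_partial_integral (pg R n) (measurable_Phi_shift2 c p q)) => w /=.
by rewrite lee_fin -(shiftc_i0 c (toV w.1) p0) Phi_shift_ge0.
Qed.

(** The Gaussian vector is split into two independent halves, of which the outer one becomes a
    shift. *)
Lemma meanPhi_semigroup p c : p i0 = 0 ->
  (meanPhi p c =
   \int[pg R n]_u meanPhi (scalec r2^-1 p) (shiftc c (scalec r2^-1 p) (toV u)))%E.
Proof.
move=> p0; rewrite /meanPhi -gauss_semigroup; last 2 first.
- by apply/measurable_EFinP; exact: measurable_Phi_shift.
- by move=> v; rewrite lee_fin Phi_shift_ge0.
apply: eq_integral => u _; apply: eq_integral => v _.
rewrite (shiftc_i0 _ _ (scalec_i0 _ p0)); congr ((Phi _ - _)%:E).
apply/funext => i; rewrite /shiftc /scalec toV_phs dotpZr dotpDr mulrDr.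
by rewrite !dotpZl addrA.
Qed.

Lemma meanPhi_commute p q c : p i0 = 0 -> q i0 = 0 ->
  (\int[pg R n]_u meanPhi q (shiftc c p (toV u)) =
   \int[pg R n]_u meanPhi p (shiftc c q (toV u)))%E.
Proof.
move=> p0 q0.
under eq_integral do rewrite meanPhi_shift//.
under [RHS]eq_integral do rewrite meanPhi_shift//.
rewrite (@fubini_tonelli _ _ _ _ _ (pg R n) (pg R n) (fun w : pT R n * pT R n =>
  (Phi (shiftc (shiftc c p (toV w.1)) q (toV w.2)) - c i0)%:E)
  (measurable_Phi_shift2 c p q)).
  by apply: eq_integral => v _; apply: eq_integral => u _; rewrite shiftcAC.
by move=> w; rewrite lee_fin -(shiftc_i0 c (toV w.1) p0) Phi_shift_ge0.
Qed.

(** The two halves are replaced one at a time: with one half of [p] absorbed in the shift, compare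
    the other; exchange the roles of the halves; compare again. Each comparison costs [K], and each
    uses the hypothesis at a random shift. *)
Lemma meanPhi_double p q (K : R) : p i0 = 0 -> q i0 = 0 -> 0 <= K ->
  (forall c, meanPhi (scalec r2^-1 p) c <= meanPhi (scalec r2^-1 q) c + K%:E)%E ->
  forall c, (meanPhi p c <= meanPhi q c + (2 * K)%:E)%E.
Proof.
move=> p0 q0 K0 H c.
have sp0 : scalec r2^-1 p i0 = 0 by rewrite scalec_i0.
have sq0 : scalec r2^-1 q i0 = 0 by rewrite scalec_i0.
have step w : w i0 = 0 ->
    (\int[pg R n]_u meanPhi (scalec r2^-1 p) (shiftc c w (toV u)) <=
     \int[pg R n]_u meanPhi (scalec r2^-1 q) (shiftc c w (toV u)) + K%:E)%E.
  move=> w0; rewrite -[X in (_ + X)%E](integral_cst_probability (pg R n) K).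
  rewrite -ge0_integralD; [|by []|by move=> u _; exact: meanPhi_ge0
    |exact: measurable_meanPhi|by move=> u _; rewrite lee_fin|by []].
  apply: ge0_le_integral; [by []|by move=> u _; exact: meanPhi_ge0
    |exact: measurable_meanPhi| |by move=> u _; exact: H].
  by apply: emeasurable_funD => //; exact: measurable_meanPhi.
rewrite (meanPhi_semigroup c p0) (meanPhi_semigroup c q0).
exact: (lee_double (step _ sp0) (meanPhi_commute c sp0 sq0) (step _ sq0)).
Qed.

End Functional.

Lemma measurable_lse d (T : measurableType d) (g : 'I_N -> T -> R) :
  (forall i, measurable_fun setT (g i)) -> measurable_fun setT (fun t => lse (fun i => g i t)).
Proof.
move=> mg; apply: (measurableT_comp (@measurable_ln R)).
apply: measurable_sum => i; exact: (measurableT_comp (@measurable_expR R) (mg i)).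
Qed.

Lemma measurable_maxc d (T : measurableType d) (g : 'I_N -> T -> R) :
  (forall i, measurable_fun setT (g i)) ->
  measurable_fun setT (fun t => maxc i0 (fun i => g i t)).
Proof.
move=> mg; rewrite /maxc; elim: (index_enum _) => [|i s IHs].
  by under eq_fun do rewrite big_nil; exact: mg.
under eq_fun do rewrite big_cons.
exact: measurable_maxr.
Qed.

Lemma lse_ge (c : 'I_N -> R) i : c i <= lse c.
Proof. exact: le_trans (maxc_ge i0 c i) (maxc_le_lse i0 c). Qed.

Lemma maxc_le_sum (c : 'I_N -> R) : maxc i0 c <= 0 + \sum_i `|c i|.
Proof.
rewrite add0r; apply: maxc_le => i; apply: le_trans (ler_norm _) _.
by rewrite (bigD1 i)//= lerDl sumr_ge0.
Qed.

Lemma lse_le_sum (c : 'I_N -> R) : lse c <= ln N%:R + \sum_i `|c i|.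
Proof.
apply: le_trans (lse_le_maxc i0 c) _; rewrite addrC lerD2l.
by have := maxc_le_sum c; rewrite add0r.
Qed.

Definition mean_lse := meanPhi (@lse R N).
Definition mean_max := meanPhi (maxc i0).

Definition expansion p q := forall i j, enorm (p i - p j) <= enorm (q i - q j).

Lemma expansion_scale a p q : expansion p q -> expansion (scalec a p) (scalec a q).
Proof.
move=> pq i j; have := pq i j; rewrite !ler_enorm -!scalerBr !dotpZl !dotpZr !mulrA.
by move=> h; rewrite ler_wpM2l// -expr2 sqr_ge0.
Qed.

Lemma le_by_bounds (a b x v w e f : R) :
  a <= x + 0 + 4^-1 * v + e -> x + 0 + 4^-1 * w - f <= b -> v <= w -> a <= b + (e + f).
Proof. lra. Qed.

Lemma taylor_upper (l x c m v e : R) : `|l - x - m - v| <= e -> l - c <= x - c + m + v + e.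
Proof. by rewrite ler_norml => /andP[_]; lra. Qed.

Lemma taylor_lower (l x c m v e : R) : `|l - x - m - v| <= e -> x - c + m + v - e <= l - c.
Proof. by rewrite ler_norml => /andP[+ _]; lra. Qed.

(** In the Gaussian average the linear Taylor term vanishes and the quadratic one is a combination
    of squared distances with nonnegative softmax weights, hence ordered by the expansion. Only the
    cubic remainders are left, bounded independently of [c]. *)
Lemma mean_lse_small p q : expansion p q -> exists C, 0 <= C /\
  forall e c, 0 <= e ->
    (mean_lse (scalec e p) c <= mean_lse (scalec e q) c + (C * e ^+ 3)%:E)%E.
Proof.
move=> pq; have [C0 [C00 HC]] := lse_taylor R.
pose M (p : 'I_N -> 'rV[R]_n) i := fine (\int[pg R n]_v (`|dotp (p i) (toV v)| ^+ 3)%:E)%E.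
have HM (p' : 'I_N -> 'rV[R]_n) i : has_mean (fun x => `|dotp (p' i) x| ^+ 3) (M p' i).
  by apply: has_mean_integrable; exact: pg_integrable_norm3.
have M0 p' i : 0 <= M p' i.
  by rewrite /M fine_ge0// integral_ge0// => v _; rewrite lee_fin exprn_ge0.
pose S p' := \sum_i M p' i.
have S0 p' : 0 <= S p' by apply: sumr_ge0.
exists (C0 * (S p + S q)); split; first by rewrite mulr_ge0// addr_ge0.
move=> e c e0.
pose s := softmax c.
pose V (p' : 'I_N -> 'rV[R]_n) := \sum_i \sum_j s i * s j * dotp (p' i - p' j) (p' i - p' j).
have mean1 p' : has_mean (fun x => \sum_i s i * dotp (scalec e p' i) x) 0.
  have := has_mean_sum (fun i => has_meanZ (s i) (has_mean_dotp (scalec e p' i))).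
  by rewrite [X in has_mean _ X]big1// => i _; rewrite mulr0.
have mean2 p' : has_mean (fun x => 4^-1 * \sum_i \sum_j s i * s j *
    (dotp (scalec e p' i) x - dotp (scalec e p' j) x) ^+ 2) (4^-1 * (gauss_var R * e ^+ 2 * V p')).
  apply: has_meanZ; rewrite /V mulr_sumr; apply: has_mean_sum => i.
  rewrite mulr_sumr; apply: has_mean_sum => j.
  set d := dotp (p' i - p' j) (p' i - p' j).
  have -> : gauss_var R * e ^+ 2 * (s i * s j * d) = s i * s j * (gauss_var R * (e * (e * d))).
    by ring.
  apply: has_meanZ; have := has_mean_dotp2 (e *: (p' i - p' j)); rewrite dotpZl dotpZr.
  by under eq_fun do rewrite scalerBr dotpBl.
have mean3 p' : has_mean (fun x => \sum_i `|dotp (scalec e p' i) x| ^+ 3) (e ^+ 3 * S p').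
  rewrite /S mulr_sumr; apply: has_mean_sum => i.
  under eq_fun do rewrite /scalec dotpZl normrM (ger0_norm e0) exprMn.
  by apply: has_meanZ; exact: HM.
have cst := has_mean_cst n (lse c - c i0).
have main p' := has_meanD (has_meanD cst (mean1 p')) (mean2 p').
have hp := has_mean_Phi measurable_lse lse_ge lse_le_sum (scalec e p) c.
have hq := has_mean_Phi measurable_lse lse_ge lse_le_sum (scalec e q) c.
rewrite /mean_lse (meanPhiE measurable_lse lse_ge lse_le_sum).
rewrite [X in (_ <= X + _)%E](meanPhiE measurable_lse lse_ge lse_le_sum) -EFinD lee_fin.
have up := has_mean_le hp (has_meanD (main p) (has_meanZ C0 (mean3 p))).
have lo := has_mean_le (has_meanB (main q) (has_meanZ C0 (mean3 q))) hq.
have taylor p' x := HC N i0 c (fun i => dotp (scalec e p' i) x).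
have up' : fine (meanPhi (@lse R N) (scalec e p) c) <=
    lse c - c i0 + 0 + 4^-1 * (gauss_var R * e ^+ 2 * V p) + C0 * (e ^+ 3 * S p).
  by apply: up => x; apply: taylor_upper; exact: taylor.
have lo' : lse c - c i0 + 0 + 4^-1 * (gauss_var R * e ^+ 2 * V q) - C0 * (e ^+ 3 * S q) <=
    fine (meanPhi (@lse R N) (scalec e q) c).
  by apply: lo => x; apply: taylor_lower; exact: taylor.
have VV : V p <= V q.
  apply: ler_sum => i _; apply: ler_sum => j _; apply: ler_wpM2l.
    by rewrite mulr_ge0// softmax_ge0.
  by have := pq i j; rewrite ler_enorm.
have GV : gauss_var R * e ^+ 2 * V p <= gauss_var R * e ^+ 2 * V q.
  by rewrite ler_wpM2l// mulr_ge0 ?gauss_var_ge0 ?sqr_ge0.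
have -> : C0 * (S p + S q) * e ^+ 3 = C0 * (e ^+ 3 * S p) + C0 * (e ^+ 3 * S q) by ring.
exact: le_by_bounds up' lo' GV.
Qed.

Lemma mean_lse_halving p q : p i0 = 0 -> q i0 = 0 -> expansion p q ->
  exists C, forall k c, (mean_lse p c <= mean_lse q c + (C * r2^-1 ^+ k)%:E)%E.
Proof.
move=> p0 q0 pq; have [C [C0 HC]] := mean_lse_small pq; exists C => k c.
have r0 : 0 < r2^-1 by rewrite invr_gt0 sqrt2_gt0.
(* The scale [e] is generalised because each doubling calls the induction hypothesis at
   [e / sqrt 2]. *)
have main : forall e c, 0 <= e -> (mean_lse (scalec e p) c <=
    mean_lse (scalec e q) c + (2 ^+ k * (C * (e * r2^-1 ^+ k) ^+ 3))%:E)%E.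
  elim: k {c} => [|k IHk] e c e0.
    by rewrite !expr0 mul1r mulr1; exact: HC.
  rewrite [2 ^+ k.+1]exprS -[2 * 2 ^+ k * _]mulrA.
  apply: (meanPhi_double measurable_lse lse_ge);
    rewrite ?scalec_i0//.
    by rewrite mulr_ge0 ?exprn_ge0// mulr_ge0// exprn_ge0// mulr_ge0// exprn_ge0// ltW.
  move=> c'; rewrite !scalecA.
  have -> : e * r2^-1 ^+ k.+1 = r2^-1 * e * r2^-1 ^+ k by rewrite exprS; ring.
  by apply: IHk; rewrite mulr_ge0// ltW.
have := main 1 c ler01; rewrite !scalec1 mul1r.
suff -> : 2 ^+ k * (C * (r2^-1 ^+ k) ^+ 3) = C * r2^-1 ^+ k by [].
have -> : 2 ^+ k * (C * (r2^-1 ^+ k) ^+ 3) = C * r2^-1 ^+ k * ((2 * r2^-1 ^+ 2) ^+ k).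
  rewrite exprMn; have -> : (r2^-1 ^+ 2) ^+ k = (r2^-1 ^+ k) ^+ 2 by rewrite -!exprM mulnC.
  ring.
have -> : 2 * r2^-1 ^+ 2 = 1 by rewrite exprVn sqrt2_sqr divff// pnatr_eq0.
by rewrite expr1n mulr1.
Qed.

End Comparison.

Section SudakovFernique.
Variables (R : realType) (n : nat).
Local Notation r2 := (Num.sqrt (2 : R)).

Lemma le_of_geometric (x y C : R) : (forall k, x <= y + C * r2^-1 ^+ k) -> x <= y.
Proof.
move=> H; rewrite leNgt; apply/negP => yx.
pose m := Num.bound (`|C| / (x - y)).
have mb : `|C| / (x - y) < m%:R.
  by apply: archi_boundP; rewrite divr_ge0// subr_ge0 ltW.
have := H (2 * m)%N; rewrite exprM exprVn sqrt2_sqr => h.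
have m2 : m%:R < 2 ^+ m :> R by rewrite -natrX ltr_nat ltn_expl.
have p2 : 0 < 2 ^+ m :> R by rewrite exprn_gt0.
have : C < (x - y) * 2 ^+ m.
  apply: le_lt_trans (ler_norm _) _; rewrite -ltr_pdivrMl ?subr_gt0// mulrC.
  exact: lt_trans mb m2.
rewrite -ltr_pdivrMr// -exprVn; lra.
Qed.

Lemma squeeze_eq (a b pp qp pq qq : \bar R) : a = pp -> b = qq -> a = b -> qp = pq ->
  (pp <= qp -> pq <= qq -> pp = qp /\ pq = qq)%E.
Proof.
move=> <- <- <- -> h1 h2; suff -> : pq = a by [].
by apply/eqP; rewrite eq_le h1 h2.
Qed.

Lemma addeI_eq0 (a b d : \bar R) : (a \is a fin_num -> b = a + d -> a = b -> d = 0)%E.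
Proof.
move=> + ->; case: a => // r _; case: d => [s| |]//= [] /eqP.
by rewrite eq_sym addrC -subr_eq0 addrK => /eqP ->.
Qed.

Section Fixed.
Variables (N : nat) (i0 : 'I_N).
Implicit Types (p q : 'I_N -> 'rV[R]_n) (c : 'I_N -> R).

Definition rmax p c : R := fine (mean_max i0 p c).

Lemma has_mean_rmax p c : has_mean (fun x => maxc i0 (shiftc c p x) - c i0) (rmax p c).
Proof.
exact: (has_mean_Phi i0 (@measurable_maxc R N i0) (@maxc_ge R N i0) (@maxc_le_sum R N i0)).
Qed.

Lemma rmaxE p c : mean_max i0 p c = (rmax p c)%:E.
Proof.
exact: (meanPhiE i0 (@measurable_maxc R N i0) (@maxc_ge R N i0) (@maxc_le_sum R N i0)).
Qed.

Lemma maxcZ (L : R) c : 0 <= L -> maxc i0 (fun i => L * c i) = L * maxc i0 c.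
Proof.
move=> L0; apply/eqP; rewrite eq_le; apply/andP; split.
  by apply: maxc_le => i; rewrite ler_wpM2l// maxc_ge.
by have [k ->] := maxc_attained i0 c; exact: (maxc_ge i0 (fun i => L * c i)).
Qed.

(** Scaling configuration and shift by [L] multiplies a violation by [L], whereas passing between
    [max] and [lse] costs at most [ln N]. *)
Lemma rmax_le p q c : p i0 = 0 -> q i0 = 0 -> expansion p q -> rmax p c <= rmax q c.
Proof.
move=> p0 q0 pq; rewrite leNgt; apply/negP => qp.
(* Chosen so that the scaled violation equals [|ln N| + 1]. *)
pose L := (`|ln (N%:R : R)| + 1) / (rmax p c - rmax q c).
have L0 : 0 < L by rewrite divr_gt0 ?subr_gt0// ltr_pwDr.
have lse_mean p' c' := has_mean_Phi i0 (@measurable_lse R N) (@lse_ge R N i0)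
  (@lse_le_sum R N i0) p' c'.
pose Lc := fun i => L * c i.
have scal p' x : maxc i0 (shiftc Lc (scalec L p') x) = L * maxc i0 (shiftc c p' x).
  rewrite -maxcZ ?(ltW L0)//; congr maxc; apply/funext => i.
  by rewrite /shiftc /scalec dotpZl mulrDr.
have h1 : L * rmax p c <= fine (mean_lse i0 (scalec L p) Lc).
  apply: (has_mean_le (has_meanZ L (has_mean_rmax p c)) (lse_mean _ _)) => x.
  by rewrite mulrBr -scal lerD2r maxc_le_lse.
have h2 : fine (mean_lse i0 (scalec L p) Lc) <= fine (mean_lse i0 (scalec L q) Lc).
  have [C HC] := @mean_lse_halving R n N i0 (scalec L p) (scalec L q)
    (scalec_i0 L p0) (scalec_i0 L q0) (expansion_scale L pq).
  apply: (@le_of_geometric _ _ C) => k; have := HC k Lc.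
  rewrite /mean_lse (meanPhiE i0 (@measurable_lse R N) (@lse_ge R N i0) (@lse_le_sum R N i0)).
  rewrite [X in (_ <= X + _)%E](meanPhiE i0 (@measurable_lse R N) (@lse_ge R N i0)
    (@lse_le_sum R N i0)).
  by rewrite -EFinD lee_fin.
have h3 : fine (mean_lse i0 (scalec L q) Lc) <= L * rmax q c + ln N%:R.
  apply: (has_mean_le (lse_mean _ _)
    (has_meanD (has_meanZ L (has_mean_rmax q c)) (has_mean_cst n (ln N%:R)))) => x.
  have := lse_le_maxc i0 (shiftc Lc (scalec L q) x); rewrite scal /Lc mulrBr.
  by rewrite addrAC lerD2r.
have e : L * (rmax p c - rmax q c) = `|ln (N%:R : R)| + 1.
  by rewrite /L divfK// gt_eqF// subr_gt0.
have := le_trans (le_trans h1 h2) h3.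
rewrite -lerBlDl -mulrBr e => h4.
by have := le_trans h4 (ler_norm _); rewrite gerDl ler10.
Qed.

Lemma le_by_two_norms (a b c d e : R) :
  `|a - b| <= e -> `|c - d| <= e -> a - c <= b - d + 2 * e.
Proof. by rewrite !ler_norml => /andP[_ h] /andP[h' _]; lra. Qed.

Lemma dist_sub_le (a b c d e : R) :
  `|a - b| <= e -> `|c - d| <= e -> `|(a - c) - (b - d)| <= 2 * e.
Proof.
by rewrite !ler_norml => /andP[h1 h2] /andP[h3 h4]; apply/andP; split; lra.
Qed.

Lemma rmax_lipschitz p c d : `|rmax p c - rmax p d| <= 2 * \sum_i `|c i - d i|.
Proof.
have H c' d' : rmax p c' <= rmax p d' + 2 * \sum_i `|c' i - d' i|.
  apply: (has_mean_le (has_mean_rmax p c')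
    (has_meanD (has_mean_rmax p d') (has_mean_cst n _))) => x.
  have := maxc_lipschitz i0 (shiftc c' p x) (shiftc d' p x).
  rewrite (eq_bigr (fun i => `|c' i - d' i|)) => [|i _]; last first.
    by rewrite /shiftc opprD addrACA subrr addr0.
  have : `|c' i0 - d' i0| <= \sum_i `|c' i - d' i| by rewrite (bigD1 i0)//= lerDl sumr_ge0.
  by move=> h1 h2; exact: le_by_two_norms h2 h1.
have H2 := H d c.
rewrite (eq_bigr (fun i => `|c i - d i|)) in H2 => [|i _]; last exact: distrC.
by rewrite ler_norml lerBlDl (H c d) andbT lerNl opprB lerBlDl.
Qed.

Lemma norm_dotp_le (w x : 'rV[R]_n) :
  `|dotp w x| <= (\sum_j `|w 0 j|) * \sum_j `|x 0 j|.
Proof.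
apply: le_trans (ler_norm_sum _ _ _) _; rewrite mulr_suml; apply: ler_sum => j _.
by rewrite normrM ler_wpM2l// (bigD1 j)//= lerDl sumr_ge0.
Qed.

Lemma shiftc_lipschitz c (w : 'I_N -> 'rV[R]_n) x y :
  \sum_i `|shiftc c w x i - shiftc c w y i| <=
  (\sum_i \sum_j `|w i 0 j|) * \sum_j `|x 0 j - y 0 j|.
Proof.
rewrite mulr_suml; apply: ler_sum => i _.
have -> : shiftc c w x i - shiftc c w y i = dotp (w i) (x - y).
  by rewrite /shiftc dotpBr; ring.
apply: le_trans (norm_dotp_le _ _) _.
by rewrite ler_wpM2l ?sumr_ge0//; apply: ler_sum => j _; rewrite !mxE.
Qed.

Lemma affine_growth_le (a m t : R) : 0 <= a -> 1 <= m -> 0 <= t ->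
  a + 2 * (m + t) <= (a + 2 * m) * (1 + t).
Proof.
move=> a0 m1 t0; have h1 : 0 <= a * t by rewrite mulr_ge0.
have h2 : 0 <= (m - 1) * t by rewrite mulr_ge0// subr_ge0.
by nra.
Qed.

(** In the two-step replacement of [meanPhi_double], now with zero error, equality of the ends
    forces equality in both steps. Each step integrates a nonnegative Lipschitz difference against
    the Gaussian measure, so that difference vanishes at every shift: along [p] in the first step,
    along [q] in the second. *)
Lemma rmax_eq_shift p q c (w : 'I_N -> 'rV[R]_n) : p i0 = 0 -> q i0 = 0 -> w i0 = 0 -> expansion p q ->
  w = p \/ w = q -> rmax p c = rmax q c -> forall x,
  rmax (scalec r2^-1 p) (shiftc c (scalec r2^-1 w) x) =
  rmax (scalec r2^-1 q) (shiftc c (scalec r2^-1 w) x).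
Proof.
move=> p0 q0 w0 pq wpq eq x; set a := r2^-1.
pose P := scalec a p; pose Q := scalec a q; pose W := scalec a w.
have P0 : P i0 = 0 by exact: scalec_i0.
have Q0 : Q i0 = 0 by exact: scalec_i0.
have W0 : W i0 = 0 by exact: scalec_i0.
have PQ : expansion P Q by exact: expansion_scale.
have mP (v : 'I_N -> 'rV[R]_n) : v i0 = 0 -> measurable_fun setT (fun u : pT R n => mean_max i0 P (shiftc c v (toV u))).
  by move=> v0; exact: (measurable_meanPhi (@measurable_maxc R N i0) (@maxc_ge R N i0)).
have mQ (v : 'I_N -> 'rV[R]_n) : v i0 = 0 -> measurable_fun setT (fun u : pT R n => mean_max i0 Q (shiftc c v (toV u))).
  by move=> v0; exact: (measurable_meanPhi (@measurable_maxc R N i0) (@maxc_ge R N i0)).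
have ge0 (v : 'I_N -> 'rV[R]_n) (d : 'I_N -> R) : v i0 = 0 -> (0 <= mean_max i0 v d)%E.
  by move=> v0; exact: (meanPhi_ge0 (@maxc_ge R N i0)).
have step (v : 'I_N -> 'rV[R]_n) : v i0 = 0 -> (\int[pg R n]_u mean_max i0 P (shiftc c v (toV u)) <=
    \int[pg R n]_u mean_max i0 Q (shiftc c v (toV u)))%E.
  move=> v0; apply: ge0_le_integral; [by []|by move=> u _; exact: ge0|exact: mP|exact: mQ|].
  by move=> u _; rewrite !rmaxE lee_fin rmax_le.
have X0 := meanPhi_semigroup (@measurable_maxc R N i0) (@maxc_ge R N i0) c p0.
have X2 := meanPhi_semigroup (@measurable_maxc R N i0) (@maxc_ge R N i0) c q0.
have X1 := meanPhi_commute (@measurable_maxc R N i0) (@maxc_ge R N i0) c P0 Q0.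
rewrite -/(mean_max i0 p c) -/a -/P in X0; rewrite -/(mean_max i0 q c) -/a -/Q in X2.
have e02 : mean_max i0 p c = mean_max i0 q c by rewrite !rmaxE eq.
have E : (\int[pg R n]_u mean_max i0 P (shiftc c W (toV u)) =
    \int[pg R n]_u mean_max i0 Q (shiftc c W (toV u)))%E.
  have [E1 E2] := squeeze_eq X0 X2 e02 X1 (step P P0) (step Q Q0).
  by case: wpq => wE; rewrite /W wE; [exact: E1|exact: E2].
pose D (y : 'rV[R]_n) := rmax Q (shiftc c W y) - rmax P (shiftc c W y).
have D0 y : 0 <= D y by rewrite subr_ge0 rmax_le.
have mr (v : 'I_N -> 'rV[R]_n) : (fun u : pT R n => mean_max i0 v (shiftc c W (toV u))) =
    (fun u => (rmax v (shiftc c W (toV u)))%:E) by apply/funext => u; exact: rmaxE.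
have mPr : measurable_fun setT (fun u : pT R n => rmax P (shiftc c W (toV u))).
  by apply/measurable_EFinP; have := mP W W0; rewrite mr.
have mQr : measurable_fun setT (fun u : pT R n => rmax Q (shiftc c W (toV u))).
  by apply/measurable_EFinP; have := mQ W W0; rewrite mr.
have mD : measurable_fun setT (fun u : pT R n => D (toV u)) by exact: measurable_funB.
have P0r (v : 'I_N -> 'rV[R]_n) : v i0 = 0 -> forall u : pT R n, 0 <= rmax v (shiftc c W (toV u)).
  by move=> v0 u; rewrite -lee_fin -rmaxE ge0.
(* Finiteness allows the common integral to be cancelled, which leaves integral zero for the
   difference [D]. *)
have fin : (\int[pg R n]_u (rmax P (shiftc c W (toV u)))%:E \is a fin_num)%E.
  have KW : forall u : pT R n, `|rmax P (shiftc c W (toV u))| <=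
      (`|rmax P c| + 2 * N%:R) * (1 + \sum_i `|dotp (W i) (toV u)| ^+ 3).
    move=> u; set T := \sum_i _.
    have T0 : 0 <= T by apply: sumr_ge0 => i _; rewrite exprn_ge0.
    have hT : \sum_i `|shiftc c W (toV u) i - c i| <= N%:R + T.
      have -> : N%:R = \sum_(i < N) (1 : R) by rewrite sumr_const card_ord.
      rewrite -big_split; apply: ler_sum => i _ /=.
      by rewrite /shiftc addrAC subrr add0r norm_le_1norm3.
    have N1 : 1 <= (N%:R : R) by rewrite ler1n; case: (N) i0 => [[]|].
    have lip := rmax_lipschitz P (shiftc c W (toV u)) c.
    have tri : `|rmax P (shiftc c W (toV u))| <= `|rmax P c| + 2 * (N%:R + T).
      rewrite -[X in `|X|](subrK (rmax P c)) addrC.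
      apply: le_trans (ler_normD _ _) _; rewrite lerD2l; apply: le_trans lip _.
      by rewrite ler_wpM2l.
    exact: le_trans tri (affine_growth_le (normr_ge0 _) N1 T0).
  exact: (integrable_fin_num measurableT (pg_integrable_bound mPr KW)).
have ID : (\int[pg R n]_u (D (toV u))%:E = 0)%E.
  have sum : (\int[pg R n]_u (rmax Q (shiftc c W (toV u)))%:E =
      \int[pg R n]_u (rmax P (shiftc c W (toV u)))%:E + \int[pg R n]_u (D (toV u))%:E)%E.
    rewrite -ge0_integralD; [|by []|by move=> u _; rewrite lee_fin P0r|exact/measurable_EFinP
      |by move=> u _; rewrite lee_fin|exact/measurable_EFinP].
    by apply: eq_integral => u _; rewrite -EFinD /D addrC subrK.
  by rewrite !mr in E; exact: (addeI_eq0 fin sum E).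
pose K := 2 * \sum_i \sum_j `|W i 0 j|.
have DK (y y' : 'rV[R]_n) : `|D y - D y'| <= (2 * K) * \sum_j `|y 0 j - y' 0 j|.
  have l1 := rmax_lipschitz P (shiftc c W y) (shiftc c W y').
  have l2 := rmax_lipschitz Q (shiftc c W y) (shiftc c W y').
  have b : 2 * \sum_i `|shiftc c W y i - shiftc c W y' i| <= K * \sum_j `|y 0 j - y' 0 j|.
    by rewrite /K -mulrA; apply: ler_wpM2l (shiftc_lipschitz c W y y').
  rewrite -mulrA; exact: dist_sub_le (le_trans l2 b) (le_trans l1 b).
by have /subr0_eq := pg_integral_eq0 mD D0 DK ID x.
Qed.

End Fixed.

(** A fixed positive multiple of the norm of [d]. Instead of evaluating it, the order is obtained by
    applying the comparison to the two-point configurations [0, d]. *)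
Definition ppart (d : 'rV[R]_n) : R :=
  fine (\int[pg R n]_v (Num.max 0 (dotp d (toV v)))%:E)%E.

Definition pair0 (d : 'rV[R]_n) : 'I_2 -> 'rV[R]_n := fun i => if i == ord0 then 0 else d.

Lemma maxc_pair0 d x : maxc ord0 (shiftc (fun=> 0) (pair0 d) x) - 0 = Num.max 0 (dotp d x).
Proof.
rewrite subr0; apply/eqP; rewrite eq_le; apply/andP; split.
  apply: maxc_le => i; rewrite /shiftc /pair0 add0r; case: ifP => _.
    by rewrite dotp0l le_max lexx.
  by rewrite le_max lexx orbT.
rewrite ge_max; apply/andP; split.
  have := maxc_ge ord0 (shiftc (fun=> 0) (pair0 d) x) ord0.
  by rewrite [X in X <= _]/shiftc /pair0 eqxx dotp0l addr0.
have := maxc_ge ord0 (shiftc (fun=> 0) (pair0 d) x) (lift ord0 ord0).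
by rewrite [X in X <= _]/shiftc /pair0 /= add0r.
Qed.

Lemma ppart_rmax d : ppart d = rmax ord0 (pair0 d) (fun=> 0).
Proof.
rewrite /ppart /rmax /mean_max /meanPhi; congr fine.
by apply: eq_integral => v _; rewrite maxc_pair0.
Qed.

Lemma has_mean_ppart d : has_mean (fun x => Num.max 0 (dotp d x)) (ppart d).
Proof.
rewrite ppart_rmax; have := has_mean_rmax ord0 (pair0 d) (fun=> 0).
by under eq_fun do rewrite maxc_pair0.
Qed.

Lemma enormN (x : 'rV[R]_n) : enorm (- x) = enorm x.
Proof. by rewrite /enorm dotpNl dotpNr opprK. Qed.

Lemma ppart_le d d' : enorm d <= enorm d' -> ppart d <= ppart d'.
Proof.
move=> dd; rewrite !ppart_rmax; apply: rmax_le => // i j; rewrite /pair0.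
case: ifP => _; case: ifP => _; rewrite ?subrr// ?sub0r ?subr0//.
by rewrite !enormN.
Qed.

Lemma ppartZ (l : R) d : 0 <= l -> ppart (l *: d) = l * ppart d.
Proof.
move=> l0; apply: (has_mean_uniq (has_mean_ppart _)).
have := has_meanZ l (has_mean_ppart d).
by under eq_fun do rewrite maxr_pMr// mulr0 -dotpZl.
Qed.

Lemma max0_lipschitz (s t : R) : `|Num.max 0 s - Num.max 0 t| <= `|s - t|.
Proof.
have := ler_norm (s - t); have := ler_norm (t - s); rewrite (distrC t s) => h1 h2.
by rewrite ler_norml; case: (leP 0 s) => h3; case: (leP 0 t) => h4; apply/andP; split; lra.
Qed.

Lemma ppart_gt0 d : d != 0 -> 0 < ppart d.
Proof.
move=> d0; have h := has_mean_ppart d.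
have g0 : 0 <= ppart d.
  by apply: (has_mean_le (has_mean_cst n 0) h) => x; rewrite le_max lexx.
rewrite lt0r g0 andbT; apply/eqP => e.
pose D x := Num.max 0 (dotp d x).
have D0 x : 0 <= D x by rewrite le_max lexx.
have mD : measurable_fun setT (fun u : pT R n => D (toV u)).
  by apply: measurable_maxr => //; exact: measurable_dotp.
have DK (x y : 'rV[R]_n) : `|D x - D y| <= (\sum_j `|d 0 j|) * \sum_j `|x 0 j - y 0 j|.
  apply: (@le_trans _ _ `|dotp d (x - y)|); last first.
    apply: le_trans (norm_dotp_le _ _) _.
    by rewrite ler_wpM2l ?sumr_ge0//; apply: ler_sum => j _; rewrite !mxE.
  by rewrite dotpBr /D; exact: max0_lipschitz.
have [_] := h; rewrite e => I0.
have := pg_integral_eq0 mD D0 DK I0 d; rewrite /D => m0.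
have : dotp d d <= 0 by rewrite -m0 le_max lexx orbT.
by rewrite leNgt dotp_gt0 d0.
Qed.

(** Strictness comes from homogeneity: stretching [d] to the length of [d'] multiplies its positive
    value by a factor larger than 1, and the weak comparison handles equal lengths. *)
Lemma ppart_lt d d' : enorm d < enorm d' -> ppart d < ppart d'.
Proof.
move=> dd; have [d0|d0] := eqVneq d 0.
  have -> : ppart d = 0.
    by rewrite d0 -(scale0r d) ppartZ// mul0r.
  apply: ppart_gt0; apply/eqP => d'0.
  by move: dd; rewrite d0 d'0 ltxx.
have nd0 : 0 < enorm d by rewrite lt0r enorm_eq0 d0 enorm_ge0.
pose l := enorm d' / enorm d.
have l1 : 1 < l by rewrite ltr_pdivlMr// mul1r.
have l0 : 0 <= l by lra.
have : ppart (l *: d) <= ppart d'.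
  apply: ppart_le; rewrite ler_enorm dotpZl dotpZr -!sqr_enorm.
  have -> : l * (l * enorm d ^+ 2) = (l * enorm d) ^+ 2 by ring.
  by rewrite /l divfK// gt_eqF.
rewrite ppartZ//; apply: lt_le_trans.
by rewrite -[ltLHS]mul1r ltr_pM2r// ppart_gt0.
Qed.

End SudakovFernique.

(** * Equality case *)

Section Rigidity.
Variables (R : realType) (n N : nat) (i0 : 'I_N).
Implicit Types (p q : 'I_N -> 'rV[R]_n) (c h : 'I_N -> R).
Local Notation r2 := (Num.sqrt (2 : R)).

(** The first application opens shifts along [p], the second, on the already scaled configurations,
    shifts along [q]. Each costs a factor [1 / sqrt 2]; rescaling [x] and [y] removes these factors
    from the shift. *)
Lemma rmax_eq_shift2 p q : p i0 = 0 -> q i0 = 0 -> expansion p q ->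
  rmax i0 p (fun=> 0) = rmax i0 q (fun=> 0) -> forall x y,
  let c i := dotp x (p i) + dotp y (q i) in
  rmax i0 (scalec (r2^-1 * r2^-1) p) c = rmax i0 (scalec (r2^-1 * r2^-1) q) c.
Proof.
move=> p0 q0 pq eq x y c; set a := r2^-1.
have a0 : a != 0 by rewrite invr_eq0 gt_eqF// sqrt2_gt0.
have E1 := rmax_eq_shift p0 q0 p0 pq (or_introl erefl) eq (a^-1 *: x).
have := rmax_eq_shift (scalec_i0 a p0) (scalec_i0 a q0) (scalec_i0 a q0)
  (expansion_scale a pq) (or_intror erefl) E1 ((a * a)^-1 *: y).
have -> : shiftc (shiftc (fun=> 0) (scalec r2^-1 p) (a^-1 *: x))
    (scalec r2^-1 (scalec a q)) ((a * a)^-1 *: y) = c.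
  apply/funext => i; rewrite /shiftc /scalec -/a add0r !dotpZl !dotpZr.
  by rewrite !mulrA invfM !mulrA mulfV// mul1r mulfK// divff// mul1r (dotpC (p i)) (dotpC (q i)).
by rewrite !scalecA.
Qed.

Lemma le_of_inverse (x y C : R) : (forall L, 0 < L -> x <= y + L^-1 * C) -> x <= y.
Proof.
move=> H; rewrite leNgt; apply/negP => yx.
have d0 : 0 < x - y by rewrite subr_gt0.
have C0 : 0 < `|C| + 1 by rewrite ltr_pwDr.
have := H ((`|C| + 1) / (x - y)) (divr_gt0 C0 d0).
rewrite invf_div -lerBlDl mulrAC ler_pdivlMr// ler_pM2l// => h.
by have := le_trans h (ler_norm C); rewrite gerDl ler10.
Qed.

Lemma le_add_sqr (t d : R) : 0 < d -> t <= d + t ^+ 2 / (4 * d).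
Proof.
move=> d0; rewrite -subr_ge0.
have -> : d + t ^+ 2 / (4 * d) - t = (t - 2 * d) ^+ 2 / (4 * d) by field; rewrite gt_eqF.
by rewrite divr_ge0 ?sqr_ge0// mulr_ge0// ltW.
Qed.

(* For large [L] the maximum is governed by the points with [h i = h k], which lie on a
   half-line; the others contribute a quadratic error of order [1 / L]. *)
Lemma ppart_edge_le p q h k m : q m - q k != 0 -> h m = h k ->
  (forall i, h i < h k \/ (h i = h k /\ exists s, [/\ 0 <= s,
     p i - p k = s *: (p m - p k) & q i - q k = s *: (q m - q k)])) ->
  (forall L, 0 < L -> rmax i0 p (fun i => L * h i) = rmax i0 q (fun i => L * h i)) ->
  ppart (q m - q k) <= ppart (p m - p k).
Proof.
move=> dq0 hmk hP eqL; set dp := p m - p k; set dq := q m - q k.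
have /boolp.choice[s sP] : forall i, exists t : R, h i < h k \/ (h i = h k /\
    [/\ 0 <= t, p i - p k = t *: dp & q i - q k = t *: dq]).
  move=> i; case: (hP i) => [hi|[hi [s sP]]]; first by exists 0; left.
  by exists s; right.
(* Among the points with [h i = h k], the one farthest along the half-line attains their maximum
   whenever the direction has positive product with [x]. *)
have [i1 /eqP hi1 i1max] := @arg_maxP _ _ _ k (fun i => h i == h k) s (eqxx _).
have on_face i : h i = h k -> [/\ 0 <= s i, p i - p k = s i *: dp & q i - q k = s i *: dq].
  by move=> hi; case: (sP i) => [|[]//]; rewrite hi ltxx.
have sm : s m = 1.
  have [_ _ /eqP] := on_face m hmk; rewrite -/dq -subr_eq0 -[X in X - _]scale1r -scalerBl.
  by rewrite scaler_eq0 (negbTE dq0) orbF subr_eq0 => /eqP.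
have S0 : 0 < s i1.
  by apply: (@lt_le_trans _ _ (s m)); [rewrite sm|apply: i1max; rewrite hmk].
have [_ _ q1] := on_face i1 hi1.
(* The coefficient that [le_add_sqr] produces at [d = L (h k - h i)], with [1 / L] factored out. *)
pose e i := if h i < h k then (4 * (h k - h i))^-1 else 0.
have e0 i : 0 <= e i.
  by rewrite /e; case: ifP => // hi; rewrite invr_ge0 mulr_ge0// subr_ge0 ltW.
have low L x : L * h k + dotp (q k) x + s i1 * Num.max 0 (dotp dq x) <=
    maxc i0 (shiftc (fun i => L * h i) q x).
  have [d0|d0] := leP 0 (dotp dq x).
    apply: le_trans (maxc_ge i0 _ i1); rewrite /shiftc hi1 -addrA lerD2l.
    by rewrite -dotpZl -q1 dotpBl addrC subrK.
  by rewrite mulr0 addr0; apply: le_trans (maxc_ge i0 _ k).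
have up L x : 0 < L -> maxc i0 (shiftc (fun i => L * h i) p x) <=
    L * h k + dotp (p k) x + s i1 * Num.max 0 (dotp dp x) +
    L^-1 * \sum_i e i * dotp (p i - p k) x ^+ 2.
  move=> L0; apply: maxc_le => i; rewrite /shiftc.
  have q0 j : 0 <= e j * dotp (p j - p k) x ^+ 2 by rewrite mulr_ge0 ?sqr_ge0.
  have M0 : 0 <= Num.max 0 (dotp dp x) by rewrite le_max lexx.
  have pix : dotp (p i) x = dotp (p k) x + dotp (p i - p k) x by rewrite dotpBl addrC subrK.
  case: (sP i) => [hi|[hi [si0 sip _]]].
    have d0 : 0 < L * (h k - h i) by rewrite mulr_gt0// subr_gt0.
    have t1 := le_add_sqr (dotp (p i - p k) x) d0.
    have t2 : dotp (p i - p k) x ^+ 2 / (4 * (L * (h k - h i))) <=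
        L^-1 * \sum_i e i * dotp (p i - p k) x ^+ 2.
      have -> : dotp (p i - p k) x ^+ 2 / (4 * (L * (h k - h i))) =
          L^-1 * (e i * dotp (p i - p k) x ^+ 2).
        by rewrite /e hi; field; rewrite !gt_eqF// subr_gt0.
      by rewrite ler_wpM2l ?invr_ge0 ?(ltW L0)// (bigD1 i)//= lerDl sumr_ge0.
    have t3 : 0 <= s i1 * Num.max 0 (dotp dp x) by rewrite mulr_ge0// ltW.
    have t4 := le_trans t1 (lerD (lexx _) t2).
    by rewrite mulrBr in t4; rewrite pix; lra.
  have t2 : 0 <= L^-1 * \sum_i e i * dotp (p i - p k) x ^+ 2.
    by rewrite mulr_ge0 ?invr_ge0 ?(ltW L0)// sumr_ge0.
  have t1 : dotp (p i - p k) x <= s i1 * Num.max 0 (dotp dp x).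
    rewrite sip dotpZl; apply: (@le_trans _ _ (s i * Num.max 0 (dotp dp x))).
      by rewrite ler_wpM2l// le_max lexx orbT.
    by rewrite ler_wpM2r//; apply: i1max; rewrite hi.
  by rewrite pix hi; lra.
pose C := \sum_i e i * (gauss_var R * dotp (p i - p k) (p i - p k)).
have mid (d w : 'rV[R]_n) r : has_mean (fun x => r + dotp w x + s i1 * Num.max 0 (dotp d x))
    (r + 0 + s i1 * ppart d).
  apply: has_meanD; last by apply: has_meanZ; exact: has_mean_ppart.
  by apply: has_meanD; [exact: has_mean_cst|exact: has_mean_dotp].
have err L : has_mean (fun x => L^-1 * \sum_i e i * dotp (p i - p k) x ^+ 2) (L^-1 * C).
  by apply: has_meanZ; apply: has_mean_sum => i; apply: has_meanZ; exact: has_mean_dotp2.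
suff : s i1 * ppart dq <= s i1 * ppart dp by rewrite ler_pM2l.
apply: (@le_of_inverse _ _ C) => L L0.
have h1 : L * h k + 0 + s i1 * ppart dq - L * h i0 <= rmax i0 q (fun i => L * h i).
  apply: (has_mean_le (has_meanB (mid dq (q k) (L * h k)) (has_mean_cst n (L * h i0)))
    (has_mean_rmax i0 q _)) => x.
  by rewrite lerD2r low.
have h2 : rmax i0 p (fun i => L * h i) <= L * h k + 0 + s i1 * ppart dp + L^-1 * C - L * h i0.
  apply: (has_mean_le (has_mean_rmax i0 p _) (has_meanB
    (has_meanD (mid dp (p k) (L * h k)) (err L)) (has_mean_cst n (L * h i0)))) => x.
  by rewrite lerD2r up.
move: h2; rewrite eqL// => h2; have := le_trans h1 h2.
by rewrite lerD2r -!addrA lerD2l lerD2l.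
Qed.

Lemma rmax_rigid p q : p i0 = 0 -> q i0 = 0 -> expansion p q ->
  rmax i0 p (fun=> 0) = rmax i0 q (fun=> 0) ->
  forall i j, enorm (p i - p j) = enorm (q i - q j).
Proof.
move=> p0 q0 pq eq i j; apply/eqP; rewrite eq_le pq /= leNgt; apply/negP => lt_ij.
have [k [m [x [y [lt_km hmk hP]]]]] :=
  exists_stretched_edge pq (ex_intro _ i (ex_intro _ j lt_ij)).
pose h l := dotp x (p l) + dotp y (q l); pose b : R := r2^-1 * r2^-1.
have b0 : 0 < b by rewrite mulr_gt0 ?invr_gt0 ?sqrt2_gt0.
have sc (v : 'I_N -> 'rV[R]_n) l : scalec b v l - scalec b v k = b *: (v l - v k).
  by rewrite scalerBr.
have : ppart (scalec b q m - scalec b q k) <= ppart (scalec b p m - scalec b p k).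
  apply: (@ppart_edge_le _ _ h) => //.
  - rewrite sc scaler_eq0 gt_eqF//=; apply/eqP => z; move: lt_km; rewrite z.
    by rewrite {2}/enorm dotp0l sqrtr0 ltNge enorm_ge0.
  - move=> l; case: (hP l) => [|[hl [s [s0 sp sq]]]]; first by left.
    by right; split=> //; exists s; rewrite !sc sp sq !scalerA mulrC.
  - move=> L L0; have := rmax_eq_shift2 p0 q0 pq eq (L *: x) (L *: y).
    suff -> : (fun l => dotp (L *: x) (p l) + dotp (L *: y) (q l)) = (fun l => L * h l) by [].
    by apply/funext => l; rewrite !dotpZl -mulrDr.
rewrite !sc !ppartZ ?(ltW b0)// ler_pM2l// leNgt => /negP; apply.
exact: ppart_lt.
Qed.

End Rigidity.

(** * Mean width as a Gaussian expectation *)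

Section Radial.
Variables (R : realType) (n : nat).
Local Notation mR := (measurableTypeR R).
Local Notation leb := (@lebesgue_measure R).
Local Notation rad := (fun v : pT R n => enorm (toV v)).

Lemma measurable_rad : measurable_fun setT rad.
Proof.
apply: (@measurableT_comp _ _ _ _ _ _ (Num.sqrt : mR -> mR)).
  by apply: continuous_measurable_fun; exact: sqrt_continuous.
by apply: measurable_sum => i; apply: measurable_funM; exact: measurable_toV.
Qed.

Lemma enormZ (s : R) (x : 'rV[R]_n) : 0 <= s -> enorm (s *: x) = s * enorm x.
Proof.
move=> s0; rewrite /enorm dotpZl dotpZr mulrA -expr2 sqrtrM ?sqr_ge0//.
by rewrite sqrtr_sqr ger0_norm.
Qed.

Lemma rad_psc (s : R) (v : pT R n) : 0 < s -> rad (psc s v) = s * rad v.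
Proof. by move=> s0 /=; rewrite toV_psc enormZ// ltW. Qed.

Definition ball_mass (F : pT R n -> R) : \bar R :=
  (\int[lam R n]_v (if rad v <= 1 then F v else 0)%:E)%E.

Lemma measurable_cut (F : pT R n -> R) (s : R) : measurable_fun setT F ->
  measurable_fun setT (fun v => if rad v <= s then F v else 0).
Proof.
move=> mF; apply: measurable_fun_ifT => //.
exact: (measurable_fun_ler measurable_rad (measurable_cst s)).
Qed.

Lemma ball_mass_scale (F : pT R n -> R) d (s : R) : measurable_fun setT F ->
  (forall v, 0 <= F v) -> (forall s v, 0 < s -> F (psc s v) = s ^+ d * F v) -> 0 < s ->
  (\int[lam R n]_v (if rad v <= s then F v else 0)%:E = (s ^+ (n + d))%:E * ball_mass F)%E.
Proof.
move=> mF F0 hF s0.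
have m1 : measurable_fun setT (fun v => (if rad v <= s then F v else 0)%:E).
  by apply/measurable_EFinP; exact: measurable_cut.
have m2 : measurable_fun setT (fun v => (if rad v <= 1 then F v else 0)%:E).
  by apply/measurable_EFinP; exact: measurable_cut.
have p1 t v : (0 <= (if rad v <= t then F v else 0)%:E)%E by rewrite lee_fin; case: ifP.
have := lam_scale s0 m1 (p1 s).
have -> : (fun v => (if rad (psc s v) <= s then F (psc s v) else 0)%:E) =
    (fun v => (s ^+ d)%:E * (if rad v <= 1 then F v else 0)%:E)%E.
  apply/funext => v; rewrite rad_psc// hF// -[X in _ <= X]mulr1 ler_pM2l//.
  by rewrite -EFinM; case: ifP => // _; rewrite mulr0.
rewrite ge0_integralZl; [|by []|exact: m2|by move=> v _; exact: p1
  |by rewrite lee_fin exprn_ge0// ltW].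
move=> /(congr1 (fun x => (s ^+ n)%:E * x)%E).
rewrite !muleA -!EFinM mulfV ?mul1e -?exprD; last by rewrite expf_neq0// gt_eqF.
by move=> <-.
Qed.

Definition unit_itv (t : R) : bool := (0 < t) && (t < 1).

(** Integrating over [t] turns these indicators of balls into a radial weight: [1 - |v|] on the unit
    ball for [rho = id], and [exp (- |v|^2 / 2)] for [gauss_radius]. *)
Definition layer (rho : R -> R) (t : R) (v : pT R n) : R :=
  if unit_itv t && (rad v <= rho t) then 1 else 0.

Lemma measurable_unit_itv d (T : measurableType d) (f : T -> R) : measurable_fun setT f ->
  measurable_fun setT (fun x => unit_itv (f x)).
Proof.
by move=> mf; apply: measurable_and; apply: measurable_fun_ltr.
Qed.

(** A layer-cake substitute for polar coordinates. After exchanging the integrals, homogeneity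
    reduces the integral over each ball to the unit ball, so the radial weight contributes a factor
    independent of [F]. *)
Lemma radial_layers (F : pT R n -> R) d (rho : R -> R) : measurable_fun setT F ->
  (forall v, 0 <= F v) -> (forall s v, 0 < s -> F (psc s v) = s ^+ d * F v) ->
  measurable_fun setT (rho : mR -> R) -> (forall t, unit_itv t -> 0 < rho t) ->
  (\int[lam R n]_v ((F v)%:E * \int[leb]_t (layer rho t v)%:E) =
   \int[leb]_t (if unit_itv t then rho t ^+ (n + d) else 0)%:E * ball_mass F)%E.
Proof.
move=> mF F0 hF mrho rho0.
have mcond : measurable_fun setT (fun w : pT R n * mR => unit_itv w.2 && (rad w.1 <= rho w.2)).
  apply: measurable_and; first exact: measurable_unit_itv.
  apply: measurable_fun_ler; first exact: (measurableT_comp measurable_rad measurable_fst).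
  exact: (measurableT_comp mrho measurable_snd).
have mlayer : measurable_fun setT (fun w : pT R n * mR => layer rho w.2 w.1).
  exact: measurable_fun_ifT.
have layer0 t v : 0 <= layer rho t v by rewrite /layer; case: ifP.
pose H (w : pT R n * mR) := (F w.1 * layer rho w.2 w.1)%:E.
have mH : measurable_fun setT H.
  apply/measurable_EFinP; apply: measurable_funM => //.
  exact: (measurableT_comp mF measurable_fst).
have H0 w : (0 <= H w)%E by rewrite lee_fin mulr_ge0.
transitivity (\int[lam R n]_v \int[leb]_t H (v, t))%E.
  apply: eq_integral => v _; rewrite -ge0_integralZl; [|by []| | |by rewrite lee_fin].
  - by apply: eq_integral => t _; rewrite -EFinM.
  - apply/measurable_EFinP; exact: (measurableT_comp mlayer (pair1_measurable v)).
  - by move=> t _; rewrite lee_fin.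
rewrite (@fubini_tonelli _ _ _ _ _ (lam R n) leb H mH H0).
have mpow : measurable_fun setT
    (fun t : mR => (if unit_itv t then rho t ^+ (n + d) else 0)%:E).
  apply/measurable_EFinP; apply: measurable_fun_ifT => //.
    exact: measurable_unit_itv.
  exact: measurable_funX.
have mass0 : (0 <= ball_mass F)%E.
  by apply: integral_ge0 => v _; rewrite lee_fin; case: ifP.
rewrite -ge0_integralZr; [|by []|exact: mpow| |exact: mass0]; last first.
  by move=> t _; rewrite lee_fin; case: ifP => // tu; rewrite exprn_ge0// ltW// rho0.
apply: eq_integral => t _; case: ifP => [tu|tu].
  rewrite -(ball_mass_scale mF F0 hF (rho0 t tu)); apply: eq_integral => v _.
  by rewrite /H /layer tu /=; case: ifP => _; rewrite ?mulr1 ?mulr0.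
rewrite mul0e; apply: integral0_eq => v _.
by rewrite /H /layer tu mulr0.
Qed.

Lemma integral_boole (i : interval R) (b : R -> bool) :
  (forall t, b t = (t \in i)) -> (\int[leb]_t (if b t then 1 else 0)%:E = leb [set` i])%E.
Proof.
move=> bi; have := @integral_indic _ mR R leb setT measurableT [set` i] (measurable_itv i).
rewrite setIT => <-; apply: eq_integral => t _; rewrite bi indicE mem_setE.
by case: (t \in i).
Qed.

Lemma layer_id (v : pT R n) :
  (\int[leb]_t (layer id t v)%:E = (if rad v <= 1 then 1 - rad v else 0)%:E)%E.
Proof.
rewrite /layer /=; have r0 := enorm_ge0 (toV v); move: (enorm (toV v)) r0 => r r0.
have [->|rn0] := eqVneq r 0.
  rewrite (@integral_boole `]0, 1[) => [|t].
    by rewrite lebesgue_measure_itv /= lte_fin ltr01 oppr0 adde0 ler01 addr0.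
  rewrite in_itv /= /unit_itv; case: (ltP 0 t) => //= t0; by rewrite (ltW t0) andbT.
have {rn0}r1 : 0 < r by rewrite lt0r rn0.
rewrite (@integral_boole `[r, 1[) => [|t].
  rewrite lebesgue_measure_itv /= lte_fin; by case: (ltgtP r 1) => // ->; rewrite subrr.
rewrite in_itv /= /unit_itv; case: (leP r t) => rt; last by rewrite andbF.
by rewrite (lt_le_trans r1 rt) andbT.
Qed.

(** The inverse of [r -> exp (- r^2 / 2)], so that its layers add up to the Gaussian weight. *)
Definition gauss_radius (t : R) : R := Num.sqrt (- 2 * ln t).

Lemma gauss_radius_gt0 t : unit_itv t -> 0 < gauss_radius t.
Proof.
by move=> /andP[t0 t1]; rewrite sqrtr_gt0 mulNr oppr_gt0 pmulr_rlt0// ln_lt0// t0.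
Qed.

Lemma measurable_gauss_radius : measurable_fun setT (gauss_radius : mR -> R).
Proof.
apply: (@measurableT_comp _ _ _ _ _ _ (Num.sqrt : mR -> mR)).
  by apply: continuous_measurable_fun; exact: sqrt_continuous.
by apply: measurable_funM => //; exact: measurable_ln.
Qed.

Lemma le_gauss_radius (r t : R) : 0 <= r -> unit_itv t ->
  (r <= gauss_radius t) = (t <= expR (- (r ^+ 2 / 2))).
Proof.
move=> r0 /andP[t0 t1].
have l0 : ln t < 0 by rewrite ln_lt0// t0.
rewrite -{1}(ger0_norm r0) -sqrtr_sqr ler_sqrt; last by rewrite nmulr_rge0 ?ltW//; lra.
by rewrite -[X in _ = (X <= _)](lnK t0) ler_expR; apply/idP/idP; lra.
Qed.

Lemma layer_gauss (v : pT R n) :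
  (\int[leb]_t (layer gauss_radius t v)%:E = (expR (- (rad v ^+ 2 / 2)))%:E)%E.
Proof.
rewrite /layer /=; have r0 := enorm_ge0 (toV v); move: (enorm (toV v)) r0 => r r0.
have [->|rn0] := eqVneq r 0.
  rewrite (@integral_boole `]0, 1[) => [|t].
    by rewrite lebesgue_measure_itv /= lte_fin ltr01 oppr0 adde0 expr0n mul0r oppr0 expR0.
  rewrite in_itv /= -/(unit_itv t); case tu : (unit_itv t) => //=.
  by rewrite ltW// gauss_radius_gt0.
have {rn0}r1 : 0 < r by rewrite lt0r rn0.
have e1 : expR (- (r ^+ 2 / 2)) < 1 by rewrite expR_lt1 oppr_lt0 divr_gt0// exprn_gt0.
rewrite (@integral_boole `]0, expR (- (r ^+ 2 / 2))]) => [|t].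
  by rewrite lebesgue_measure_itv /= lte_fin expR_gt0 oppr0 adde0.
rewrite in_itv /=; case tu : (unit_itv t); first by rewrite le_gauss_radius//; case/andP: tu => ->.
move: tu; rewrite /unit_itv; case: (ltP 0 t) => //= t0 t1.
by apply/esym/negbTE; rewrite -ltNge (lt_le_trans e1)// leNgt t1.
Qed.

End Radial.

(** * From sphere integrals to Gaussian means *)

Section Link.
Variables (R : realType) (n : nat).
Local Notation mR := (measurableTypeR R).
Local Notation leb := (@lebesgue_measure R).
Local Notation rad := (fun v : pT R n => enorm (toV v)).

Lemma norm_coord_le_enorm (x : 'rV[R]_n) i : `|x 0 i| <= enorm x.
Proof.
rewrite -sqrtr_sqr; apply: ler_wsqrtr; rewrite /dotp (bigD1 i)//= -expr2 lerDl.
by apply: sumr_ge0 => j _; rewrite -expr2 sqr_ge0.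
Qed.

Lemma enorm_le_sum (x : 'rV[R]_n) : enorm x <= \sum_i `|x 0 i|.
Proof.
rewrite -[leRHS]ger0_norm ?sumr_ge0// -sqrtr_sqr; apply: ler_wsqrtr.
rewrite expr2 mulr_suml; apply: ler_sum => i _; apply: le_trans (ler_norm _) _.
by rewrite normrM ler_wpM2l// (bigD1 i)//= lerDl sumr_ge0.
Qed.

Lemma dotp_delta (i : 'I_n) (x : 'rV[R]_n) : dotp (delta_mx 0 i) x = x 0 i.
Proof.
rewrite /dotp (bigD1 i)//= mxE !eqxx mul1r big1 ?addr0// => j /negbTE ji.
by rewrite mxE ji andbF mul0r.
Qed.

(** Positivity follows by comparison with the positive part of one coordinate. *)
Lemma has_mean_enorm : (0 < n)%N -> exists e, 0 < e /\ has_mean (@enorm R n) e.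
Proof.
move=> n0; pose i := Ordinal n0.
have [ei ee] : has_mean (@enorm R n) (fine (\int[pg R n]_v (enorm (toV v))%:E)%E).
  apply: has_mean_integrable.
  apply: (@pg_integrable_bound _ _ _ (fun i => delta_mx 0 i) _ (n%:R + 1)).
    exact: measurable_rad.
  move=> v; rewrite ger0_norm ?enorm_ge0//; apply: le_trans (enorm_le_sum _) _.
  set T := \sum_i _ ^+ 3.
  have T0 : 0 <= T by apply: sumr_ge0 => j _; rewrite exprn_ge0.
  apply: (@le_trans _ _ (n%:R + T)).
    have -> : n%:R = \sum_(i < n) (1 : R) by rewrite sumr_const card_ord.
    rewrite /T -big_split; apply: ler_sum => j _ /=.
    by rewrite dotp_delta; exact: norm_le_1norm3.
  by have := ler0n R n; nra.
exists (fine (\int[pg R n]_v (enorm (toV v))%:E)%E); split; last by split.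
apply: (@lt_le_trans _ _ (ppart (delta_mx 0 i))).
  apply: ppart_gt0; apply/eqP => /matrixP /(_ 0 i); rewrite !mxE !eqxx => /eqP.
  by rewrite oner_eq0.
apply: (has_mean_le (has_mean_ppart _) (conj ei ee)) => x.
by rewrite dotp_delta ge_max enorm_ge0 (le_trans (ler_norm _) (norm_coord_le_enorm _ _)).
Qed.

Lemma ball_integrable (F : pT R n -> R) (C : R) : measurable_fun setT F -> 0 <= C ->
  (forall v, rad v <= 1 -> `|F v| <= C) ->
  (lam R n).-integrable setT (fun v => (if rad v <= 1 then F v else 0)%:E).
Proof.
move=> mF C0 FC; apply: (@lam_integrable_box _ _ _ C).
- exact: measurable_cut.
- by move=> v; case: ifP => [/FC//|_]; rewrite normr0.
- move=> v i vi; rewrite ifF//; apply/negbTE; rewrite -ltNge.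
  exact: lt_le_trans vi (norm_coord_le_enorm _ _).
Qed.

Lemma ball_massE (F : pT R n -> R) (C : R) : measurable_fun setT F -> 0 <= C ->
  (forall v, rad v <= 1 -> `|F v| <= C) -> ball_mass F = (fine (ball_mass F))%:E.
Proof.
move=> mF C0 FC; rewrite fineK//.
by apply: (integrable_fin_num measurableT); exact: (ball_integrable mF C0 FC).
Qed.

Definition gauss_kernel : \bar R :=
  (\int[leb]_t (if unit_itv t then gauss_radius t ^+ (n + 1) else 0)%:E)%E.

Definition cone_kernel : \bar R :=
  (\int[leb]_t (if unit_itv t then (t : R) ^+ (n + 0) else 0)%:E)%E.

Lemma gauss_kernel_ge0 : (0 <= gauss_kernel)%E.
Proof.
apply: integral_ge0 => t _; rewrite lee_fin; case: ifP => // tu.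
by rewrite exprn_ge0// ltW// gauss_radius_gt0.
Qed.

Lemma cone_kernel_ge0 : (0 <= cone_kernel)%E.
Proof.
apply: integral_ge0 => t _; rewrite lee_fin; case: ifP => // /andP[t0 _].
by rewrite exprn_ge0// ltW.
Qed.

Definition degree0 (F : pT R n -> R) :=
  [/\ measurable_fun setT F, forall v, 0 <= F v & forall s v, 0 < s -> F (psc s v) = F v].

Lemma measurable_radM (F : pT R n -> R) : measurable_fun setT F ->
  measurable_fun setT (fun v => rad v * F v).
Proof. by move=> mF; apply: measurable_funM => //; exact: measurable_rad. Qed.

Lemma gauss_ball_mass (F : pT R n -> R) : degree0 F ->
  (\int[pg R n]_v (rad v * F v)%:E =
   (normal_peak 1 ^+ n)%:E * (gauss_kernel * ball_mass (fun v => rad v * F v)%R))%E.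
Proof.
move=> [mF F0 hF]; have mrF := measurable_radM mF.
have rF0 v : 0 <= rad v * F v by rewrite mulr_ge0// enorm_ge0.
rewrite pg_density; [|exact/measurable_EFinP|by move=> v; rewrite lee_fin].
rewrite -radial_layers; [|exact: mrF|exact: rF0| |exact: measurable_gauss_radius
  |exact: gauss_radius_gt0]; last first.
  by move=> s v s0; rewrite hF// rad_psc// expr1 mulrA.
rewrite -ge0_integralZl; [| by []| | |]; last first.
- by rewrite lee_fin exprn_ge0// normal_peak_ge0.
- by move=> v _; rewrite layer_gauss mule_ge0// lee_fin// expR_ge0.
- under eq_fun do rewrite layer_gauss.
  apply: emeasurable_funM; first exact/measurable_EFinP.
  apply/measurable_EFinP; apply: (measurableT_comp (@measurable_expR R)).
  apply: measurableT_comp => //.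
  by apply: measurable_funM => //; apply: measurable_funX; exact: measurable_rad.
apply: eq_integral => v _; rewrite layer_gauss gwtE sqr_enorm -!EFinM; congr (_%:E).
by rewrite mulrCA.
Qed.

(** Splits [F] on the unit ball as [|v| F + (1 - |v|) F] and reads the second weight as a layer
    integral. It exchanges the degree-one integrand of the Gaussian side for the degree-zero
    integrand of the cone formula in [sphere_int]. *)
Lemma cone_ball_mass (F : pT R n -> R) : degree0 F ->
  (ball_mass (fun v => rad v * F v)%R + cone_kernel * ball_mass F = ball_mass F)%E.
Proof.
move=> [mF F0 hF]; have mrF := measurable_radM mF.
rewrite -radial_layers; [|exact: mF|exact: F0| |exact: measurable_id|by move=> t /andP[]];
  last by move=> s v s0; rewrite hF// mul1r.
have mid : measurable_fun setT (fun v => if rad v <= 1 then 1 - rad v else 0).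
  by apply: measurable_cut; apply: measurable_funB => //; exact: measurable_rad.
rewrite /ball_mass -ge0_integralD; [|by []| | | |]; last first.
- under eq_fun do rewrite layer_id.
  by apply: emeasurable_funM; exact/measurable_EFinP.
- by move=> v _; rewrite layer_id mule_ge0// lee_fin//; case: ifP => //; rewrite subr_ge0.
- by apply/measurable_EFinP; exact: measurable_cut.
- by move=> v _; rewrite lee_fin; case: ifP => // _; rewrite mulr_ge0// enorm_ge0.
apply: eq_integral => v _; rewrite layer_id -EFinM -EFinD; congr (_%:E).
by case: ifP => _; ring.
Qed.

(* No explicit value of the two kernels is needed: finiteness and positivity are read off
   from the case [F = 1], where the Gaussian side is the positive real [E |x|]. *)
Lemma gauss_mean_degree0 : (0 < n)%N -> exists k : R, 0 < k /\
  forall (F : pT R n -> R) C, degree0 F -> (forall v, F v <= C) ->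
  (\int[pg R n]_v (rad v * F v)%:E = k%:E * ball_mass F)%E.
Proof.
move=> n0; have [e [e0 [_ eE]]] := has_mean_enorm n0.
pose one (v : pT R n) : R := 1.
have mone : measurable_fun setT one by exact: measurable_cst.
have d1 : degree0 one by split=> // v; exact: ler01.
have r1 v : rad v <= 1 -> `|rad v * one v| <= 1.
  by move=> v1; rewrite mulr1 ger0_norm// enorm_ge0.
have Mr := ball_massE (measurable_radM mone) ler01 r1.
have M1 : ball_mass one = (fine (ball_mass one))%:E.
  by apply: (ball_massE mone ler01) => v _; rewrite normr1.
have := gauss_ball_mass d1; have := cone_ball_mass d1.
have -> : (\int[pg R n]_v (rad v * one v)%:E)%E = e%:E.
  by rewrite -eE; apply: eq_integral => v _; rewrite mulr1.
have : (0 <= ball_mass (fun v => rad v * one v)%R)%E.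
  by apply: integral_ge0 => v _; rewrite lee_fin; case: ifP => // _; rewrite mulr1 enorm_ge0.
have : (0 <= ball_mass one)%E.
  by apply: integral_ge0 => v _; rewrite lee_fin; case: ifP => // _; exact: ler01.
rewrite Mr M1 !lee_fin.
move: (fine (ball_mass (fun v => rad v * one v)%R)) (fine (ball_mass one)) => a m m0 a0.
have pk0 : 0 < normal_peak 1 ^+ n :> R by rewrite exprn_gt0// normal_peak_gt0// oner_eq0.
have := gauss_kernel_ge0; have := cone_kernel_ge0.
case gE : gauss_kernel => [g| |] //; last first.
  move=> _ _ _; have [->|an0] := eqVneq a 0.
    by rewrite mule0 mule0 => -[] /eqP; rewrite gt_eqF.
  by rewrite gt0_mulye ?lte_fin ?lt0r ?an0// gt0_muley// lte_fin.
case bE : cone_kernel => [b| |] //; last first.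
  move=> _ g0 + ; rewrite -!EFinM => + [] => /[swap] ae.
  have an0 : a != 0 by apply: contraTneq e0 => a_0; rewrite ae a_0 !mulr0 ltxx.
  have [->|mn0] := eqVneq m 0.
    by rewrite mule0 adde0 => -[] /eqP; rewrite (negbTE an0).
  by rewrite gt0_mulye// lte_fin lt0r mn0.
rewrite !lee_fin => b0 g0; rewrite -!EFinM -EFinD => -[] am [] ae.
have abm : a = (1 - b) * m by rewrite mulrBl mul1r -[X in X - _]am addrK.
(* By [cone_ball_mass], multiplying the ball mass of [F] by [1 - b] gives that of [rad * F]; the
   other factors come from [gauss_ball_mass]. *)
pose k := normal_peak 1 ^+ n * g * (1 - b).
have km : k * m = e by rewrite ae abm /k; ring.
have k0 : 0 < k.
  have kn0 : k != 0 by apply: contraTneq e0 => k_0; rewrite -km k_0 mul0r ltxx.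
  rewrite lt0r kn0 /=; have mn0 : m != 0.
    by apply: contraTneq e0 => m_0; rewrite -km m_0 mulr0 ltxx.
  by rewrite -(pmulr_lge0 _ (_ : 0 < m)) ?lt0r ?mn0// km ltW.
exists k; split=> // F C dF FC; have [mF F0 hF] := dF.
have C0 : 0 <= C := le_trans (F0 point) (FC point).
have FC1 v : rad v <= 1 -> `|F v| <= C by rewrite ger0_norm.
have rFC v : rad v <= 1 -> `|rad v * F v| <= C.
  move=> v1; rewrite ger0_norm ?mulr_ge0 ?enorm_ge0//; apply: le_trans (FC v).
  by rewrite ler_piMl.
have := cone_ball_mass dF; rewrite (gauss_ball_mass dF) gE bE.
rewrite (ball_massE mF C0 FC1) (ball_massE (measurable_radM mF) C0 rFC).
move: (fine _) (fine _) => y x; rewrite -!EFinM -EFinD => -[] xy; congr (_%:E).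
have -> : x = (1 - b) * y by rewrite mulrBl mul1r -[X in X - _]xy addrK.
by rewrite /k; ring.
Qed.

Lemma measurable_inv_rad : measurable_fun setT (fun v : pT R n => (rad v)^-1).
Proof.
under eq_fun do rewrite -powR_inv1 ?enorm_ge0//.
apply: (@measurableT_comp _ _ _ _ _ _ (fun x : mR => x `^ (-1) : mR)).
  exact: measurable_powR.
exact: measurable_rad.
Qed.

(** The layer formulas need nonnegative functions, while [h] may change sign. A constant [D]
    bounding [h x / |x|] is therefore added, and its contribution, known from the constant case, is
    cancelled at the end. *)
Lemma sphere_int_mean : (0 < n)%N -> exists k : R, 0 < k /\
  forall (h : 'rV[R]_n -> R) C e,
    (forall s x, 0 < s -> h (s *: x) = s * h x) -> (forall x, `|h x| <= C * enorm x) ->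
    measurable_fun setT (fun v : pT R n => h (toV v)) -> has_mean h e ->
  sphere_int h = (k * e)%:E.
Proof.
move=> n0; have [k [k0 kP]] := gauss_mean_degree0 n0.
have [er [er0 mer]] := has_mean_enorm n0.
(* The numerator is the factor of the cone formula; [k] converts ball masses into Gaussian means. *)
exists (n%:R / k); split; first by rewrite divr_gt0// ltr0n.
move=> h C e hom hC mh me; rewrite /sphere_int.
pose f (x : 'rV[R]_n) := if enorm x <= 1 then h x / enorm x else 0.
have h0 : h 0 = 0.
  by apply/eqP; rewrite -normr_le0; have := hC 0; rewrite /enorm dotp0l sqrtr0 mulr0.
have -> : (fun x : 'rV[R]_n => if (x != 0) && (enorm x <= 1)
    then (h ((enorm x)^-1 *: x))%:E else 0%E) = (fun x => (f x)%:E).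
  apply/funext => x; rewrite /f; have [->|x0] := eqVneq x 0; first by rewrite h0 mul0r if_same.
  have ex0 : 0 < (enorm x)^-1 by rewrite invr_gt0 lt0r enorm_eq0 x0 enorm_ge0.
  by rewrite (hom _ _ ex0) mulrC /=; case: ifP.
pose D := `|C|.
have D0 : 0 <= D by exact: normr_ge0.
have hD x : `|h x / enorm x| <= D.
  rewrite normrM normfV (ger0_norm (enorm_ge0 x)); have [x0|x0] := eqVneq (enorm x) 0.
    by rewrite x0 invr0 mulr0.
  have xp : 0 < enorm x by rewrite lt0r x0 enorm_ge0.
  by rewrite ler_pdivrMr// (le_trans (hC x))// ler_pM2r// ler_norm.
have mhr : measurable_fun setT (fun v : pT R n => h (toV v) / rad v).
  by apply: measurable_funM => //; exact: measurable_inv_rad.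
have mf : measurable_fun setT (fun v : pT R n => f (toV v)) by exact: measurable_cut.
rewrite (@leb_intE _ _ _ D mf); last 2 first.
- by move=> x; rewrite /f; case: ifP => // _; rewrite normr0.
- move=> x i xi; rewrite /f ifF//; apply/negbTE; rewrite -ltNge.
  exact: lt_le_trans xi (norm_coord_le_enorm _ _).
have dF : degree0 (fun v => h (toV v) / rad v + D).
  split; first exact: measurable_funD.
  - by move=> v; have := hD (toV v); rewrite ler_norml => /andP[+ _]; rewrite -lerBlDr sub0r.
  - move=> s v s0; rewrite rad_psc// toV_psc hom//; congr (_ + _).
    by rewrite invfM mulrACA divff ?mul1r// gt_eqF.
have FC (v : pT R n) : h (toV v) / rad v + D <= 2 * D.
  by have := hD (toV v); rewrite ler_norml => /andP[_ +]; lra.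
have := kP _ _ dF FC.
have -> : (\int[pg R n]_v (rad v * (h (toV v) / rad v + D))%:E = (e + D * er)%:E)%E.
  have [_ <-] := has_meanD me (has_meanZ D mer); apply: eq_integral => v _; congr (_%:E).
  have [x0|x0] := eqVneq (enorm (toV v)) 0; last by rewrite mulrDr mulrCA divff// mulr1 mulrC [X in _ + X]mulrC.
  have : `|h (toV v)| <= 0 by have := hC (toV v); rewrite x0 mulr0.
  by rewrite normr_le0 => /eqP ->; rewrite x0 !mul0r !add0r !mulr0.
have fint : (lam R n).-integrable setT (fun v => (if rad v <= 1 then h (toV v) / rad v else 0)%:E).
  by apply: (ball_integrable mhr D0) => v _.
have cint : (lam R n).-integrable setT (fun v => (if rad v <= 1 then D else 0)%:E).
  by apply: (ball_integrable (measurable_cst D) D0) => v _; rewrite ger0_norm.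
have -> : (ball_mass (fun v => h (toV v) / rad v + D)%R = \int[lam R n]_v (f (toV v))%:E +
    \int[lam R n]_v (if rad v <= 1 then D else 0)%:E)%E.
  rewrite /ball_mass -(integralD measurableT fint cint); apply: eq_integral => v _.
  by rewrite -EFinD /f; case: ifP => // _; rewrite addr0.
have dD : degree0 (fun=> D) by split=> //; exact: measurable_cst.
have := kP _ D dD (fun=> lexx _).
have -> : (\int[pg R n]_v (rad v * D)%:E = (D * er)%:E)%E.
  by have [_ <-] := has_meanZ D mer; apply: eq_integral => v _; rewrite mulrC.
rewrite -[ball_mass _]/(\int[lam R n]_v (if rad v <= 1 then D else 0)%:E)%E.
have <- := fineK (integrable_fin_num measurableT cint).
have <- : (fine (\int[lam R n]_v (f (toV v))%:E)%E)%:E = (\int[lam R n]_v (f (toV v))%:E)%E.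
  exact: (fineK (integrable_fin_num measurableT fint)).
move: (fine _) (fine _) => x y; rewrite -EFinD -!EFinM => -[] ex [] ey; congr (_%:E).
have -> : e = k * x by apply: (addIr (D * er)); rewrite ey ex; ring.
by rewrite mulrA divfK// gt_eqF.
Qed.

End Link.

(** * Mean width of a convex hull *)

Section MeanWidth.
Variables (R : realType) (n N : nat) (i0 : 'I_N).
Implicit Types p q : 'I_N -> 'rV[R]_n.

Lemma support_conv_hull p u :
  support_fun (conv_hull p) u = maxc i0 (fun i => dotp (p i) u).
Proof.
have ub : ubound [set dotp x u | x in conv_hull p] (maxc i0 (fun i => dotp (p i) u)).
  move=> _ [x [l [l0 [l1 ->]]] <-]; rewrite dotp_suml.
  under eq_bigr do rewrite dotpZl.
  by apply: weighted_mean_le => // i; exact: (maxc_ge i0 (fun i => dotp (p i) u)).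
have [k kE] := maxc_attained i0 (fun i => dotp (p i) u).
have mem : [set dotp x u | x in conv_hull p] (dotp (p k) u).
  exists (p k) => //; exists (fun i => (i == k)%:R); split; first by move=> i; exact: ler0n.
  split; first by rewrite (bigD1 k)//= eqxx big1 ?addr0// => i /negbTE ->.
  rewrite (bigD1 k)//= eqxx scale1r big1 ?addr0// => i /negbTE ->.
  by rewrite scale0r.
apply/eqP; rewrite eq_le; apply/andP; split.
  by apply: ge_sup => //; exists (dotp (p k) u).
by rewrite kE; apply: ub_le_sup => //; exists (maxc i0 (fun i => dotp (p i) u)).
Qed.

Lemma mean_width_conv_hull : (0 < n)%N -> exists k : R, 0 < k /\ forall p,
  mean_width (conv_hull p) = (k * rmax i0 (fun i => p i - p i0) (fun=> 0))%:E.
Proof.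
move=> n0; have [k [k0 kP]] := sphere_int_mean R n0; exists k; split=> // p.
have -> : mean_width (conv_hull p) = sphere_int (fun u => maxc i0 (fun i => dotp (p i) u)).
  by rewrite /mean_width; congr sphere_int; apply/funext => u; exact: support_conv_hull.
apply: (kP _ ((\sum_i \sum_j `|p i 0 j|) * n%:R)).
- move=> s x s0; rewrite -maxcZ ?(ltW s0)//; congr maxc.
  by apply/funext => i; rewrite dotpZr.
- move=> x; have [m ->] := maxc_attained i0 (fun i => dotp (p i) x).
  apply: le_trans (norm_dotp_le _ _) _; rewrite -mulrA; apply: ler_pM.
  + by apply: sumr_ge0.
  + by apply: sumr_ge0.
  + by rewrite [leRHS](bigD1 m)//= lerDl; apply: sumr_ge0 => i _; apply: sumr_ge0.
  + rewrite mulr_natl -[X in _ *+ X]card_ord -sumr_const; apply: ler_sum => j _.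
    exact: norm_coord_le_enorm.
- by apply: measurable_maxc => i; exact: measurable_dotp.
(* Translating by [p i0] changes the maximum by the linear form of [p i0], whose Gaussian mean is
   zero; this supplies the normalisation at the origin. *)
- have := has_meanD (has_mean_rmax i0 (fun i => p i - p i0) (fun=> 0)) (has_mean_dotp (p i0)).
  rewrite addr0; congr has_mean; apply/funext => x; rewrite subr0.
  apply/eqP; rewrite eq_le; apply/andP; split.
    rewrite -lerBrDr; apply: maxc_le => i; rewrite /shiftc add0r dotpBl lerD2r.
    exact: (maxc_ge i0 (fun i => dotp (p i) x)).
  apply: maxc_le => i; rewrite -lerBlDr.
  have := maxc_ge i0 (shiftc (fun=> 0) (fun i => p i - p i0) x) i.
  by rewrite {1}/shiftc add0r dotpBl.
Qed.

End MeanWidth.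

Theorem theorem3 (R : realType) (n N : nat) (p q : 'I_N -> 'rV[R]_n) :
  (2 <= n)%N ->
  (forall i j : 'I_N, (i < j)%N -> enorm (p i - p j) <= enorm (q i - q j)) ->
  (mean_width (conv_hull p) <= mean_width (conv_hull q))%E /\
  (~ congruent p q -> (mean_width (conv_hull p) < mean_width (conv_hull q))%E).
Proof.
move=> n2 pq; have n0 : (0 < n)%N by exact: leq_trans n2.
(* Without points the two families coincide and are congruent by the identity; otherwise the first
   point serves as the base point. *)
case: N p q pq => [p q _|N p q pq].
  have -> : p = q by apply/funext => -[].
  by split=> // ncong; exfalso; apply: ncong; exists id; split=> [x y|[]].
have pq' i j : enorm (p i - p j) <= enorm (q i - q j).
  have [ij|ji|/val_inj ->] := ltngtP i j; first exact: pq.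
    by rewrite enormBC (enormBC (q i)) pq.
  by rewrite !subrr.
pose centered (r : 'I_N.+1 -> 'rV[R]_n) i := r i - r ord0.
have c0 r : centered r ord0 = 0 by rewrite /centered subrr.
have cB r i j : centered r i - centered r j = r i - r j.
  by rewrite /centered opprB addrA subrK.
have cpq : expansion (centered p) (centered q) by move=> i j; rewrite !cB.
have [k [k0 kE]] := mean_width_conv_hull R (ord0 : 'I_N.+1) n0; rewrite !kE.
have le_pq := rmax_le (fun=> 0) (c0 p) (c0 q) cpq.
split; first by rewrite lee_fin ler_pM2l.
move=> ncong; rewrite lte_fin ltr_pM2l// lt_neqAle le_pq andbT; apply/eqP => eq_pq.
apply: ncong; apply: congruent_of_equal_distances => i j.
by have := rmax_rigid (c0 p) (c0 q) cpq eq_pq i j; rewrite !cB.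
Qed.
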